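(* Assume $\mathfrak g$ is of type $A(m,n)$, $B(m,n+1)$, $C(n+1)$ or $D(m,n+1)$ with an arbitrary simple system, or of type $F(3|1)$ or $G(3)$ with the distinguished simple system, and fix an arbitrary total order on $I$. Then for every $\mathbf i\in\mathsf W^+$, $$\max(r_{\mathbf i})=\max(\mathrm E_{\mathbf i})=\mathbf i .$$
   Context: Let $\mathfrak g$ be a basic Lie superalgebra with a fixed simple system $\Pi=\{\alpha_i\mid i\in I\}$, parity $p(i)\in\{0,1\}$, $Q^+=\bigoplus\mathbb Z_{\ge0}\alpha_i$ with parity $p(\sum c_i\alpha_i)=\sum c_ip(i)\bmod2$, $(\cdot,\cdot)$ the symmetric bilinear form with $(\alpha_i,\alpha_j)=d_ia_{ij}$ ($d_i>0$, $\gcd(d_i)=1$). $\Phi$ is the reduced root system, $\Phi^+$ its positive roots; an odd root $\beta$ is isotropic if $(\beta,\beta)=0$. The distinguished simple system of $F(3|1)$: nodes $1,2,3$ even and $4$ isotropic odd, with a single bond $1$–$2$, a double bond $2$–$3$ (arrow towards 3) and a single bond $3$–$4$. The distinguished simple system of $G(3)$: node $1$ isotropic odd, $2,3$ even, single bond $1$–$2$, triple bond $2$–$3$. $\pi:=-1$, $q$ an indeterminate; $U_q$ is the positive half of the associated quantum supergroup. $\mathsf F$: free associative $\mathbb Q(q)$-algebra on $I$ with basis the words $\mathbf i=(i_1,\dots,i_d)$, weight $|\mathbf i|=\sum\alpha_{i_s}$, parity $\sum p(i_s)$. For $v\in\mathbb Q(q)^\times$: $x\diamond_v\emptyset=\emptyset\diamond_vx=x$,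 $(xi)\diamond_v(yj)=(x\diamond_v(yj))i+\pi^{(p(x)+p(i))p(j)}v^{-(|x|+\alpha_i,\alpha_j)}((xi)\diamond_vy)j$; $x\star y:=x\diamond_qy$, $x\star_{q,q^{-1}}y:=x\diamond_qy-x\diamond_{q^{-1}}y$. $\Psi:U_q\to(\mathsf F,\star)$ is the injective algebra homomorphism with $\Psi(e_i)=i$, $\mathsf U:=\Psi(U_q)$. Words are ordered lexicographically ($\mathbf i<\mathbf j$ if $\mathbf i$ is a proper prefix of $\mathbf j$, or at the first differing position $s$, $i_s<j_s$); $\max(x)$ = largest word with nonzero coefficient. Dominant word: $\max(u)$ for some $u\in\mathsf U$; $\mathsf W^+$ dominant words; Lyndon: smaller than all proper right factors; $\mathsf L^+$ dominant Lyndon words. Co-standard factorization of a Lyndon word: $\mathbf i=\mathbf i_1\mathbf i_2$, $\mathbf i_1$ Lyndon of maximal length. Canonical factorization: $\mathbf i=\mathbf i_1^{n_1}\cdots\mathbf i_d^{n_d}$, $\mathbf i_1>\cdots>\mathbf i_d$ Lyndon (in $\mathsf L^+$ if $\mathbf i$ is dominant). Lyndon basis: $r_i=i$, $r_{\mathbf i}=r_{\mathbf i_1}\star_{q,q^{-1}}r_{\mathbf i_2}$ for $\mathbf i\in\mathsf L^+$ (co-standard factorization), $r_{\mathbf i}=r_{\mathbf i_1}^{\star n_1}\star\cdots\star r_{\mathbf i_d}^{\star n_d}$ for $\mathbf i\in\mathsf W^+$. Bar map: $\mathbb Q$-linear on $\mathsf F$, $\bar q=\pi q^{-1}$ in type $B(0,n+1)$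 and $\bar q=q^{-1}$ otherwise, $\overline{(i_1,\dots,i_d)}=\pi^{\sum_{s<t}p(i_s)p(i_t)}q^{-\sum_{s<t}(\alpha_{i_s},\alpha_{i_t})}(i_d,\dots,i_1)$; $\tau$ = $\mathbb Q(q)$-linear word reversal; $\sigma(x)=\overline{\tau(x)}$. Quantum numbers: $q_i=q^{d_i}$; $[n]_i=\frac{q_i^n-q_i^{-n}}{q_i-q_i^{-1}}$ if $i$ is even or isotropic, $[n]_i=\frac{\pi^nq_i^n-q_i^{-n}}{\pi q_i-q_i^{-1}}$ if $i$ is odd non-isotropic; $\{n\}_i=\frac{\pi^nq_i^n-q_i^{-n}}{\pi q_i-q_i^{-1}}$. For $\beta\in\Phi^+$, pick $i$ with $(\beta,\beta)=(\alpha_i,\alpha_i)$ and set $[n]_\beta=[n]_i$ if $\beta$ is even or isotropic odd, $[n]_\beta=\{n\}_i$ if $\beta$ is odd non-isotropic; $[n]_\beta!=\prod_{k=1}^n[k]_\beta$. PBW vectors: for $\mathbf i\in\mathsf L^+$ define $\kappa_{\mathbf i}$ by $\kappa_i=1$ for letters and, for co-standard factorization $\mathbf i=\mathbf i_1\mathbf i_2$ with $\beta_k=|\mathbf i_k|$, $\kappa_{\mathbf i}=[p_{\mathbf i}+1]_{\beta_r}\kappa_{\mathbf i_1}\kappa_{\mathbf i_2}$ where $p_{\mathbf i}=\max\{p\ge0\mid\beta_1-p\beta_2\in\Phi^+\}$ and $\beta_r\in\{\beta_1,\beta_2\}$ has $(\beta_r,\beta_r)=\min((\beta_1,\beta_1),(\beta_2,\beta_2))$.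 Set $\mathrm E_{\mathbf i}=\kappa_{\mathbf i}^{-1}\sigma(r_{\mathbf i})$ for $\mathbf i\in\mathsf L^+$, $\mathrm E^{(n)}_{\mathbf j}=\mathrm E_{\mathbf j}^{\star n}/[n]_{|\mathbf j|}!$, and for $\mathbf i\in\mathsf W^+$ with canonical factorization $\mathbf i_1^{n_1}\cdots\mathbf i_d^{n_d}$ ($\mathbf i_1>\cdots>\mathbf i_d$), $\mathrm E_{\mathbf i}=\mathrm E_{\mathbf i_d}^{(n_d)}\star\cdots\star\mathrm E_{\mathbf i_1}^{(n_1)}$; $\mathrm E_\emptyset=1$. *)

(* Defs.v *)
From HB Require Import structures.
From mathcomp Require Import all_boot all_order all_algebra.
From mathcomp Require Import fraction fingroup perm.
From Stdlib Require Import ClassicalEpsilon.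

Set Implicit Arguments.
Unset Strict Implicit.
Unset Printing Implicit Defensive.

Import Order.TTheory GRing.Theory Num.Theory.
Local Open Scope ring_scope.

Notation Kq := {fraction {poly rat}}.

Definition qq : Kq := FracField.tofrac 'X.

Definition evK (c : Kq) (p : {poly rat}) : Kq := (map_poly ratr p).[c].

(* The Q-linear field automorphism of Q(q) with q |-> q^{-1}
   (resp. q |-> pi q^{-1} = - q^{-1} when bp = true, type B(0,n+1)),
   computed on any representative numerator/denominator. *)
Definition barK (bp : bool) (x : Kq) : Kq :=
  let c := (if bp then -1 else 1) * qq^-1 in
  let r := generic_quotient.repr x in evK c (frac r).1 / evK c (frac r).2.

Record datum (n : nat) := Datum {
  gram : 'I_n -> 'I_n -> int;
  par : 'I_n -> bool;
  posroot : ('I_n -> int) -> bool;        (* beta = sum c_i alpha_i in Phi^+ *)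
  barpi : bool                            (* true iff type B(0,n+1)        *)
}.

Section Shuffle.
Variables (n : nat) (D : datum n).

Definition word := seq 'I_n.

(* elements of F: formal finite Q(q)-linear combinations of words *)
Definition fsum := seq (Kq * word).

Definition coef (x : fsum) (w : word) : Kq := \sum_(p <- x | p.2 == w) p.1.
Definition scale (c : Kq) (x : fsum) : fsum := [seq (c * p.1, p.2) | p <- x].
Definition one : fsum := [:: (1, [::])].
Definition letter (i : 'I_n) : fsum := [:: (1, [:: i])].
Definition app (i : 'I_n) (x : fsum) : fsum := [seq (p.1, rcons p.2 i) | p <- x].

Definition wpar (w : word) : bool := odd (count (par D) w).
Definition wform (w : word) (j : 'I_n) : int := \sum_(k <- w) gram D k j.

(* (x i) <>_v (y j), words given reversed: rx = rev (x i), ry = rev (y j) *)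
Fixpoint shr (v : Kq) (rx ry : word) {struct rx} : fsum :=
  match rx with
  | [::] => [:: (1, rev ry)]
  | i :: rx' =>
    let fix sh2 (ry : word) : fsum :=
      match ry with
      | [::] => [:: (1, rev rx)]
      | j :: ry' =>
          app i (shr v rx' ry) ++
          scale ((if wpar (rev rx) && par D j then -1 else 1)
                   * v ^ (- wform (rev rx) j))
                (app j (sh2 ry'))
      end in sh2 ry
  end.

Definition diamond (v : Kq) (x y : fsum) : fsum :=
  flatten [seq scale (a.1 * b.1) (shr v (rev a.2) (rev b.2)) | a <- x, b <- y].

Definition star (x y : fsum) : fsum := diamond qq x y.
Definition starqq (x y : fsum) : fsum :=
  diamond qq x y ++ scale (-1) (diamond qq^-1 x y).

Fixpoint prodl (xs : seq fsum) : fsum :=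
  match xs with
  | [::] => one
  | [:: x] => x
  | x :: xs' => star x (prodl xs')
  end.

(* U = Psi(U_q): the subalgebra of (F, star) generated by the letters,
   i.e. the Q(q)-span of star-monomials in the letters *)
Definition mon (w : word) : fsum := prodl [seq letter i | i <- w].
Definition inU (u : fsum) : Prop :=
  exists s : seq (Kq * word),
    forall w, coef u w = coef (flatten [seq scale p.1 (mon p.2) | p <- s]) w.

Fixpoint wlt (x y : word) : bool :=
  match x, y with
  | [::], [::] => false
  | [::], _ :: _ => true
  | _ :: _, [::] => false
  | a :: x', b :: y' => ((a : nat) < b)%N || ((a == b) && wlt x' y')
  end.
Definition wle (x y : word) : bool := (x == y) || wlt x y.

Definition ismax (x : fsum) (w : word) : Prop :=
  coef x w != 0 /\ forall w', coef x w' != 0 -> wle w' w.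

Definition dominant (w : word) : Prop := exists u, inU u /\ ismax u w.

Definition lyndon (w : word) : bool :=
  (w != [::]) && all (fun k => wlt w (drop k w)) (iota 1 (size w).-1).

Definition costd (w : word) : nat :=
  (\max_(k <- iota 1 (size w).-1 | lyndon (take k w)) k)%N.

Definition cfl (w : word) : seq word :=
  epsilon (inhabits [::]) (fun ls : seq word =>
    [/\ all lyndon ls, sorted (fun a b => wle b a) ls & flatten ls = w]).

Fixpoint grp (ls : seq word) : seq (word * nat) :=
  match ls with
  | [::] => [::]
  | l :: ls' =>
      match grp ls' with
      | (l', k) :: g => if l' == l then (l, k.+1) :: g else (l, 1%N) :: (l', k) :: g
      | [::] => [:: (l, 1%N)]
      end
  end.

Fixpoint rLf (fuel : nat) (w : word) : fsum :=
  match fuel with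
  | 0%N => [::]
  | f.+1 => if (size w <= 1)%N then [:: (1, w)]
            else starqq (rLf f (take (costd w) w)) (rLf f (drop (costd w) w))
  end.
Definition rL (w : word) : fsum := rLf (size w) w.
Definition rW (w : word) : fsum := prodl [seq rL l | l <- cfl w].

Definition wt (w : word) : 'I_n -> int := fun i => (count_mem i w)%:Z.
Definition bform (a b : 'I_n -> int) : int :=
  \sum_(i < n) \sum_(j < n) a i * b j * gram D i j.
Definition rpar (b : 'I_n -> int) : bool :=
  odd (absz (\sum_(i < n | par D i) b i)).
Definition isotropic (b : 'I_n -> int) : bool := rpar b && (bform b b == 0).

Definition dbeta (b : 'I_n -> int) : nat :=
  if isotropic b then 1%N else (absz (bform b b) %/ 2)%N.
Definition qnum (oddni : bool) (d m : nat) : Kq :=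
  if oddni then ((-1) ^+ m * qq ^+ (d * m) - qq ^- (d * m)) / (- qq ^+ d - qq ^- d)
  else (qq ^+ (d * m) - qq ^- (d * m)) / (qq ^+ d - qq ^- d).
Definition qnb (b : 'I_n -> int) (m : nat) : Kq :=
  qnum (rpar b && ~~ isotropic b) (dbeta b) m.
Definition qfact (b : 'I_n -> int) (m : nat) : Kq :=
  \prod_(1 <= k < m.+1) qnb b k.

Fixpoint kapf (fuel : nat) (w : word) : Kq :=
  match fuel with
  | 0%N => 1
  | f.+1 =>
    if (size w <= 1)%N then 1 else
    let w1 := take (costd w) w in
    let w2 := drop (costd w) w in
    let b1 := wt w1 in
    let b2 := wt w2 in
    let p := (\max_(p < (size w1).+1 |
                 posroot D (fun i => (b1 i - (p : nat)%:Z * b2 i)%R)) (p : nat))%N in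
    let br := if bform b1 b1 <= bform b2 b2 then b1 else b2 in
    qnb br p.+1 * kapf f w1 * kapf f w2
  end.
Definition kap (w : word) : Kq := kapf (size w) w.

Fixpoint pairform (w : word) : int :=
  match w with
  | [::] => 0
  | a :: w' => \sum_(b <- w') gram D a b + pairform w'
  end.
Fixpoint oddpairs (w : word) : nat :=
  match w with
  | [::] => 0%N
  | a :: w' => ((if par D a then count (par D) w' else 0) + oddpairs w')%N
  end.
Definition barF (x : fsum) : fsum :=
  [seq (barK (barpi D) p.1 * ((-1) ^+ oddpairs p.2 * qq ^ (- pairform p.2)), rev p.2)
  | p <- x].
Definition tauF (x : fsum) : fsum := [seq (p.1, rev p.2) | p <- x].
Definition sigmaF (x : fsum) : fsum := barF (tauF x).

Definition EL (w : word) : fsum := scale (kap w)^-1 (sigmaF (rL w)).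
Definition Edp (l : word) (m : nat) : fsum :=
  scale (qfact (wt l) m)^-1 (prodl (nseq m (EL l))).
Definition EW (w : word) : fsum :=
  prodl (rev [seq Edp g.1 g.2 | g <- grp (cfl w)]).

End Shuffle.

Definition dequiv n (D1 D2 : datum n) : Prop :=
  [/\ forall i j, gram D1 i j = gram D2 i j,
      forall i, par D1 i = par D2 i,
      forall c, posroot D1 c = posroot D2 c
    & barpi D1 = barpi D2].

(* families A, B, C/D realised in an ambient lattice Z^N with basis
   e_a of kind "epsilon" (kd a = false) or "delta" (kd a = true) *)
Inductive ftype := TA | TB | TCD.
Definition ftype_eqb (s t : ftype) : bool :=
  match s, t with TA, TA | TB, TB | TCD, TCD => true | _, _ => false end.

Section Ambient.
Variables (N : nat) (kd : 'I_N -> bool).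

Definition evec (a : 'I_N) : 'I_N -> int := fun b => if a == b then 1 else 0.

Definition isroot_amb (t : ftype) (v : 'I_N -> int) : bool :=
  match [seq a <- enum 'I_N | v a != 0] with
  | [:: a; b] => if t is TA then v a * v b == -1
                 else (v a * v a == 1) && (v b * v b == 1)
  | [:: a] => (ftype_eqb t TB && (v a * v a == 1))
              || (~~ ftype_eqb t TA && kd a && (v a * v a == 4))
  | _ => false
  end.

Definition sdiffs (ord : seq 'I_N) (sg : 'I_N -> int) : seq ('I_N -> int) :=
  [seq (fun c => sg x.1 * evec x.1 c - sg x.2 * evec x.2 c) | x <- zip ord (behead ord)].

Definition sroots (t : ftype) (ord : seq 'I_N) (sg : 'I_N -> int) : seq ('I_N -> int) :=
  sdiffs ord sg ++
  match t with
  | TA => [::]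
  | TB => if rev ord is l :: _ then [:: fun c => sg l * evec l c] else [::]
  | TCD => if rev ord is l :: l' :: _ then
             [:: if kd l then (fun c => 2 * sg l * evec l c)
                 else (fun c => sg l' * evec l' c + sg l * evec l c)]
           else [::]
  end.

Definition amb_datum (n : nat) (t : ftype) (ws : int) (L : seq ('I_N -> int))
  (s : {perm 'I_n}) (bp : bool) : datum n :=
  let alpha := fun i : 'I_n => nth (fun _ => 0) L (s i) in
  let w := fun a : 'I_N => if kd a then - ws else ws in
  {| gram := fun i j => \sum_(a < N) w a * alpha i a * alpha j a;
     par := fun i => odd (absz (\sum_(a < N | kd a) alpha i a));
     posroot := fun c => [forall i, 0 <= c i]
                         && isroot_amb t (fun a => \sum_(i < n) c i * alpha i a);
     barpi := bp |}.
End Ambient.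

(* datum D is (a relabelling of) a simple system of type A(m,n), B(m,n+1),
   C(n+1) or D(m,n+1) *)
Definition family_datum (n : nat) (D : datum n) : Prop :=
  exists (t : ftype) (m k N : nat) (kd : 'I_N -> bool) (ord : seq 'I_N)
         (sg : 'I_N -> int) (s : {perm 'I_n}),
    [/\ perm_eq ord (enum 'I_N),
        forall a, sg a = 1 \/ sg a = -1,
        size (sroots kd t ord sg) = n,
        match t with
        | TA => [/\ (1 <= m + k)%N, N = (m + k + 2)%N, #|[pred a | kd a]| = k.+1
                 & forall a, sg a = 1]                               (* A(m,k) *)
        | TB => N = (m + k + 1)%N /\ #|[pred a | kd a]| = k.+1       (* B(m,k+1) *)
        | TCD => ((1 <= k)%N /\ m = 1%N /\ N = (k + 1)%N /\ #|[pred a | kd a]| = k)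
                                                                     (* C(k+1) *)
                 \/ ((2 <= m)%N /\ N = (m + k + 1)%N /\ #|[pred a | kd a]| = k.+1)
                                                                     (* D(m,k+1) *)
        end
      & dequiv D (amb_datum kd t (if t is TB then 2 else 1) (sroots kd t ord sg) s
                            (ftype_eqb t TB && (m == 0%N)))].

Definition explicit_datum (n : nat) (D : datum n) (G0 : seq (seq int)) (P0 : seq bool)
  (R0 : seq (seq int)) : Prop :=
  exists s : {perm 'I_n},
    dequiv D {| gram := fun i j => nth 0 (nth [::] G0 (s i)) (s j);
                par := fun i => nth false P0 (s i);
                posroot := fun c => has (fun r => [forall i, c i == nth 0 r (s i)]) R0;
                barpi := false |}.

(* G(3), distinguished simple system: alpha1 = delta + eps1 (isotropic),
   alpha2 = eps2, alpha3 = eps3 - eps2, (delta,delta) = 2, (eps_i,eps_j) = 1 - 3 delta_ij *)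
Definition G3_gram : seq (seq int) := [:: [:: 0; 1; 0]; [:: 1; -2; 3]; [:: 0; 3; -6]].
Definition G3_par : seq bool := [:: true; false; false].
Definition G3_pos : seq (seq int) :=
  [:: [:: 0; 0; 1]; [:: 0; 1; 0]; [:: 0; 1; 1]; [:: 0; 2; 1]; [:: 0; 3; 1];
      [:: 0; 3; 2]; [:: 1; 0; 0]; [:: 1; 1; 0]; [:: 1; 1; 1]; [:: 1; 2; 1];
      [:: 1; 3; 1]; [:: 1; 3; 2]; [:: 1; 4; 2]; [:: 2; 4; 2]].

(* F(3|1), distinguished simple system: alpha1 = eps1 - eps2, alpha2 = eps2 - eps3,
   alpha3 = eps3, alpha4 = (delta - eps1 - eps2 - eps3)/2,
   form 2*diag(1,1,1,-3) *)
Definition F4_gram : seq (seq int) :=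
  [:: [:: 4; -2; 0; 0]; [:: -2; 4; -2; 0]; [:: 0; -2; 2; -1]; [:: 0; 0; -1; 0]].
Definition F4_par : seq bool := [:: false; false; false; true].
Definition F4_pos : seq (seq int) :=
  [:: [:: 0; 0; 0; 1]; [:: 0; 0; 1; 0]; [:: 0; 0; 1; 1]; [:: 0; 1; 0; 0];
      [:: 0; 1; 1; 0]; [:: 0; 1; 1; 1]; [:: 0; 1; 2; 0]; [:: 0; 1; 2; 1];
      [:: 1; 0; 0; 0]; [:: 1; 1; 0; 0]; [:: 1; 1; 1; 0]; [:: 1; 1; 1; 1];
      [:: 1; 1; 2; 0]; [:: 1; 1; 2; 1]; [:: 1; 2; 2; 0]; [:: 1; 2; 2; 1];
      [:: 1; 2; 3; 1]; [:: 1; 2; 3; 2]].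

Definition admissible (n : nat) (D : datum n) : Prop :=
  family_datum D
  \/ (n = 4%N /\ explicit_datum D F4_gram F4_par F4_pos)
  \/ (n = 3%N /\ explicit_datum D G3_gram G3_par G3_pos).

(* Main.v *)
(** Elements of F are viewed as functions on words, so that U becomes the span of the shuffle
    monomials, with a symmetric pairing (mon w, x) = x(w). For a Lyndon word l, the bracketing r_l
    is mon l plus a combination of the mon w with w > l, and its proper left derivatives only
    involve words > l. If the largest word z of r_l were larger than l, pairing r_l with r_z would
    force all Lyndon factors of z to be larger than l (smaller factors are handled by induction).

    Such a dominant z <> l of the same weight is excluded by simple reflections. The elements of U
    supported on words < l form a right coideal subalgebra E. As long as E contains a letter i, the
    part of E killed by the right derivation at i is carried, by an analogue of Lusztig's T_i (or of
    an odd reflection), to a right coideal subalgebra for the reflected simple system. Finiteness of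
    the root system makes this stop, with E trivial; at that moment |l| has become a simple root,
    whose weight space is a line, while l and z yield two independent vectors modulo E. So r_l is
    supported on words <= l. Triangularity then passes to products of decreasing Lyndon words, and
    the leading coefficient does not vanish because r_w pairs nontrivially with U.

    For E_w, sigma is a semilinear antiautomorphism that preserves supports, so E_w is a multiple of
    sigma(r_w). The multiple is nonzero: being simple in some simple system, |l| is odd whenever it
    has norm zero, so no quantum integer occurring in the normalisation vanishes. *)

Require Import Defs.
From HB Require Import structures.
From mathcomp Require Import all_boot all_order all_algebra.
From mathcomp Require Import boolp fraction fingroup perm zify ring.

Set Implicit Arguments.
Unset Strict Implicit.
Unset Printing Implicit Defensive.

Import Order.TTheory GRing.Theory Num.Theory.
Local Open Scope ring_scope.

(** * Lexicographic order, Lyndon words and shuffles *)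

(** The simple reflections move the simple system inside one fixed lattice instead of acting on the
    lattice. The transport maps therefore preserve weights, and the weight of [l] keeps its meaning
    along the whole path. Up to the triangularity of the Lyndon basis only a bicharacter over an
    arbitrary field is present; the Lie type enters through a class of simple systems closed under
    reflections and a finite sign-coherent list of roots.

    Two obstacles shape the argument. The monomials [monw w] satisfy linear relations, so the
    pairing takes a formal combination on one side, and its symmetry shows that only the element
    matters. Quantum integers can vanish, as at an odd isotropic root, so powers of the reflecting
    letter cannot be divided by quantum factorials; wherever such a factorial vanishes, the power
    itself is shown to vanish.

    The ideal used for [E] inside [G] is [G] times the augmentation ideal of [E]. Conditions on
    supports are lost under a reflection, but membership in this ideal survives it in both
    directions, on elements killed by the derivation. It carries the information about [l] and [z]
    to a simple system where the weight space is a line. *)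

Section Words.
Variable n : nat.
Implicit Types (x y z u v w l m : word n) (a b k : 'I_n).

(* the case of wlt where x is not a prefix of y: it survives right extensions *)
Fixpoint dlt x y : bool :=
  match x, y with
  | a :: x', b :: y' => ((a : nat) < b)%N || ((a == b) && dlt x' y')
  | _, _ => false
  end.

Lemma wlt_irr x : wlt x x = false.
Proof. by elim: x => //= a x ->; rewrite ltnn eqxx. Qed.

Lemma wlt_trans y x z : wlt x y -> wlt y z -> wlt x z.
Proof.
elim: y x z => [|b y IH] [|a x] [|c z] //=.
case/orP=> [ab|/andP[/eqP-> xy]]; case/orP=> [bc|/andP[/eqP<- yz]].
- by rewrite (ltn_trans ab bc).
- by rewrite ab.
- by rewrite bc.
- by rewrite (IH _ _ xy yz) eqxx orbT.
Qed.

Lemma wlt_total x y : x != y -> wlt x y || wlt y x.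
Proof.
elim: x y => [|a x IH] [|b y] //=.
rewrite eqseq_cons negb_and.
case: (ltngtP a b) => //= e; first by rewrite orbT.
by rewrite (ord_inj e) eqxx /=; exact: IH.
Qed.

Lemma wlt_asym x y : wlt x y -> ~~ wlt y x.
Proof. by move=> h; apply/negP => /(wlt_trans h); rewrite wlt_irr. Qed.

Lemma wltNge x y : ~~ wlt x y = wle y x.
Proof.
rewrite /wle; case: (eqVneq y x) => [->|ne]; first by rewrite wlt_irr.
case/orP: (wlt_total ne) => h; rewrite ?h ?(negbTE (wlt_asym h)) //.
Qed.

Lemma wleNgt x y : wle x y = ~~ wlt y x.
Proof. by rewrite wltNge. Qed.

Lemma wle_refl x : wle x x.
Proof. by rewrite /wle eqxx. Qed.

Lemma wltW x y : wlt x y -> wle x y.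
Proof. by rewrite /wle => ->; rewrite orbT. Qed.

Lemma wle_lt_trans y x z : wle x y -> wlt y z -> wlt x z.
Proof. by case/orP=> [/eqP->//|]; exact: wlt_trans. Qed.

Lemma wlt_le_trans y x z : wlt x y -> wle y z -> wlt x z.
Proof. by move=> h /orP[/eqP<-//|]; exact: wlt_trans. Qed.

Lemma wle_trans y x z : wle x y -> wle y z -> wle x z.
Proof. by case/orP=> [/eqP->//|h1 h2]; apply/wltW/(wlt_le_trans h1). Qed.

Lemma wlt_cat2l p x y : wlt (p ++ x) (p ++ y) = wlt x y.
Proof. by elim: p => //= a p ->; rewrite ltnn eqxx. Qed.

Lemma wle_cat2l p x y : wle (p ++ x) (p ++ y) = wle x y.
Proof. by rewrite !wleNgt wlt_cat2l. Qed.

Lemma wlt0s x : wlt [::] x = (x != [::]).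
Proof. by case: x. Qed.

Lemma wlts0 x : wlt x [::] = false.
Proof. by case: x. Qed.

Lemma wle_catr x y : wle x (x ++ y).
Proof. by rewrite -{1}(cats0 x) wle_cat2l; case: y. Qed.

Lemma wlt_catr x y : y != [::] -> wlt x (x ++ y).
Proof. by rewrite -{1}(cats0 x) wlt_cat2l; case: y. Qed.

Lemma dltW x y : dlt x y -> wlt x y.
Proof.
elim: x y => [|a x IH] [|b y] //= /orP[->//|/andP[-> /IH->]].
by rewrite orbT.
Qed.

Lemma dlt_cat x y u v : dlt x y -> dlt (x ++ u) (y ++ v).
Proof.
elim: x y => [|a x IH] [|b y] //= /orP[->//|/andP[-> /IH->]].
by rewrite orbT.
Qed.

Lemma wlt_dlt x y : wlt x y -> (size y <= size x)%N -> dlt x y.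
Proof.
elim: x y => [|a x IH] [|b y] //=; rewrite ltnS.
by case/orP=> [->//|/andP[-> h /(IH _ h) ->]]; rewrite orbT.
Qed.

Lemma wltP x y : wlt x y -> dlt x y \/ exists2 y', y' != [::] & y = x ++ y'.
Proof.
elim: x y => [|a x IH] [|b y] //=; first by right; exists (b :: y).
case/orP=> [->|/andP[/eqP<- /IH [->|[y' ne ->]]]]; first by left.
  by left; rewrite eqxx orbT.
by right; exists y'.
Qed.

Lemma wlt_catw x y u : wlt x y -> wlt x (y ++ u).
Proof. by move=> h; apply: wlt_le_trans h (wle_catr _ _). Qed.

Lemma wle_cat_size x y u v : size x = size y -> wle (x ++ u) (y ++ v) -> wle x y.
Proof.
move=> e h; rewrite wleNgt; apply/negP => h2.
have d : dlt y x by apply: wlt_dlt => //; rewrite e.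
have := dltW (dlt_cat v u d); rewrite -[wlt _ _]negbK -wleNgt h //.
Qed.

Lemma lyndonP l : reflect
  (l <> [::] /\ forall x y, l = x ++ y -> x <> [::] -> y <> [::] -> wlt l y)
  (lyndon l).
Proof.
apply: (iffP andP) => [[/eqP ne /allP h]|[ne h]]; split => //.
- move=> x y e /eqP xn /eqP yn.
  have := h (size x); rewrite mem_iota e drop_size_cat // -e; apply.
  rewrite lt0n size_eq0 xn /= e size_cat add1n.
  by case: (y) yn => // c y' _; rewrite /= addnS ltnS leq_addr.
- exact/eqP.
- apply/allP => k; rewrite mem_iota => /andP[k0 kl].
  have kl' : (k < size l)%N by case: (size l) kl => //= ; case: (k) k0.
  apply: (h (take k l)); first by rewrite cat_take_drop.
    by apply/eqP; rewrite -size_eq0 size_take kl' -lt0n.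
  by apply/eqP; rewrite -size_eq0 size_drop -lt0n subn_gt0.
Qed.

Lemma lyndon_ne l : lyndon l -> l != [::].
Proof. by case/andP. Qed.

Lemma lyndon_suffix l x y : lyndon l -> l = x ++ y -> y <> [::] -> wle l y.
Proof.
case: x => [_ -> _|a x]; first exact: wle_refl.
by case/lyndonP=> _ h e yn; apply/wltW/(h _ _ e).
Qed.

Lemma lyndon1 a : lyndon [:: a].
Proof. by []. Qed.

(** A proper suffix of [u ++ v] is either a suffix of [v], hence at least [v], which exceeds
    [u ++ v]; or a proper suffix of [u] followed by [v]. In the second case the suffix of [u] is
    shorter than [u] and larger, so it wins at a differing letter. *)
Lemma lyndon_cat u v : lyndon u -> lyndon v -> wlt u v -> lyndon (u ++ v).
Proof.
move=> lu lv uv.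
have un := lyndon_ne lu; have vn := lyndon_ne lv.
have uvv : wlt (u ++ v) v.
  case: (wltP uv) => [d|[v' v'n e]].
    by have := dltW (dlt_cat v [::] d); rewrite cats0.
  rewrite {2}e wlt_cat2l.
  by case/lyndonP: lv => _; apply; [exact: e|exact/eqP|exact/eqP].
apply/lyndonP; split; first by case: (u) un.
move=> x y e /eqP xn /eqP yn.
case: (leqP (size u) (size x)) => su.
  have ex : x = u ++ drop (size u) x.
    rewrite -{1}(cat_take_drop (size u) x); congr (_ ++ _).
    have := congr1 (take (size u)) e.
    by rewrite take_size_cat // takel_cat.
  have ev : v = drop (size u) x ++ y.
    have := congr1 (drop (size u)) e; rewrite drop_size_cat // drop_cat => ->.
    move: su; rewrite leq_eqVlt => /orP[/eqP->|->//].
    by rewrite ltnn subnn drop0 drop_size.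
  apply: (wlt_le_trans uvv); apply: (lyndon_suffix lv ev); exact/eqP.
have ey : y = drop (size x) u ++ v.
  have := congr1 (drop (size x)) e.
  by rewrite drop_cat su drop_size_cat // => ->.
have eu : u = x ++ drop (size x) u.
  rewrite -{1}(cat_take_drop (size x) u); congr (_ ++ _).
  have := congr1 (take (size x)) e.
  by rewrite takel_cat ?(ltnW su) // take_size_cat // => ->.
have dn : drop (size x) u <> [::].
  by move=> d; have := size_drop (size x) u; rewrite d /= => /esym/eqP; rewrite subn_eq0 leqNgt su.
have h : wlt u (drop (size x) u).
  by case/lyndonP: lu => _; apply; [exact: eu|exact/eqP|].
have := wlt_dlt h; rewrite size_drop leq_subr => /(_ isT) d.
rewrite ey; exact: dltW (dlt_cat v v d).
Qed.

Definition wge x y := wle y x.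

Lemma wge_trans : transitive wge.
Proof. by move=> y x z /= h1 h2; apply: wle_trans h2 h1. Qed.

(** Prepends a Lyndon word to a nonincreasing factorization: it absorbs its right neighbour as long
    as it is smaller. Iterated over the letters of a word, this yields the existence behind the
    epsilon in [cfl]. *)
Fixpoint cfl_ins l (ls : seq (word n)) : seq (word n) :=
  match ls with
  | [::] => [:: l]
  | m :: ls' => if wlt l m then cfl_ins (l ++ m) ls' else l :: ls
  end.

Lemma cfl_insP l ls : lyndon l -> all (@lyndon n) ls -> sorted wge ls ->
  [/\ all (@lyndon n) (cfl_ins l ls), sorted wge (cfl_ins l ls)
    & flatten (cfl_ins l ls) = l ++ flatten ls].
Proof.
elim: ls l => [|m ls IH] l ll /=; first by rewrite ll.
case/andP=> lm als s.
case: ifP => h.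
  have [|||h1 h2 h3] := IH (l ++ m) => //; first exact: lyndon_cat.
    exact: path_sorted s.
  by rewrite h1 h2 h3 catA.
rewrite /= ll lm als; split => //.
by rewrite /wge wleNgt h.
Qed.

Lemma cfl_exists w : exists ls,
  [/\ all (@lyndon n) ls, sorted wge ls & flatten ls = w].
Proof.
elim: w => [|a w [ls [h1 h2 h3]]]; first by exists [::].
have [g1 g2 g3] := cfl_insP (lyndon1 a) h1 h2.
by exists (cfl_ins [:: a] ls); rewrite g1 g2 g3 h3.
Qed.

Lemma cfl_spec w :
  [/\ all (@lyndon n) (cfl w), sorted wge (cfl w) & flatten (cfl w) = w].
Proof.
rewrite /cfl; apply: (@ClassicalEpsilon.epsilon_spec _ _
 (fun ls => [/\ all (@lyndon n) ls, sorted wge ls & flatten ls = w])).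
exact: cfl_exists.
Qed.

Lemma sorted_wge_all l ls : sorted wge (l :: ls) -> all (fun m => wle m l) ls.
Proof. exact: (order_path_min wge_trans). Qed.

Lemma sorted_wge_last l ls m : sorted wge (rcons ls m) -> l \in rcons ls m -> wle m l.
Proof.
elim: ls => [|x ls IH] /=; first by rewrite inE => _ /eqP ->; exact: wle_refl.
move=> s; rewrite inE => /orP[/eqP->|]; last by apply: IH; exact: path_sorted s.
by have /allP := sorted_wge_all s; apply; rewrite mem_rcons mem_head.
Qed.

(* m' ranges over nonempty suffixes of m to make the induction go through *)
Lemma flatten_lt_suffix m x m' fs : lyndon m -> m = x ++ m' -> m' <> [::] ->
  all (fun f => wlt f m) fs -> wlt (flatten fs) m'.
Proof.
move=> lm; elim: fs x m' => [|f fs IH] x m' e m'n /=.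
  by case: (m') m'n.
case/andP=> fm afs.
have fm' : wlt f m' by apply: wlt_le_trans fm (lyndon_suffix lm e m'n).
case: (wltP fm') => [d|[y yn e']].
  by have := dltW (dlt_cat (flatten fs) [::] d); rewrite cats0.
rewrite e' wlt_cat2l; apply: (IH (x ++ f)) => //; last exact/eqP.
by rewrite e e' catA.
Qed.

Lemma flatten_lt m fs : lyndon m -> all (fun f => wlt f m) fs -> wlt (flatten fs) m.
Proof.
move=> lm; apply: (flatten_lt_suffix (x := [::]) lm) => //.
exact/eqP/lyndon_ne.
Qed.

Lemma sorted_first_lt m f fs : lyndon m -> sorted wge (f :: fs) -> wlt f m ->
  wlt (flatten (f :: fs)) m.
Proof.
move=> lm s fm; apply: flatten_lt => //=; rewrite fm /=.
apply/allP => g /(allP (sorted_wge_all s)) h; exact: wle_lt_trans h fm.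
Qed.

Lemma lyndon_prefix_ge m z : lyndon m -> wle m z ->
  exists M z', [/\ z = M ++ z', lyndon M & wle m M].
Proof.
move=> lm mz; have [[|M ms] [h1 h2 h3]] := cfl_exists z.
  by move: mz; rewrite -h3 wleNgt wlt0s lyndon_ne.
exists M, (flatten ms); split=> //; first by case/andP: h1.
rewrite wleNgt; apply/negP => h.
by move: mz; rewrite wleNgt -h3 (sorted_first_lt lm h2 h).
Qed.

(** The first letter of [l] absorbs the factors of the remaining word from the left; the last
    absorption is the splitting. Absorption cannot stop early: a current word [x] not below the next
    factor would head a nonincreasing factorization of [l], forcing [l < l]. *)
Lemma lyndon_split l : lyndon l -> (1 < size l)%N ->
  exists u v, [/\ l = u ++ v, lyndon u, lyndon v & wlt u v].
Proof.
case: l => // a w la sw.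
have [ls [h1 h2 h3]] := cfl_exists w.
pose P l := exists u v, [/\ l = u ++ v, lyndon u, lyndon v & wlt u v].
suff H x : lyndon x -> (x = [:: a] \/ P x) -> forall ls, all (@lyndon n) ls ->
   sorted wge ls -> lyndon (x ++ flatten ls) -> ls <> [::] -> P (x ++ flatten ls).
  rewrite -[a :: w]cat1s -h3; apply: H => //; [by left|by rewrite h3|].
  by move=> e; move: sw; rewrite -h3 e.
move=> lx Px {h3 h2 h1}ls h1 h2.
elim: ls x lx Px h1 h2 => // m ls IH x lx Px /= /andP[lm als] s.
case: (boolP (wlt x m)) => xm.
  move=> lxm _; have lxm' := lyndon_cat lx lm xm.
  have Pxm : P (x ++ m) by exists x, m.
  case: (ls) IH als s lxm => [|m2 ls2] IH als s lxm; first by rewrite /= cats0.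
  rewrite catA; apply: IH => //; [by right|exact: path_sorted s|by rewrite -catA].
move=> lxm _.
have /(sorted_first_lt lxm) h : sorted wge (x :: m :: ls).
  by rewrite /= s andbT /wge wleNgt.
have := lyndon_suffix lxm erefl.
have mn := lyndon_ne lm.
have : m ++ flatten ls <> [::] by case: (m) mn.
move=> mne /(_ mne) h2.
have : wlt x (x ++ m ++ flatten ls) by apply: wlt_catr; apply/eqP.
by move/h; rewrite /= wlt_irr.
Qed.

Lemma costd_bound l : (1 < size l)%N -> lyndon l -> (0 < costd l < size l)%N /\
   lyndon (take (costd l) l) /\
   (forall k : nat, (0 < k < size l)%N -> lyndon (take k l) -> (k <= costd l)%N).
Proof.
move=> sl ll.
have mem (k : nat) : (k \in iota 1 (size l).-1) = (0 < k < size l)%N.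
  by rewrite mem_iota add1n prednK // (ltn_trans _ sl).
have ge (k : nat) : (0 < k < size l)%N -> lyndon (take k l) -> (k <= costd l)%N.
  move=> kl lk; rewrite /costd; apply: (@leq_bigmax_seq _ _ _ id) => //.
  by rewrite mem.
have c1 : (1 <= costd l)%N.
  by apply: ge; rewrite ?sl //; case: (l) ll => // a w; rewrite /= take0.
suff [h1 h2] : (costd l < size l)%N /\ lyndon (take (costd l) l) by rewrite c1 h1.
have : (costd l = 0%N) \/ ((costd l < size l)%N /\ lyndon (take (costd l) l)).
  rewrite /costd big_seq_cond; elim/big_rec: _ => [|i x]; first by left.
  rewrite mem -andbA => /and3P[_ il li] IH.
  case: (leqP x i) => h; first by right.
  by case: IH => [e|?]; [move: h; rewrite e|right].
by case=> // e; move: c1; rewrite e.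
Qed.

(** If the right part [v] had several factors, the first one, [v1], would give a longer Lyndon
    prefix [u ++ v1] when [u < v1]; otherwise [u] would start a nonincreasing factorization of the
    Lyndon word [l]. *)
Lemma costdP l : (1 < size l)%N -> lyndon l ->
  [/\ lyndon (take (costd l) l), lyndon (drop (costd l) l)
    & wlt (take (costd l) l) (drop (costd l) l)].
Proof.
move=> sl ll; have [/andP[c0 cl] [lu mx]] := costd_bound sl ll.
set u := take _ _ in lu *; set v := drop _ _.
have e : l = u ++ v by rewrite cat_take_drop.
have un := lyndon_ne lu.
have vn : v != [::] by rewrite -size_eq0 size_drop -lt0n subn_gt0.
have su : size u = costd l by rewrite size_take cl.
have uv : wlt u v.
  have : wlt l v by case/lyndonP: ll => _; apply; [exact: e|exact/eqP|exact/eqP].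
  by apply: wle_lt_trans; rewrite e wle_catr.
suff : lyndon v by [].
have [ls [h1 h2 h3]] := cfl_exists v.
case: ls h1 h2 h3 => [_ _ e0|v1 ls]; first by rewrite -e0 in vn.
case: ls => [/andP[l1 _] _ /=|v2 ls /=]; first by rewrite cats0 => <-.
case/and3P=> l1 l2 als s ev.
have v1n := lyndon_ne l1; have v2n := lyndon_ne l2.
case: (boolP (wlt u v1)) => uv1.
  have luv := lyndon_cat lu l1 uv1.
  have h1 : (0 < size v1)%N by rewrite lt0n size_eq0.
  have h2 : (0 < size v2)%N by rewrite lt0n size_eq0.
  have bd : (0 < size u + size v1 < size l)%N.
    rewrite e -ev /= !size_cat addn_gt0 h1 orbT /= ltn_add2l.
    by rewrite -[X in (X < _)%N]addn0 ltn_add2l addn_gt0 h2.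
  have tk : take (size u + size v1) l = u ++ v1.
    by rewrite e -ev -size_cat /= catA take_size_cat.
  have := mx _ bd; rewrite tk => /(_ luv); rewrite su.
  by rewrite -[X in (_ <= X)%N]addn0 leq_add2l leqNgt h1.
have : sorted wge (u :: v1 :: v2 :: ls) by move: s => /= /andP[-> ->]; rewrite /wge wleNgt uv1.
move=> s'; have := sorted_first_lt ll s'.
have ul : wlt u l by rewrite e wlt_catr.
by move/(_ ul); rewrite /= ev -e wlt_irr.
Qed.

(** * Shuffles of words and Lyndon bounds *)

Inductive shuf : word n -> word n -> word n -> Prop :=
| shuf0 : shuf [::] [::] [::]
| shufl k x y z : shuf x y z -> shuf (k :: x) y (k :: z)
| shufr k x y z : shuf x y z -> shuf x (k :: y) (k :: z).

Lemma shuf_sym x y z : shuf x y z -> shuf y x z.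
Proof. by elim=> *; constructor. Qed.

Lemma shuf_nil x z : shuf x [::] z -> x = z.
Proof.
move e: [::] => y h; elim: h e => // k {}x {}y {}z _ IH e.
by rewrite IH.
Qed.

Lemma shuf_size x y z : shuf x y z -> size z = (size x + size y)%N.
Proof. by elim=> //= k {}x {}y {}z _ ->; rewrite ?addnS. Qed.

Lemma shuf_cat x y p q : shuf x y (p ++ q) -> exists x1 x2 y1 y2,
  [/\ x = x1 ++ x2, y = y1 ++ y2, shuf x1 y1 p & shuf x2 y2 q].
Proof.
elim: p x y => [|k p IH] x y /=.
  by move=> h; exists [::], x, [::], y; split=> //; constructor.
move e: (k :: _) => z h; case: h e => // {}k' x' y' z' h [ek ez]; subst.
  have [x1 [x2 [y1 [y2 [-> -> h1 h2]]]]] := IH _ _ h.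
  by exists (k' :: x1), x2, y1, y2; split=> //; constructor.
have [x1 [x2 [y1 [y2 [-> -> h1 h2]]]]] := IH _ _ h.
by exists x1, x2, (k' :: y1), y2; split=> //; constructor.
Qed.

(** Induction along a splitting [m = u ++ v], which cuts the shuffle in two. If both pieces inside
    [u] are nonempty, then by induction one of them is not below [u]; being shorter than [u], it
    exceeds [u] at a letter, so its whole word exceeds [m]. If one piece is empty, the other is all
    of [u], and the induction moves to [v], where [m < v] keeps the bounds. *)
Lemma lyndon_no_shuffle m x y : lyndon m -> shuf x y m -> x <> [::] -> y <> [::] ->
  wlt x m -> ~~ wlt y m.
Proof.
have [N] := ubnP (size m); elim: N m x y => // N IH m x y sN lm sh xn yn xm.
apply/negP => ym.
have sxy := shuf_size sh.
have sm : (1 < size m)%N.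
  rewrite sxy; case: (x) xn => // ? ? _; case: (y) yn => // ? ? _ /=.
  by rewrite addSn addnS.
have [u [v [e lu lv uv]]] := lyndon_split lm sm.
have un := lyndon_ne lu; have vn := lyndon_ne lv.
have su : (size u < N)%N.
  move: sN; rewrite ltnS; apply: leq_trans; rewrite e size_cat -addn1 leq_add2l.
  by rewrite lt0n size_eq0.
have sv : (size v < N)%N.
  move: sN; rewrite ltnS; apply: leq_trans; rewrite e size_cat -add1n leq_add2r.
  by rewrite lt0n size_eq0.
have mv : wlt m v by case/lyndonP: lm => _; apply; [exact: e|exact/eqP|exact/eqP].
(* one of the two words is exhausted by the first factor u *)
have H x1 x2 y1 y2 : x1 ++ x2 <> [::] -> y1 ++ y2 <> [::] ->
  wlt (x1 ++ x2) m -> wlt (y1 ++ y2) m -> shuf x1 y1 u -> shuf x2 y2 v -> x1 <> [::] ->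
  ~~ wlt x1 u || (y1 == [::]) -> False.
  move=> xn' yn' xm' ym' sh1 sh2 x1n.
  case: (eqVneq y1 [::]) => [e1 _|y1n]; last first.
    rewrite orbF => h.
    have sx1 := shuf_size sh1.
    have lt1 : (size x1 < size u)%N.
      by rewrite sx1 -{1}(addn0 (size x1)) ltn_add2l lt0n size_eq0.
    have ne : u != x1 by apply/eqP => e1; move: lt1; rewrite e1 ltnn.
    have ux : wlt u x1 by case/orP: (wlt_total ne) => // h'; rewrite h' in h.
    have d := wlt_dlt ux (ltnW lt1).
    have := dltW (dlt_cat v x2 d); rewrite -e => /(wlt_trans xm').
    by rewrite wlt_irr.
  move: sh1 yn' ym' sh2; rewrite e1 => /shuf_nil ex1 /= y2n y2m sh2.
  move: xm'; rewrite ex1 e wlt_cat2l => x2v.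
  case: (eqVneq x2 [::]) => [ex2|x2n].
    move: sh2; rewrite ex2 => /shuf_sym/shuf_nil ey2.
    by move: (wlt_trans y2m mv); rewrite ey2 wlt_irr.
  have /negP := IH v x2 y2 sv lv sh2 (elimN eqP x2n) y2n x2v; apply.
  exact: wlt_trans y2m mv.
move: sh; rewrite e => /shuf_cat[x1 [x2 [y1 [y2 [ex ey sh1 sh2]]]]].
rewrite ex ey in xn yn xm ym.
case: (eqVneq x1 [::]) => [ex1|/eqP x1n].
  apply: (H y1 y2 x1 x2) => //; [exact: shuf_sym|exact: shuf_sym| |by rewrite ex1 eqxx orbT].
  move=> ey1; move: sh1; rewrite ex1 ey1 => /shuf_nil e0.
  by rewrite -e0 in un.
case: (eqVneq y1 [::]) => [ey1|/eqP y1n].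
  by apply: (H x1 x2 y1 y2) => //; rewrite ey1 eqxx orbT.
case: (boolP (wlt x1 u)) => h; last by apply: (H x1 x2 y1 y2) => //; rewrite h.
have h' := IH u x1 y1 su lu sh1 x1n y1n h.
apply: (H y1 y2 x1 x2) => //; [exact: shuf_sym|exact: shuf_sym|by rewrite h'].
Qed.

(** Otherwise the first Lyndon factor [M] of [z] is at least [m] and is itself a shuffle of prefixes
    of [x] and [y], both below [M]. This closes supports bounded by a Lyndon word under products. *)
Lemma shuf_lt m x y z : lyndon m -> wlt x m -> wlt y m -> shuf x y z -> wlt z m.
Proof.
move=> lm xm ym sh; rewrite -[wlt _ _]negbK wltNge; apply/negP => mz.
have [M [z' [e lM mM]]] := lyndon_prefix_ge lm mz.
move: sh; rewrite e => /shuf_cat[x1 [x2 [y1 [y2 [ex ey sh1 _]]]]].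
have x1M : wlt x1 M.
  by apply: wlt_le_trans mM; apply: wle_lt_trans xm; rewrite ex wle_catr.
have y1M : wlt y1 M.
  by apply: wlt_le_trans mM; apply: wle_lt_trans ym; rewrite ey wle_catr.
have Mn := lyndon_ne lM.
case: (eqVneq x1 [::]) => [e1|/eqP x1n].
  by move: sh1; rewrite e1 => /shuf_sym/shuf_nil ey1; move: y1M; rewrite ey1 wlt_irr.
case: (eqVneq y1 [::]) => [e1|/eqP y1n].
  by move: sh1; rewrite e1 => /shuf_nil ey1; move: x1M; rewrite ey1 wlt_irr.
by have := lyndon_no_shuffle lM sh1 x1n y1n x1M; rewrite y1M.
Qed.

(* for Lyndon l: the words whose Chen-Fox-Lyndon factors are all at most l *)
Definition below l z := forall m, lyndon m -> wlt l m -> wlt z m.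

Lemma below_shuf l x y z : below l x -> below l y -> shuf x y z -> below l z.
Proof. by move=> hx hy sh m lm lt; apply: shuf_lt sh; [|apply: hx|apply: hy]. Qed.

Lemma below_le l x : wle x l -> below l x.
Proof. by move=> h m _; apply: wle_lt_trans. Qed.

Lemma below_flatten l ls : all (fun m => wle m l) ls -> below l (flatten ls).
Proof.
move=> h m lm lt; apply: flatten_lt => //.
by apply/allP => f /(allP h) fl; apply: wle_lt_trans fl lt.
Qed.

Lemma belowP l z : lyndon l -> below l z ->
  wlt z l \/ exists2 z', z = l ++ z' & below l z'.
Proof.
move=> ll bz; case: (boolP (wlt z l)) => [|h]; [by left|right].
have [[|m ls] [h1 h2 h3]] := cfl_exists z.
  by move: h; rewrite -h3 wlt0s lyndon_ne.
have /andP[lm als] := h1.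
have ml : wle m l.
  rewrite wleNgt; apply/negP => lt.
  by have := bz m lm lt; rewrite -h3 /=; apply/negP; rewrite wltNge wle_catr.
have e : m = l.
  case/orP: ml => [/eqP//|ml].
  by move: h; rewrite -h3 (sorted_first_lt ll h2 ml).
exists (flatten ls); first by rewrite -h3 /= e.
by apply: below_flatten; have := sorted_wge_all h2; rewrite e.
Qed.

Lemma below_power l z : lyndon l -> below l z ->
  exists t z2, z = flatten (nseq t l) ++ z2 /\ wlt z2 l.
Proof.
move=> ll; have [N] := ubnP (size z); elim: N z => // N IH z sz.
case/(belowP ll) => [h|[z' e bz']]; first by exists 0%N, z.
have [|t [z2 [e2 h2]]] := IH z' _ bz'.
  move: sz; rewrite e size_cat ltnS; apply: leq_trans.
  by rewrite -[X in (X < _)%N]add0n ltn_add2r lt0n size_eq0 lyndon_ne.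
by exists t.+1, z2; rewrite e e2 /= catA.
Qed.

End Words.

(** * The quantum shuffle algebra of all functions on words *)

Section ShuffleAlgebra.
Variables (n : nat) (K : fieldType).

(** The argument [chi] is a phantom on which the product instance depends, so that the functions
    attached to different simple systems carry different algebra structures. *)
Definition sh (chi : 'I_n -> 'I_n -> K) : Type := word n -> K.

Variable chi : 'I_n -> 'I_n -> K.
Local Notation F := (sh chi).
Implicit Types (x y : F) (v w z : word n) (i j k : 'I_n).

HB.instance Definition _ := gen_eqMixin F.
HB.instance Definition _ := gen_choiceMixin F.

Lemma shP x y : (forall w, x w = y w) -> x = y.
Proof. by move=> h; apply: functional_extensionality_dep. Qed.

Definition sh0 : F := fun _ => 0.
Definition shopp x : F := fun w => - x w.
Definition shadd x y : F := fun w => x w + y w.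
Definition shscale (c : K) x : F := fun w => c * x w.

Fact shaddA : associative shadd.
Proof. by move=> x y t; apply: shP => w; apply: addrA. Qed.
Fact shaddC : commutative shadd.
Proof. by move=> x y; apply: shP => w; apply: addrC. Qed.
Fact shadd0 : left_id sh0 shadd.
Proof. by move=> x; apply: shP => w; apply: add0r. Qed.
Fact shaddN : left_inverse sh0 shopp shadd.
Proof. by move=> x; apply: shP => w; apply: addNr. Qed.

HB.instance Definition _ := GRing.isZmodule.Build F shaddA shaddC shadd0 shaddN.

Fact shscaleA a b x : shscale a (shscale b x) = shscale (a * b) x.
Proof. by apply: shP => w; apply: mulrA. Qed.
Fact shscale1 : left_id 1 shscale.
Proof. by move=> x; apply: shP => w; apply: mul1r. Qed.
Fact shscaleDr : right_distributive shscale +%R.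
Proof. by move=> a x y; apply: shP => w; apply: mulrDr. Qed.
Fact shscaleDl x : {morph shscale^~ x : a b / a + b}.
Proof. by move=> a b; apply: shP => w; apply: mulrDl. Qed.

HB.instance Definition _ :=
  GRing.Zmodule_isLmodule.Build K F shscaleA shscale1 shscaleDr shscaleDl.

Lemma shDE x y w : (x + y) w = x w + y w. Proof. by []. Qed.
Lemma shNE x w : (- x) w = - x w. Proof. by []. Qed.
Lemma sh0E w : (0 : F) w = 0. Proof. by []. Qed.
Lemma shZE a x w : (a *: x) w = a * x w. Proof. by []. Qed.
Lemma shBE x y w : (x - y) w = x w - y w. Proof. by []. Qed.
Lemma sh_sumE I (r : seq I) (P : pred I) (G : I -> F) w :
  (\sum_(i <- r | P i) G i) w = \sum_(i <- r | P i) G i w.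
Proof. by elim/big_rec2: _ => // i a b _ <-. Qed.

Definition dl k x : F := fun w => x (k :: w).
Definition dr k x : F := fun w => x (rcons w k).
Definition ch (f : 'I_n -> K) x : F := fun w => (\prod_(a <- w) f a) * x w.
Definition delta w : F := fun v => (v == w)%:R.

(** The quantum shuffle product read from the first letter. A letter taken from [x] precedes every
    remaining letter of [y], whence the twist of [y]; in total each letter of [x] standing before a
    letter of [y] contributes one factor [chi]. *)
Fixpoint st (z : word n) (x y : F) : K :=
  match z with
  | [::] => x [::] * y [::]
  | k :: z' => st z' (dl k x) (ch (chi k) y) + st z' x (dl k y)
  end.

Lemma dl_linear k : linear (dl k). Proof. by []. Qed.
Lemma dr_linear k : linear (dr k). Proof. by []. Qed.
Lemma ch_linear f : linear (ch f).
Proof. by move=> a x y; apply: shP => w; rewrite /ch !shDE !shZE; ring. Qed.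

HB.instance Definition _ k := GRing.isLinear.Build K F F *:%R (dl k) (dl_linear k).
HB.instance Definition _ k := GRing.isLinear.Build K F F *:%R (dr k) (dr_linear k).
HB.instance Definition _ f := GRing.isLinear.Build K F F *:%R (ch f) (ch_linear f).

Lemma st_linl (z : word n) a x x' y : st z (a *: x + x') y = a * st z x y + st z x' y.
Proof.
elim: z x x' y => [|k z IH] x x' y /=; first by rewrite shDE shZE; ring.
by rewrite linearP !IH; ring.
Qed.

Lemma st_linr (z : word n) a x y y' : st z x (a *: y + y') = a * st z x y + st z x y'.
Proof.
elim: z x y y' => [|k z IH] x y y' /=; first by rewrite shDE shZE; ring.
by rewrite !linearP !IH; ring.
Qed.

Lemma st0l (z : word n) y : st z 0 y = 0.
Proof.
have := st_linl z (-1) 0 0 y; rewrite scaler0 addr0 => ->.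
by rewrite mulN1r addNr.
Qed.

Lemma st0r (z : word n) x : st z x 0 = 0.
Proof.
have := st_linr z (-1) x 0 0; rewrite scaler0 addr0 => ->.
by rewrite mulN1r addNr.
Qed.

Lemma st_Zl (z : word n) a x y : st z (a *: x) y = a * st z x y.
Proof. by rewrite -[a *: x]addr0 st_linl st0l addr0. Qed.

Lemma st_Zr (z : word n) a x y : st z x (a *: y) = a * st z x y.
Proof. by rewrite -[a *: y]addr0 st_linr st0r addr0. Qed.

Definition shmul x y : F := fun z => st z x y.
Definition sh1 : F := fun w => (w == [::])%:R.

Lemma dl_ch k f x : dl k (ch f x) = f k *: ch f (dl k x).
Proof. by apply: shP => w; rewrite /dl /ch shZE big_cons mulrA. Qed.

Lemma dr_ch k f x : dr k (ch f x) = f k *: ch f (dr k x).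
Proof.
by apply: shP => w; rewrite /dr /ch shZE -cats1 big_cat big_seq1 /=; ring.
Qed.

Lemma chC f g x : ch f (ch g x) = ch g (ch f x).
Proof. by apply: shP => w; rewrite /ch mulrCA. Qed.

Lemma ch_shmul f x y : ch f (shmul x y) = shmul (ch f x) (ch f y).
Proof.
apply: shP => z; rewrite /ch /shmul.
elim: z x y => [|k z IH] x y /=; first by rewrite !big_nil; ring.
rewrite big_cons mulrDr -!mulrA !IH !dl_ch chC.
by rewrite st_Zl st_Zr.
Qed.

Fact shmulA : associative shmul.
Proof.
move=> x y w; apply: shP => z; rewrite /shmul.
elim: z x y w => [|k z IH] x y w; first by rewrite /= mulrA.
rewrite [LHS]/= [RHS]/=.
have E (a b : F) : (fun t => st t a b) = shmul a b by [].
have D (a b : F) : dl k (shmul a b) = 1 *: shmul (dl k a) (ch (chi k) b) + shmul a (dl k b).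
  by rewrite scale1r.
by rewrite !E ch_shmul !D st_linl st_linr !mul1r -!IH; ring.
Qed.

Fact sh1mul : left_id sh1 shmul.
Proof.
move=> x; apply: shP => z; rewrite /shmul.
elim: z x => [|k z IH] x /=; first by rewrite /sh1 mul1r.
by rewrite -[dl k sh1]/(0 : F) st0l add0r IH.
Qed.

Lemma dl_sh1 k : dl k sh1 = 0. Proof. by []. Qed.
Lemma dr_sh1 k : dr k sh1 = 0.
Proof. by apply: shP => w; rewrite /dr /sh1; case: w. Qed.
Lemma ch_sh1 f : ch f sh1 = sh1.
Proof.
apply: shP => w; rewrite /ch /sh1; case: eqP => [->|_]; last by rewrite mulr0.
by rewrite big_nil mul1r.
Qed.

Fact shmul1 : right_id sh1 shmul.
Proof.
move=> x; apply: shP => z; rewrite /shmul.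
elim: z x => [|k z IH] x /=; first by rewrite /sh1 mulr1.
by rewrite dl_sh1 st0r addr0 ch_sh1 IH.
Qed.

Fact shmulDl : left_distributive shmul +%R.
Proof.
move=> x y w; apply: shP => z.
by rewrite /shmul -[x]scale1r st_linl shDE mul1r scale1r.
Qed.

Fact shmulDr : right_distributive shmul +%R.
Proof.
move=> x y w; apply: shP => z.
by rewrite /shmul -[y]scale1r st_linr shDE mul1r scale1r.
Qed.

Fact sh1_neq0 : sh1 != 0.
Proof.
apply/eqP => /(congr1 (fun x : F => x [::])).
by move/eqP; rewrite /sh1 eqxx oner_eq0.
Qed.

HB.instance Definition _ := GRing.Zmodule_isNzRing.Build F
  shmulA sh1mul shmul1 shmulDl shmulDr sh1_neq0.

Fact shscaleAl a x y : a *: (x * y) = (a *: x) * y.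
Proof.
by apply: shP => z; exact: esym (st_Zl z a x y).
Qed.

HB.instance Definition _ := GRing.Lmodule_isLalgebra.Build K F shscaleAl.

Fact shscaleAr a x y : a *: (x * y) = x * (a *: y).
Proof.
by apply: shP => z; exact: esym (st_Zr z a x y).
Qed.

HB.instance Definition _ := GRing.Lalgebra_isAlgebra.Build K F shscaleAr.

Lemma dlM k x y : dl k (x * y) = dl k x * ch (chi k) y + x * dl k y.
Proof. by []. Qed.

Lemma shMcons k z x y :
  (x * y) (k :: z) = (dl k x * ch (chi k) y) z + (x * dl k y) z.
Proof. by []. Qed.

Lemma dl1 k : dl k 1 = 0. Proof. by []. Qed.
Lemma dr1 k : dr k 1 = 0. Proof. exact: dr_sh1. Qed.
Lemma ch1 f : ch f 1 = 1. Proof. exact: ch_sh1. Qed.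
Lemma chM f x y : ch f (x * y) = ch f x * ch f y. Proof. exact: ch_shmul. Qed.
Lemma shM0E x y : (x * y) [::] = x [::] * y [::]. Proof. by []. Qed.
Lemma sh10E : (1 : F) [::] = 1. Proof. by []. Qed.

Lemma sh_ext x y : x [::] = y [::] -> (forall k, dl k x = dl k y) -> x = y.
Proof.
move=> h0 h; apply: shP => -[|k w] //.
by have := congr1 (fun f : F => f w) (h k).
Qed.

Hypothesis chiC : forall i j, chi i j = chi j i.

(** The same product read from the last letter, which is the recursion of [shr]. Symmetry of [chi]
    enters when the first letter comes from [x] and the last one from [y]. *)
Lemma drM k x y : dr k (x * y) = dr k x * y + ch (chi k) x * dr k y.
Proof.
apply: shP => z; rewrite shDE.
elim: z x y => [|j z IH] x y.
  rewrite /dr /= /GRing.mul /= /shmul /= /dl /ch !big_nil; ring.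
have -> : dr k (x * y) (j :: z) =
  dr k (dl j x * ch (chi j) y) z + dr k (x * dl j y) z by [].
rewrite !shMcons !IH dl_ch dr_ch -scalerAl -scalerAr chiC.
have E (u : F) : dl j (dr k u) = dr k (dl j u) by [].
by rewrite !E !shZE; ring.
Qed.

End ShuffleAlgebra.

(** * The subalgebra generated by the letters and its symmetric pairing *)

Section Pairing.
Variables (n : nat) (K : fieldType) (chi : 'I_n -> 'I_n -> K).
Local Notation F := (sh chi).
Implicit Types (x y : F) (v w z : word n) (i j k : 'I_n) (P Q : seq (K * word n)).

Definition letr i : F := @delta n K chi [:: i].
Definition monw w : F := \prod_(a <- w) letr a.
Definition lmon P : F := \sum_(p <- P) p.1 *: monw p.2.
Definition inUp x := exists P, x = lmon P.
(** The bilinear form for which pairing with a monomial reads off a coefficient. One argument stays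
    a formal combination because the monomials are linearly dependent in general. *)
Definition pr P x : K := \sum_(p <- P) p.1 * x p.2.

Definition subsp (E : F -> Prop) := E 0 /\ forall a x y, E x -> E y -> E (a *: x + y).

Lemma subsp0 E : subsp E -> E 0. Proof. by case. Qed.
Lemma subspZ E a x : subsp E -> E x -> E (a *: x).
Proof. by case=> h0 h /h; rewrite -[a *: x]addr0; apply. Qed.
Lemma subspD E x y : subsp E -> E x -> E y -> E (x + y).
Proof. by case=> h0 h hx hy; rewrite -[x]scale1r; apply: h. Qed.
Lemma subspN E x : subsp E -> E x -> E (- x).
Proof. by rewrite -scaleN1r; apply: subspZ. Qed.
Lemma subspB E x y : subsp E -> E x -> E y -> E (x - y).
Proof. by move=> h hx hy; apply: subspD => //; apply: subspN. Qed.
Lemma subsp_sum E I (r : seq I) (G : I -> F) : subsp E ->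
  (forall t : I, E (G t)) -> E (\sum_(t <- r) G t).
Proof. by move=> hE h; elim/big_ind: _ => //; [exact: subsp0|move=> *; exact: subspD]. Qed.
Lemma subsp_sumP E (I : eqType) (r : seq I) (G : I -> F) : subsp E ->
  (forall t : I, t \in r -> E (G t)) -> E (\sum_(t <- r) G t).
Proof.
move=> hE h; rewrite big_seq; elim/big_ind: _ => //; first exact: subsp0.
by move=> *; exact: subspD.
Qed.

Lemma lmon_nil : lmon [::] = 0. Proof. by rewrite /lmon big_nil. Qed.
Lemma lmon_cons p P : lmon (p :: P) = p.1 *: monw p.2 + lmon P.
Proof. by rewrite /lmon big_cons. Qed.
Lemma lmon_cat P Q : lmon (P ++ Q) = lmon P + lmon Q.
Proof. by rewrite /lmon big_cat. Qed.
Lemma lmonZ a P : a *: lmon P = lmon [seq (a * p.1, p.2) | p <- P].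
Proof. by rewrite /lmon big_map scaler_sumr; apply: eq_bigr => p _; rewrite scalerA. Qed.

Lemma inUp_subsp : subsp inUp.
Proof.
split; first by exists [::]; rewrite lmon_nil.
by move=> a x y [P ->] [Q ->]; exists ([seq (a * p.1, p.2) | p <- P] ++ Q); rewrite lmon_cat lmonZ.
Qed.

Lemma inUp0  : inUp 0. Proof. exact: subsp0 inUp_subsp. Qed.
Lemma inUpZ  a x : inUp x -> inUp (a *: x). Proof. exact: subspZ inUp_subsp. Qed.
Lemma inUpD  x y : inUp x -> inUp y -> inUp (x + y). Proof. exact: subspD inUp_subsp. Qed.
Lemma inUpB  x y : inUp x -> inUp y -> inUp (x - y). Proof. exact: subspB inUp_subsp. Qed.

Lemma inUp_monw w : inUp (monw w).
Proof. by exists [:: (1, w)]; rewrite lmon_cons lmon_nil addr0 scale1r. Qed.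

Lemma inUp_ind (E : F -> Prop) : subsp E -> (forall w, E (monw w)) ->
  forall x, inUp x -> E x.
Proof.
move=> hE h _ [P ->]; apply: (subsp_sum P hE) => p.
exact: subspZ.
Qed.

Lemma monw_nil : monw [::] = 1. Proof. by rewrite /monw big_nil. Qed.
Lemma monw_cons i w : monw (i :: w) = letr i * monw w.
Proof. by rewrite /monw big_cons. Qed.
Lemma monw1 i : monw [:: i] = letr i. Proof. by rewrite monw_cons monw_nil mulr1. Qed.
Lemma monw_cat v w : monw (v ++ w) = monw v * monw w.
Proof. by rewrite /monw big_cat. Qed.

Lemma inUp1 : inUp 1. Proof. by rewrite -monw_nil; exact: inUp_monw. Qed.
Lemma inUp_letr i : inUp (letr i). Proof. by rewrite -monw1; exact: inUp_monw. Qed.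

Lemma inUpM x y : inUp x -> inUp y -> inUp (x * y).
Proof.
move=> hx hy; elim/inUp_ind: x / hx => [|v].
  split; first by rewrite mul0r; apply: (subsp0 inUp_subsp).
  by move=> a x x' h h'; rewrite mulrDl -scalerAl; case: inUp_subsp => _; apply.
elim/inUp_ind: y / hy => [|w].
  split; first by rewrite mulr0; apply: (subsp0 inUp_subsp).
  by move=> a x x' h h'; rewrite mulrDr -scalerAr; case: inUp_subsp => _; apply.
by rewrite -monw_cat; exact: inUp_monw.
Qed.

Definition spanm (A : word n -> bool) x :=
  exists P, all (fun p => A p.2) P /\ x = lmon P.

Lemma spanm_subsp A : subsp (spanm A).
Proof.
split; first by exists [::]; rewrite lmon_nil.
move=> a x y [P [hP ->]] [Q [hQ ->]].
exists ([seq (a * p.1, p.2) | p <- P] ++ Q); rewrite lmon_cat lmonZ; split=> //.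
by rewrite all_cat hQ andbT all_map.
Qed.

Lemma spanm0 (A : word n -> bool) : spanm A 0. Proof. exact: subsp0 (spanm_subsp A). Qed.
Lemma spanmZ (A : word n -> bool) a x : spanm A x -> spanm A (a *: x). Proof. exact: subspZ (spanm_subsp A). Qed.
Lemma spanmD (A : word n -> bool) x y : spanm A x -> spanm A y -> spanm A (x + y). Proof. exact: subspD (spanm_subsp A). Qed.
Lemma spanmB (A : word n -> bool) x y : spanm A x -> spanm A y -> spanm A (x - y). Proof. exact: subspB (spanm_subsp A). Qed.

Lemma spanm_monw (A : word n -> bool) w : A w -> spanm A (monw w).
Proof.
move=> h; exists [:: (1, w)]; rewrite /= h lmon_cons lmon_nil addr0 scale1r.
by split.
Qed.

Lemma spanm_ind (A : word n -> bool) (E : F -> Prop) : subsp E -> (forall w, A w -> E (monw w)) ->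
  forall x, spanm A x -> E x.
Proof.
move=> hE h _ [P [/allP hP ->]]; apply: (subsp_sumP hE) => p /hP /h.
exact: subspZ.
Qed.

Lemma spanm_sub (A B : word n -> bool) x : (forall w, A w -> B w) -> spanm A x -> spanm B x.
Proof. by move=> h [P [hP ->]]; exists P; split=> //; apply: sub_all hP => p; apply: h. Qed.

Lemma spanmM (A B C : word n -> bool) x y : (forall v w, A v -> B w -> C (v ++ w)) ->
  spanm A x -> spanm B y -> spanm C (x * y).
Proof.
move=> h hx hy; elim/spanm_ind: x / hx => [|v Av].
  split; first by rewrite mul0r; apply: (subsp0 (spanm_subsp _)).
  by move=> a x x' h1 h2; rewrite mulrDl -scalerAl; case: (spanm_subsp C) => _; apply.
elim/spanm_ind: y / hy => [|w Bw].
  split; first by rewrite mulr0; apply: (subsp0 (spanm_subsp _)).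
  by move=> a x x' h1 h2; rewrite mulrDr -scalerAr; case: (spanm_subsp C) => _; apply.
by rewrite -monw_cat; apply: spanm_monw; apply: h.
Qed.

Lemma dl_letr k i : dl k (letr i) = (k == i)%:R *: 1.
Proof.
apply: shP => w; rewrite /dl /letr /delta shZE eqseq_cons.
by case: (k == i) => /=; rewrite ?mul0r // mul1r.
Qed.

Lemma dr_letr k i : dr k (letr i) = (k == i)%:R *: 1.
Proof.
apply: shP => w; rewrite /dr /letr /delta shZE -[[:: i]]/(rcons [::] i) eqseq_rcons andbC.
by case: (k == i) => /=; rewrite ?mul0r // mul1r.
Qed.

Lemma ch_letr f i : ch f (letr i) = f i *: letr i.
Proof.
apply: shP => w; rewrite /ch /letr /delta shZE.
by case: eqP => [->|_]; rewrite ?mulr0 // big_seq1.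
Qed.

Lemma letr0 i : letr i [::] = 0. Proof. by []. Qed.

Lemma ch_monw f w : ch f (monw w) = (\prod_(a <- w) f a) *: monw w.
Proof.
elim: w => [|i w IH]; first by rewrite monw_nil ch1 big_nil scale1r.
by rewrite monw_cons chM ch_letr IH big_cons -scalerAl -scalerAr scalerA.
Qed.

Fixpoint ders i w : seq (K * word n) :=
  match w with
  | [::] => [::]
  | k :: w' => ((k == i)%:R * \prod_(a <- w') chi i a, w') ::
               [seq (p.1, k :: p.2) | p <- ders i w']
  end.

Lemma lmon_map_cons k P : lmon [seq (p.1, k :: p.2) | p <- P] = letr k * lmon P.
Proof.
rewrite /lmon big_map mulr_sumr; apply: eq_bigr => p _.
by rewrite monw_cons scalerAr.
Qed.

Lemma dl_monw i w : dl i (monw w) = lmon (ders i w).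
Proof.
elim: w => [|k w IH] /=; first by rewrite monw_nil dl1 lmon_nil.
rewrite monw_cons dlM dl_letr IH lmon_cons lmon_map_cons ch_monw /= eq_sym.
by rewrite -!scalerAl mul1r scalerA.
Qed.

Lemma letrM_ders i x w : (letr i * x) w = pr (ders i w) x.
Proof.
elim: w x => [|k w IH] x; first by rewrite shM0E letr0 mul0r /pr big_nil.
rewrite shMcons IH dl_letr -scalerAl mul1r shZE /= /pr big_cons big_map /=.
by congr (_ + _); rewrite mulrA; case: eqP => [->|] //; rewrite !mul0r.
Qed.

(** Left multiplication by a letter is adjoint to the left derivation by it: [letrM_ders] and
    [dl_monw] involve the same coefficients [ders]. Induction on one word then exchanges the roles
    of the two. *)
Lemma monw_sym v w : monw v w = monw w v.
Proof.
elim: v w => [|i v IH] w.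
  rewrite monw_nil; case: w => [|k w] //; first by rewrite monw_nil.
  by rewrite monw_cons shM0E letr0 mul0r.
rewrite monw_cons letrM_ders -[monw w _]/(dl i (monw w) v) dl_monw /pr /lmon sh_sumE.
by apply: eq_bigr => p _; rewrite shZE IH.
Qed.

Lemma lmonE P w : lmon P w = \sum_(p <- P) p.1 * monw p.2 w.
Proof. by rewrite /lmon sh_sumE. Qed.

Lemma pr_sym P Q : pr P (lmon Q) = pr Q (lmon P).
Proof.
rewrite /pr; under eq_bigr => p _ do rewrite lmonE mulr_sumr.
rewrite exchange_big; apply: eq_bigr => q _.
rewrite lmonE mulr_sumr; apply: eq_bigr => p _.
by rewrite monw_sym; ring.
Qed.

(** Symmetry turns the pairing into one of a presentation of [x] with the element [lmon P], in which
    the presentation [P] is no longer visible. *)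
Lemma pr_eq P Q x : inUp x -> lmon P = lmon Q -> pr P x = pr Q x.
Proof. by case=> R -> e; rewrite pr_sym e pr_sym. Qed.

Lemma pr_linear P : linear_for *%R (pr P).
Proof.
move=> a x y; rewrite /pr mulr_sumr -big_split /=; apply: eq_bigr => p _.
by rewrite shDE shZE; ring.
Qed.

Lemma pr_spanm (A : word n -> bool) P x : inUp x -> spanm A (lmon P) -> (forall w, A w -> x w = 0) ->
  pr P x = 0.
Proof.
move=> hx [Q [/allP hQ e]] h; rewrite (pr_eq hx e) /pr big_seq big1 // => p /hQ /h ->.
exact: mulr0.
Qed.

Definition dls v x : F := fun w => x (v ++ w).
Definition drs v x : F := fun w => x (w ++ v).

Lemma dls_linear v : linear (dls v). Proof. by []. Qed.
Lemma drs_linear v : linear (drs v). Proof. by []. Qed.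
HB.instance Definition _ v := GRing.isLinear.Build K F F *:%R (dls v) (dls_linear v).
HB.instance Definition _ v := GRing.isLinear.Build K F F *:%R (drs v) (drs_linear v).

Lemma dls_nil x : dls [::] x = x. Proof. by []. Qed.
Lemma dls_cons i v x : dls (i :: v) x = dls v (dl i x). Proof. by []. Qed.
Lemma dls1 i x : dls [:: i] x = dl i x. Proof. by []. Qed.
Lemma dls_rcons i v x : dls (rcons v i) x = dl i (dls v x).
Proof. by apply: shP => w; rewrite /dls /dl cat_rcons. Qed.
Lemma drs_nil x : drs [::] x = x.
Proof. by apply: shP => w; rewrite /drs cats0. Qed.
Lemma drs_cons i v x : drs (i :: v) x = dr i (drs v x).
Proof. by apply: shP => w; rewrite /drs /dr cat_rcons. Qed.
Lemma inUp_dl k x : inUp x -> inUp (dl k x).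
Proof.
move=> hx; elim/inUp_ind: x / hx => [|w]; last by rewrite dl_monw; eexists.
split; first by rewrite linear0; apply: (subsp0 inUp_subsp).
by move=> a x y hx hy; rewrite linearP; case: inUp_subsp => _; apply.
Qed.

Lemma inUp_dls v x : inUp x -> inUp (dls v x).
Proof. by elim: v x => [|i v IH] x hx //; rewrite dls_cons; apply/IH/inUp_dl. Qed.

Lemma pr_map_cat v P x : pr [seq (p.1, v ++ p.2) | p <- P] x = pr P (dls v x).
Proof. by rewrite /pr big_map. Qed.

Lemma shM_neq0 x y z : (x * y) z != 0 ->
  exists v w, [/\ shuf v w z, x v != 0 & y w != 0].
Proof.
elim: z x y => [|k z IH] x y.
  rewrite shM0E mulf_eq0 negb_or => /andP[hx hy].
  by exists [::], [::]; split=> //; constructor.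
rewrite shMcons => h.
have /orP[/IH [v [w [sh hx hy]]]|/IH [v [w [sh hx hy]]]] :
  ((dl k x * ch (chi k) y) z != 0) || ((x * dl k y) z != 0).
  by rewrite -negb_and; apply/negP => /andP[/eqP e /eqP e']; rewrite e e' addr0 eqxx in h.
  exists (k :: v), w; split=> //; first by constructor.
  by apply/eqP => e; rewrite /ch e mulr0 eqxx in hy.
by exists v, (k :: w); split=> //; constructor.
Qed.

(** * Homogeneous elements and dominant words *)

Definition phom w x := forall v, x v != 0 -> perm_eq v w.

Lemma shuf_perm v w z : shuf v w z -> perm_eq z (v ++ w).
Proof.
elim=> // k x y {}z _ h; first by rewrite /= perm_cons.
by rewrite perm_sym -(cat1s k y) perm_catCA /= perm_cons perm_sym.
Qed.

Lemma phomM v w x y : phom v x -> phom w y -> phom (v ++ w) (x * y).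
Proof.
move=> hx hy z /shM_neq0 [a [b [/shuf_perm sh /hx pa /hy pb]]].
by apply: (perm_trans sh); apply: perm_cat.
Qed.

Lemma phom_delta w : phom w (@delta n K chi w).
Proof. by move=> v; rewrite /delta; case: (v =P w) => [->|]; rewrite ?eqxx. Qed.

Lemma phom_letr i : phom [:: i] (letr i). Proof. exact: phom_delta. Qed.

Lemma phom1 : phom [::] 1.
Proof. exact: phom_delta. Qed.

Lemma phom_subsp w : subsp (phom w).
Proof.
split; first by move=> v; rewrite eqxx.
move=> a x y hx hy v; rewrite shDE shZE => h.
case: (eqVneq (x v) 0) => [e|/hx//]; apply: hy.
by move: h; rewrite e mulr0 add0r.
Qed.

Lemma phom0 w : phom w 0. Proof. exact: subsp0 (phom_subsp w). Qed.
Lemma phomZ w a x : phom w x -> phom w (a *: x). Proof. exact: subspZ (phom_subsp w). Qed.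
Lemma phomB w x y : phom w x -> phom w y -> phom w (x - y). Proof. exact: subspB (phom_subsp w). Qed.

Lemma phom_perm v w x : perm_eq v w -> phom v x -> phom w x.
Proof. by move=> p h u /h h'; apply: perm_trans h' p. Qed.

Lemma phom_monw w : phom w (monw w).
Proof.
elim: w => [|i w IH]; first by rewrite monw_nil; exact: phom1.
by rewrite monw_cons -cat1s; apply: phomM => //; exact: phom_letr.
Qed.

Lemma phom_ch f w x : phom w x -> ch f x = (\prod_(a <- w) f a) *: x.
Proof.
move=> h; apply: shP => v; rewrite /ch shZE.
case: (eqVneq (x v) 0) => [->|/h p]; first by rewrite !mulr0.
by rewrite (perm_big _ p).
Qed.

Lemma phom_dls v w x : phom (v ++ w) x -> phom w (dls v x).
Proof. by move=> h u /h; rewrite perm_cat2l. Qed.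

Lemma phom_dls_size v w x u : phom w x -> dls v x u != 0 ->
  (size v + size u = size w)%N.
Proof. by move=> h /h /perm_size; rewrite size_cat. Qed.

Definition wcomp w x : F := fun v => if perm_eq v w then x v else 0.

Lemma comp_linear w : linear (wcomp w).
Proof.
move=> a x y; apply: shP => v; rewrite /wcomp !shDE !shZE.
by case: ifP => // _; rewrite mulr0 addr0.
Qed.
HB.instance Definition _ w := GRing.isLinear.Build K F F *:%R (wcomp w) (comp_linear w).

Lemma phom_comp w x : phom w (wcomp w x).
Proof. by move=> v; rewrite /wcomp; case: ifP => //; rewrite eqxx. Qed.

Lemma comp_monw w v : wcomp w (monw v) = (perm_eq v w)%:R *: monw v.
Proof.
apply: shP => u; rewrite /wcomp shZE.
case: (eqVneq (monw v u) 0) => [->|/phom_monw p]; first by rewrite mulr0 if_same.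
by rewrite (permPl p); case: ifP => _; rewrite ?mul1r ?mul0r.
Qed.

Lemma inUp_comp w x : inUp x -> inUp (wcomp w x).
Proof.
move=> hx; elim/inUp_ind: x / hx => [|v].
  split; first by rewrite linear0; apply: (subsp0 inUp_subsp).
  by move=> a x y hx hy; rewrite linearP; case: inUp_subsp => _; apply.
by rewrite comp_monw; apply: (subspZ _ inUp_subsp); apply: inUp_monw.
Qed.

Definition maxat x w := x w != 0 /\ forall v, x v != 0 -> wle v w.

Definition domin w := exists2 u, inUp u & maxat u w.

Lemma domin_phom w : domin w -> exists u, [/\ inUp u, maxat u w & phom w u].
Proof.
case=> u hu [h0 h]; exists (wcomp w u); split; [exact: inUp_comp| |exact: phom_comp].
split; first by rewrite /wcomp perm_refl.
by move=> v; rewrite /wcomp; case: ifP => [_ /h//|]; rewrite eqxx.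
Qed.

Lemma maxat_exists w x : phom w x -> x != 0 -> exists z, maxat x z.
Proof.
move=> hx xn0.
have [v hv] : exists v, x v != 0.
  apply: contrapT => H; case/eqP: xn0; apply: shP => v; apply/eqP/negbNE/negP => h.
  by apply: H; exists v.
pose s := [seq v <- permutations w | x v != 0].
have ms u : (u \in s) = (x u != 0).
  rewrite mem_filter mem_permutations; case: (eqVneq (x u) 0) => //= h.
  exact: hx.
suff H (r : seq (word n)) : r != [::] -> exists2 z, z \in r & forall u, u \in r -> wle u z.
  have [|z zs hz] := H s; first by apply/eqP => e; move: hv; rewrite -ms e.
  by exists z; split=> [|u]; rewrite -ms //; exact: hz.
elim: r => // a r IH _; case: (eqVneq r [::]) => [->|/IH [z zr hz]].
  by exists a; rewrite ?mem_head // => u; rewrite inE => /eqP->; exact: wle_refl.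
case: (boolP (wle a z)) => az.
  by exists z => [|u]; rewrite inE ?zr ?orbT // => /orP[/eqP->|/hz].
exists a; first exact: mem_head.
move=> u; rewrite inE => /orP[/eqP->|/hz uz]; first exact: wle_refl.
by apply: wle_trans uz _; apply: wltW; rewrite -[wlt _ _]negbK -wleNgt.
Qed.

Lemma maxat_domin x w : inUp x -> maxat x w -> domin w.
Proof. by move=> h1 h2; exists x. Qed.

Hypothesis chiC : forall i j, chi i j = chi j i.

Lemma dr_monw_in k w : inUp (dr k (monw w)).
Proof.
elim: w => [|i w IH]; first by rewrite monw_nil dr1; apply: (subsp0 inUp_subsp).
rewrite monw_cons (drM chiC) dr_letr ch_letr -!scalerAl mul1r.
by case: inUp_subsp => _; apply; [exact: inUp_monw|apply: (subspZ _ inUp_subsp); apply: inUpM; [exact: inUp_letr|]].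
Qed.

Lemma inUp_dr k x : inUp x -> inUp (dr k x).
Proof.
move=> hx; elim/inUp_ind: x / hx => [|w]; last exact: dr_monw_in.
split; first by rewrite linear0; apply: (subsp0 inUp_subsp).
by move=> a x y hx hy; rewrite linearP; case: inUp_subsp => _; apply.
Qed.

Lemma inUp_drs v x : inUp x -> inUp (drs v x).
Proof. by elim: v => [|i v IH] hx; rewrite ?drs_nil // drs_cons; apply/inUp_dr/IH. Qed.

(** The element is taken homogeneous, so that all words left after stripping the suffix [w] have the
    length of [v]; comparing them followed by [w] then compares the words themselves. *)
Lemma domin_catl v w : domin (v ++ w) -> domin v.
Proof.
move/domin_phom=> [u [hu [h0 h] hp]].
exists (drs w u); first exact: inUp_drs.
split=> // a; rewrite /drs => ha; apply: (wle_cat_size _ (h _ ha)).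
by have /perm_size := hp _ ha; rewrite !size_cat => /addIn.
Qed.

Lemma domin_catr v w : domin (v ++ w) -> domin w.
Proof.
move/domin_phom=> [u [hu [h0 h] hp]].
exists (dls v u); first exact: inUp_dls.
by split=> // a; rewrite /dls => /h; rewrite wle_cat2l.
Qed.

End Pairing.

(** * Bracketing of Lyndon words *)

Inductive spn (K : fieldType) (V : lmodType K) (G : V -> Prop) : V -> Prop :=
| spn0 : spn G 0
| spnS a f g : G f -> spn G g -> spn G (a *: f + g).

Section Span.
Variables (K : fieldType) (V : lmodType K).
Implicit Types (G H : V -> Prop) (f g : V).

Lemma spn_gen G f : G f -> spn G f.
Proof. by move=> h; rewrite -[f]addr0 -[f]scale1r; apply: spnS => //; apply: spn0. Qed.

Lemma spnD G f g : spn G f -> spn G g -> spn G (f + g).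
Proof.
move=> hf hg; elim: hf => [|a f1 g1 h1 _ IH]; first by rewrite add0r.
by rewrite -addrA; apply: spnS.
Qed.

Lemma spnZ G a f : spn G f -> spn G (a *: f).
Proof.
elim=> [|b f1 g1 h1 _ IH]; first by rewrite scaler0; apply: spn0.
by rewrite scalerDr scalerA; apply: spnS.
Qed.

Lemma spnN G f : spn G f -> spn G (- f).
Proof. by rewrite -scaleN1r; apply: spnZ. Qed.

Lemma spn_ind_sub G (E : V -> Prop) f : E 0 -> (forall a x y, E x -> E y -> E (a *: x + y)) ->
  (forall g, G g -> E g) -> spn G f -> E f.
Proof. by move=> h0 hS hG; elim=> // a f1 g1 h1 _ IH; apply: hS => //; apply: hG. Qed.

End Span.

Lemma spn_linear (K : fieldType) (V W : lmodType K) (G : V -> Prop) (H : W -> Prop)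
  (phi : V -> W) : linear phi -> (forall f, G f -> spn H (phi f)) ->
  forall f, spn G f -> spn H (phi f).
Proof.
move=> lp h f; elim=> [|a f1 g1 h1 _ IH].
  have := lp (-1) 0 0; rewrite scaler0 addr0 scaleN1r addNr => ->; exact: spn0.
by rewrite lp; apply: spnD => //; apply/spnZ/h.
Qed.

Section Bracket.
Variables (n : nat) (K : fieldType) (chi : 'I_n -> 'I_n -> K).
Hypothesis chiC : forall i j, chi i j = chi j i.
Hypothesis chi_neq0 : forall i j, chi i j != 0.
Local Notation F := (sh chi).
Implicit Types (x y : F) (u v w z l a b c : word n) (i j k : 'I_n).

Definition iw u (a : 'I_n) : K := (\prod_(b <- u) chi b a)^-1.

(** The subtracted term is the shuffle product for the inverse parameter: [iw u] undoes the factors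
    [chi] between the letters of [u] and those of [y]. The identification with [starqq] is
    [sem_starqq]. *)
Definition brk u x y : F := x * y - ch (iw u) y * x.

Lemma iwK u k : iw u k * \prod_(a <- u) chi k a = 1.
Proof.
rewrite /iw (eq_bigr (fun t => chi k t)) // mulVf //.
by rewrite prodf_seq_neq0; apply/allP => b _; rewrite chi_neq0.
Qed.

Lemma dl_brk k u x y : phom u x -> dl k (brk u x y) =
  brk u x (dl k y) + (dl k x * ch (chi k) y - ch (iw u) y * dl k x).
Proof.
move=> hx; rewrite /brk linearB /= !dlM dl_ch (phom_ch _ hx).
rewrite -scalerAl -scalerAr scalerA iwK scale1r opprD !addrA.
by rewrite [dl k x * _ + _]addrC; congr (_ - _); rewrite addrAC.
Qed.

Definition QS l (s : nat) w := wlt l w && (size w + s == size l)%N.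
Definition QE l (s : nat) w := wle l w && (size w + s == size l)%N.

Definition leadp l x := exists2 x', spanm (chi := chi) (QS l 0) x' & x = monw chi l + x'.
Definition dlsp l x :=
  forall a, (0 < size a < size l)%N -> spanm (chi := chi) (QS l (size a)) (dls a x).
(** The invariant kept by bracketing. The condition [dlsp] is made for the pairing: left
    multiplication by a monomial is adjoint to a left derivative of [x], and the monomials appearing
    there all exceed [l]. *)
Definition lybr l x := [/\ phom l x, leadp l x, dlsp l x & inUp x].

Lemma QS_QE l s w : QS l s w -> QE l s w.
Proof. by rewrite /QS /QE => /andP[/wltW-> ->]. Qed.

Lemma leadp_QE l x : leadp l x -> spanm (QE l 0) x.
Proof.
case=> x' hx' ->; apply: spanmD; last by apply: spanm_sub hx' => w; exact: QS_QE.
by apply: spanm_monw; rewrite /QE wle_refl addn0 eqxx.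
Qed.

Lemma ch_dls f v a y : phom v y -> exists t, ch f (dls a y) = t *: dls a y.
Proof.
move=> hy; case: (pselect (exists w, dls a y w != 0)) => [[w hw]|h].
  exists (\prod_(b <- w) f b); apply: (phom_ch _ _) => z hz.
  have p1 := hy _ hw; have p2 := hy _ hz.
  by rewrite -(perm_cat2l a) (perm_trans p2) // perm_sym.
exists 0; rewrite scale0r; apply: shP => w; rewrite /ch.
case: (eqVneq (dls a y w) 0) => [->|hw]; first by rewrite mulr0.
by case: h; exists w.
Qed.

Lemma dls_full v a y : phom v y -> size a = size v -> dls a y = y a *: 1.
Proof.
move=> hy sa; apply: shP => w; rewrite shZE.
case: (eqVneq (dls a y w) 0) => [e|hw].
  case: w e => [|k w] e; last by rewrite e mulr0.
  by rewrite sh10E mulr1 -{2}(cats0 a).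
have := phom_dls_size hy hw; rewrite sa -{2}[size v]addn0 => /addnI/eqP.
by rewrite size_eq0 => /eqP ->; rewrite sh10E mulr1 /dls cats0.
Qed.

Lemma dls_over v a y : phom v y -> (size v < size a)%N -> dls a y = 0.
Proof.
move=> hy sa; apply: shP => w; apply/eqP; case: eqP => // /eqP hw.
by have := phom_dls_size hy hw => e; move: sa; rewrite -e ltnNge leq_addr.
Qed.

Section Step.
Variables (u v : word n) (x y : F).
Hypotheses (lu : lyndon u) (lv : lyndon v) (uv : wlt u v).
Hypotheses (hx : lybr u x) (hy : lybr v y).
Let l := u ++ v.
Let lv' : wlt l v.
Proof.
have ll := lyndon_cat lu lv uv.
by case/lyndonP: ll => _ h; apply: (h u v) => //; apply/eqP/lyndon_ne.
Qed.

(** The error terms in the derivatives of a bracket: at least one derivation has fallen on [x], so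
    [b] is nonempty. *)
Definition brk_gen (m : nat) (f : F) := exists b c, [/\ b != [::],
  (size b + size c)%N = m & f = dls b x * dls c y \/ f = dls c y * dls b x].

Let hxp : phom u x. Proof. by case: hx. Qed.
Let hyp : phom v y. Proof. by case: hy. Qed.

(** A derivation falling on [y] passes through the bracket without changing its twist, because the
    factor from passing [x] cancels against [iw u]. The terms where some derivation falls on [x] are
    collected in [t]. *)
Lemma dls_brk a : exists2 t, spn (brk_gen (size a)) t &
  dls a (brk u x y) = brk u x (dls a y) + t.
Proof.
elim/last_ind: a => [|a k [t ht e]]; first by exists 0; [exact: spn0|rewrite addr0].
exists (dl k x * ch (chi k) (dls a y) - ch (iw u) (dls a y) * dl k x + dl k t); last first.
  by rewrite !dls_rcons e linearD /= (dl_brk _ _ hxp) -addrA.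
rewrite size_rcons; apply: spnD; last first.
  apply: (spn_linear (phi := dl k) (dl_linear k) _ ht).
  move=> f [b [c [bn sbc [->|->]]]]; rewrite dlM.
    have [t' ->] := ch_dls (chi k) c hyp; rewrite -!dls_rcons -scalerAr.
    apply: spnD; [apply/spnZ|]; apply: spn_gen; [exists (rcons b k), c|exists b, (rcons c k)];
      rewrite size_rcons ?addnS ?addSn sbc; split=> //; try (by left).
    by case: (b).
  have [t' ->] := ch_dls (chi k) b hxp; rewrite -!dls_rcons -scalerAr.
  apply: spnD; [apply/spnZ|]; apply: spn_gen; [exists b, (rcons c k)|exists (rcons b k), c];
    rewrite size_rcons ?addnS ?addSn sbc; split=> //; try (by right).
  by case: (b).
have [t1 ->] := ch_dls (chi k) a hyp; have [t2 ->] := ch_dls (iw u) a hyp.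
rewrite -scalerAr -scalerAl -!dls1.
apply: spnD; [|apply: spnN]; apply/spnZ/spn_gen; exists [:: k], a; split=> //; [by left|by right].
Qed.

Lemma brk_gen_spanm m f : (m < size l)%N -> brk_gen m f -> spanm (QS l m) f.
Proof.
move=> ml [b [c [bn sbc hf]]].
have gE : (size c < size v)%N -> spanm (QE v (size c)) (dls c y).
  move=> sc; case: (c) sc => [|k c'] sc; first by apply: leadp_QE; case: hy.
  by case: hy => _ _ h _; apply: spanm_sub (h (k :: c') _) => // w; apply: QS_QE.
have fE : (size b < size u)%N -> spanm (QS u (size b)) (dls b x).
  by move=> sb; case: hx => _ _ h _; apply: h; rewrite sb lt0n size_eq0 bn.
have sl : size l = (size u + size v)%N by rewrite size_cat.
have z0 : spanm (chi := chi) (QS l m) 0 by exact: spanm0.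
have vgt w r : wle v w -> wlt l (w ++ r).
  by move=> h; apply: wlt_catw; apply: wlt_le_trans lv' h.
have ugt w r : wlt u w -> (size w + size b)%N = size u -> wlt l (w ++ r).
  move=> h e; apply: dltW; apply: dlt_cat; apply: wlt_dlt => //.
  by rewrite -e leq_addr.
case: (ltngtP (size c) (size v)) => sc.
- case: (ltngtP (size b) (size u)) => sb.
  + have {}gE := gE sc; have {}fE := fE sb.
    case: hf => ->.
      apply: spanmM fE gE => w1 w2 /andP[h1 /eqP s1] /andP[h2 /eqP s2].
      by rewrite /QS (ugt _ _ h1 s1) size_cat sl -s1 -s2 -sbc addnACA eqxx.
    apply: spanmM gE fE => w1 w2 /andP[h1 /eqP s1] /andP[h2 /eqP s2].
    by rewrite /QS (vgt _ _ h1) size_cat sl -s1 -s2 -sbc; apply/eqP; ring.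
  + have e0 : dls b x = 0 by apply: dls_over sb.
    by case: hf => ->; rewrite e0 ?mulr0 ?mul0r.
  + have {}gE := gE sc.
    suff h : spanm (QS l m) (dls c y).
      by case: hf => ->; rewrite (dls_full hxp sb) -?scalerAl -?scalerAr ?mul1r ?mulr1;
        exact: spanmZ.
    apply: spanm_sub gE => w /andP[h1 /eqP s1].
    by rewrite /QS -{1}[w]cats0 vgt //= sl -s1 -sbc sb addnCA.
- have e0 : dls c y = 0 by apply: dls_over sc.
  by case: hf => ->; rewrite e0 ?mulr0 ?mul0r.
- case: (ltngtP (size b) (size u)) => sb.
  + have {}fE := fE sb.
    suff h : spanm (QS l m) (dls b x).
      by case: hf => ->; rewrite (dls_full hyp sc) -?scalerAl -?scalerAr ?mul1r ?mulr1;
        exact: spanmZ.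
    apply: spanm_sub fE => w /andP[h1 /eqP s1].
    by rewrite /QS -{1}[w]cats0 ugt //= sl -s1 -sbc sc addnA.
  + have e0 : dls b x = 0 by apply: dls_over sb.
    by case: hf => ->; rewrite e0 ?mulr0 ?mul0r.
  + by move: ml; rewrite -sbc sb sc sl ltnn.
Qed.

Lemma brk_lybr : lybr l (brk u x y).
Proof.
have sl : size l = (size u + size v)%N by rewrite size_cat.
have [_ lx dx ux] := hx; have [_ ly dy uy] := hy.
have chy a : exists t, ch (iw u) (dls a y) = t *: dls a y := ch_dls (iw u) a hyp.
have xy_lt w1 w2 : wle u w1 -> size w1 = size u -> wlt v w2 -> wlt l (w1 ++ w2).
  case/orP=> [/eqP <- _|h s1 h2]; first by rewrite wlt_cat2l.
  by apply/dltW/dlt_cat/wlt_dlt; rewrite ?s1.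
have yx_lt w1 w2 : wle v w1 -> wlt l (w1 ++ w2).
  by move=> h; apply: wlt_catw; apply: wlt_le_trans lv' h.
have [t0 ch0] := chy [::]; rewrite !dls_nil in ch0.
split.
- rewrite /brk ch0 -scalerAl; apply: phomB; first exact: phomM.
  apply: phomZ; apply: (@phom_perm _ _ _ (v ++ u)); last exact: phomM.
  by rewrite perm_catC.
- have [x' hx' ex] := lx; have [y' hy' ey] := ly.
  exists (monw chi u * y' + x' * y - t0 *: (y * x)); last first.
    rewrite /brk ch0 -scalerAl !addrA; congr (_ - _).
    by rewrite {1}ex mulrDl {1}ey mulrDr /l monw_cat -!addrA.
  apply: spanmB; [apply: spanmD|].
  + apply: (spanmM (A := QE u 0) _ _ hy') => [w1 w2|]; last first.
      by apply: spanm_monw; rewrite /QE wle_refl addn0 eqxx.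
    rewrite /QE /QS !addn0 => /andP[h1 /eqP s1] /andP[h2 /eqP s2].
    by rewrite xy_lt //= size_cat sl s1 s2 eqxx.
  + apply: (spanmM _ hx' (leadp_QE ly)) => w1 w2.
    rewrite /QE /QS !addn0 => /andP[h1 /eqP s1] /andP[h2 /eqP s2].
    rewrite size_cat sl s1 s2 eqxx andbT.
    by apply/dltW/dlt_cat/wlt_dlt; rewrite ?s1.
  + apply: spanmZ; apply: (spanmM _ (leadp_QE ly) (leadp_QE lx)) => w1 w2.
    rewrite /QE /QS !addn0 => /andP[h1 /eqP s1] /andP[h2 /eqP s2].
    by rewrite yx_lt //= size_cat sl s1 s2 addnC eqxx.
- move=> a /andP[a0 al]; have [t ht ->] := dls_brk a.
  apply: spanmD; last first.
    apply: spn_ind_sub ht; [exact: spanm0|by case: (@spanm_subsp _ _ chi (QS l (size a)))|].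
    by move=> g hg; apply: brk_gen_spanm.
  have [t1 cha] := chy a.
  case: (ltngtP (size a) (size v)) => sa.
  + have h := dy a; rewrite a0 sa in h; have {}h := h isT.
    rewrite /brk cha -scalerAl; apply: spanmB; last apply: spanmZ.
      apply: (spanmM _ (leadp_QE lx) h) => w1 w2.
      rewrite /QE /QS !addn0 => /andP[h1 /eqP s1] /andP[h2 /eqP s2].
      by rewrite xy_lt //= size_cat sl s1 -s2 addnA eqxx.
    apply: (spanmM _ h (leadp_QE lx)) => w1 w2.
    rewrite /QE /QS !addn0 => /andP[h1 /eqP s1] /andP[h2 /eqP s2].
    by rewrite (yx_lt _ _ (wltW h1)) /= size_cat sl s2 -s1; apply/eqP; ring.
  + rewrite (dls_over hyp sa) /brk linear0 mulr0 mul0r subr0; exact: spanm0.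
  (* Here the derivative of [y] is a scalar and its bracket with [x] cancels. With a plain product a
     multiple of [x] would survive, whose leading monomial [u] is smaller than [l]. *)
  + rewrite (dls_full hyp sa) /brk linearZ /= ch1 -scalerAl -scalerAr mul1r mulr1 subrr.
    exact: spanm0.
- rewrite /brk ch0 -scalerAl; apply: inUpB; first exact: inUpM.
  by apply: inUpZ; apply: inUpM.
Qed.
End Step.

Fixpoint rlf (f : nat) l : F :=
  match f with
  | 0%N => 0
  | f'.+1 => if (size l <= 1)%N then delta chi l
             else brk (take (costd l) l) (rlf f' (take (costd l) l))
                                         (rlf f' (drop (costd l) l))
  end.

Lemma lybr1 i : lybr [:: i] (letr chi i).
Proof.
split; [exact: phom_letr| | |exact: inUp_letr].
  exists 0; first exact: spanm0.
  by rewrite monw1 addr0.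
by move=> a /=; case: (a) => // k a'; rewrite ltnS ltn0.
Qed.

Lemma rlf_lybr f l : lyndon l -> (size l <= f)%N -> lybr l (rlf f l).
Proof.
elim: f l => [|f IH] l ll; first by rewrite leqn0 size_eq0 (negbTE (lyndon_ne ll)).
move=> sl /=; case: leqP => s1.
  case: l ll s1 {sl} => [|i [|? ?]] //= _ _; exact: lybr1.
have [/andP[c0 cl] _] := costd_bound s1 ll.
have [lu lv uv] := costdP s1 ll.
set u := take _ _ in lu uv *; set v := drop _ _ in lv uv *.
have -> : l = u ++ v by rewrite cat_take_drop.
apply: brk_lybr => //; apply: IH => //.
  by rewrite size_take cl -ltnS (leq_trans cl sl).
rewrite size_drop leq_subLR (leq_trans sl) // -add1n leq_add2r //.
Qed.

Lemma rlf_phom f l : phom l (rlf f l).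
Proof.
elim: f l => [|f IH] l /=; first exact: phom0.
case: ifP => _; first exact: phom_delta.
set u := take _ _; set v := drop _ _.
have -> : l = u ++ v by rewrite cat_take_drop.
rewrite /brk (phom_ch _ (IH v)) -scalerAl.
apply: phomB; first exact: phomM.
apply: phomZ; apply: (@phom_perm _ _ _ (v ++ u)); last exact: phomM.
by rewrite perm_catC.
Qed.

End Bracket.

(** * Weights in a lattice with a bicharacter *)

Section Bichar.
Variables (K : fieldType) (Lam : zmodType) (X : Lam -> Lam -> K).
Definition bichar := [/\ forall u v, X u v = X v u,
  forall u v w, X (u + v) w = X u w * X v w & forall u v, X u v != 0].
Hypothesis hX : bichar.
Lemma biC u v : X u v = X v u. Proof. by case: hX. Qed.
Lemma biDl u v w : X (u + v) w = X u w * X v w. Proof. by case: hX. Qed.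
Lemma biDr u v w : X w (u + v) = X w u * X w v. Proof. by rewrite biC biDl !(biC w). Qed.
Lemma bi_neq0 u v : X u v != 0. Proof. by case: hX. Qed.
Lemma bi0l v : X 0 v = 1.
Proof. by apply: (mulfI (bi_neq0 0 v)); rewrite -biDl addr0 mulr1. Qed.
Lemma bi0r v : X v 0 = 1. Proof. by rewrite biC bi0l. Qed.
Lemma biNl u v : X (- u) v = (X u v)^-1.
Proof. by apply: (mulfI (bi_neq0 u v)); rewrite -biDl subrr bi0l mulfV // bi_neq0. Qed.
Lemma biNr u v : X u (- v) = (X u v)^-1. Proof. by rewrite biC biNl biC. Qed.
Lemma biMnl u v k : X (u *+ k) v = X u v ^+ k.
Proof. by elim: k => [|k IH]; rewrite ?bi0l // mulrS biDl IH exprS. Qed.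
Lemma biMnr u v k : X u (v *+ k) = X u v ^+ k. Proof. by rewrite biC biMnl biC. Qed.
End Bichar.

Section Weights.
Variables (n : nat) (K : fieldType) (Lam : zmodType) (X : Lam -> Lam -> K).
Hypothesis hX : bichar X.
Variable al : 'I_n -> Lam.

Definition chiX : 'I_n -> 'I_n -> K := fun j k => X (al j) (al k).
Local Notation F := (sh chiX).
Implicit Types (x y : F) (w z : word n) (i j k : 'I_n) (f g : Lam -> K) (u v : Lam).

Lemma chiXC i j : chiX i j = chiX j i. Proof. exact: biC. Qed.
Lemma chiX_neq0 i j : chiX i j != 0. Proof. exact: bi_neq0. Qed.

Definition wta w : Lam := \sum_(a <- w) al a.
(** Any function of the weight is allowed, so that stability under these operators covers both the
    torus [Th] and the projections [pj] to weight spaces. *)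
Definition Mw f x : F := fun w => f (wta w) * x w.
Definition homw v x := forall w, x w != 0 -> wta w = v.
Definition Th v : F -> F := Mw (X v).

Lemma wta_cons k w : wta (k :: w) = al k + wta w. Proof. by rewrite /wta big_cons. Qed.
Lemma wta_nil : wta [::] = 0. Proof. by rewrite /wta big_nil. Qed.
Lemma wta_cat w z : wta (w ++ z) = wta w + wta z. Proof. by rewrite /wta big_cat. Qed.
Lemma wta_rcons k w : wta (rcons w k) = wta w + al k.
Proof. by rewrite -cats1 wta_cat wta_cons wta_nil addr0. Qed.
Lemma wta_perm w z : perm_eq w z -> wta w = wta z. Proof. exact: perm_big. Qed.

Lemma Mw_linear f : linear (Mw f).
Proof. by move=> a x y; apply: shP => w; rewrite /Mw !shDE !shZE; ring. Qed.
HB.instance Definition _ f := GRing.isLinear.Build K F F *:%R (Mw f) (Mw_linear f).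
Lemma Th_linear v : linear (Th v). Proof. exact: Mw_linear. Qed.
HB.instance Definition _ v := GRing.isLinear.Build K F F *:%R (Th v) (Th_linear v).

Lemma MwM f g x : Mw f (Mw g x) = Mw (fun u => f u * g u) x.
Proof. by apply: shP => w; rewrite /Mw mulrA. Qed.
Lemma Mw_ext f g x : f =1 g -> Mw f x = Mw g x.
Proof. by move=> e; apply: shP => w; rewrite /Mw e. Qed.

Lemma bi_wta v w : X v (wta w) = \prod_(a <- w) X v (al a).
Proof. by elim: w => [|k w IH]; rewrite ?wta_nil ?big_nil ?(bi0r hX) // wta_cons big_cons biDr // IH. Qed.

Lemma ThE v x : Th v x = ch (fun a => X v (al a)) x.
Proof. by apply: shP => w; rewrite /Th /Mw /ch bi_wta. Qed.
Lemma ch_chiX k x : ch (chiX k) x = Th (al k) x. Proof. by rewrite ThE. Qed.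
Lemma ThM v x y : Th v (x * y) = Th v x * Th v y. Proof. by rewrite !ThE chM. Qed.
Lemma ThD u v x : Th u (Th v x) = Th (u + v) x.
Proof. by rewrite /Th MwM; apply: Mw_ext => t; rewrite biDl. Qed.
Lemma Th0 x : Th 0 x = x.
Proof. by apply: shP => w; rewrite /Th /Mw (bi0l hX) mul1r. Qed.
Lemma Th1 v : Th v 1 = 1. Proof. by rewrite ThE ch1. Qed.

Lemma dl_Mw k f x : dl k (Mw f x) = Mw (fun u => f (al k + u)) (dl k x).
Proof. by apply: shP => w; rewrite /dl /Mw wta_cons. Qed.
Lemma dr_Mw k f x : dr k (Mw f x) = Mw (fun u => f (u + al k)) (dr k x).
Proof. by apply: shP => w; rewrite /dr /Mw wta_rcons. Qed.
Lemma dl_Th k v x : dl k (Th v x) = X v (al k) *: Th v (dl k x).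
Proof. by rewrite !ThE dl_ch. Qed.
Lemma dr_Th k v x : dr k (Th v x) = X v (al k) *: Th v (dr k x).
Proof. by rewrite !ThE dr_ch. Qed.

Lemma hom_Mw f v x : homw v x -> Mw f x = f v *: x.
Proof.
move=> h; apply: shP => w; rewrite /Mw shZE.
by case: (eqVneq (x w) 0) => [->|/h->]; rewrite ?mulr0.
Qed.

Lemma Mw_mul_aux f z v x y : homw v y -> f (wta z) * (x * y) z =
  (Mw (fun u => f (u + v)) x * y) z.
Proof.
elim: z f v x y => [|k z IH] f v x y hy.
  rewrite !shM0E /Mw wta_nil add0r.
  case: (eqVneq (y [::]) 0) => [->|/hy]; first by rewrite !mulr0.
  by rewrite wta_nil => <-; rewrite mulrA.
rewrite !shMcons wta_cons mulrDr; congr (_ + _).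
  have h : homw v (ch (chiX k) y).
    by rewrite ch_chiX => w h; apply: hy; apply: contra h => /eqP e; rewrite /Th /Mw e mulr0.
  rewrite (IH (fun t => f (al k + t)) _ _ _ h) dl_Mw.
  by congr ((_ * _ : F) z); apply: Mw_ext => t; rewrite addrA.
have h : homw (v - al k) (dl k y).
  by move=> w /hy; rewrite wta_cons => <-; rewrite addrC addKr.
rewrite (IH (fun t => f (al k + t)) _ _ _ h).
by congr ((_ * _ : F) z); apply: Mw_ext => t; rewrite addrCA [al k + _]addrC subrK.
Qed.

Lemma Mw_mulr f v x y : homw v y -> Mw f (x * y) = Mw (fun u => f (u + v)) x * y.
Proof. by move=> hy; apply: shP => z; rewrite -Mw_mul_aux. Qed.

Lemma Mw_mull_aux f z v x y : homw v x -> f (wta z) * (x * y) z =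
  (x * Mw (fun u => f (v + u)) y) z.
Proof.
elim: z f v x y => [|k z IH] f v x y hx.
  rewrite !shM0E /Mw wta_nil addr0.
  case: (eqVneq (x [::]) 0) => [->|/hx]; first by rewrite !mul0r mulr0.
  by rewrite wta_nil => <-; rewrite mulrCA.
rewrite !shMcons wta_cons mulrDr; congr (_ + _).
  have h : homw (v - al k) (dl k x).
    by move=> w /hx; rewrite wta_cons => <-; rewrite addrC addKr.
  rewrite (IH (fun t => f (al k + t)) _ _ _ h) !ch_chiX /Th !MwM.
  by congr ((_ * _ : F) z); apply: Mw_ext => t; rewrite addrA [al k + _]addrC subrK mulrC.
rewrite (IH (fun t => f (al k + t)) _ _ _ hx) dl_Mw.
by congr ((_ * _ : F) z); apply: Mw_ext => t; rewrite addrCA.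
Qed.

Lemma Mw_mull f v x y : homw v x -> Mw f (x * y) = x * Mw (fun u => f (v + u)) y.
Proof. by move=> hx; apply: shP => z; rewrite -Mw_mull_aux. Qed.

Lemma phom_hom w x : phom w x -> homw (wta w) x.
Proof. by move=> h v /h; exact: wta_perm. Qed.

Lemma inUp_Mw f x : inUp x -> inUp (Mw f x).
Proof.
move=> hx; elim/inUp_ind: x / hx => [|w].
  split; first by rewrite linear0; exact: inUp0.
  by move=> a x y hx hy; rewrite linearP; apply: inUpD => //; exact: inUpZ.
by rewrite (hom_Mw f (phom_hom (@phom_monw _ _ chiX w))); apply/inUpZ/inUp_monw.
Qed.

Lemma homM u v x y : homw u x -> homw v y -> homw (u + v) (x * y).
Proof.
move=> hx hy z /shM_neq0 [a [b [/shuf_perm sh /hx <- /hy <-]]].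
by rewrite (wta_perm sh) wta_cat.
Qed.

Lemma hom_drs w v x : homw v x -> homw (v - wta w) (drs w x).
Proof. by move=> h u /h; rewrite wta_cat => <-; rewrite addrK. Qed.

Lemma hom_subsp v : subsp (homw v).
Proof.
split; first by move=> w; rewrite eqxx.
move=> a x y hx hy w; rewrite shDE shZE => h.
case: (eqVneq (x w) 0) => [e|/hx//]; apply: hy.
by move: h; rewrite e mulr0 add0r.
Qed.

Lemma hom_letr i : homw (al i) (letr chiX i).
Proof. by have := phom_hom (@phom_letr n K chiX i); rewrite wta_cons wta_nil addr0. Qed.

Lemma hom_Mw_hom f v x : homw v x -> homw v (Mw f x).
Proof. by move=> h w h'; apply: h; apply: contra h' => /eqP e; rewrite /Mw e mulr0. Qed.

Definition pj v : F -> F := Mw (fun u => (u == v)%:R).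
Lemma hom_pj v x : homw v (pj v x).
Proof. by move=> w; rewrite /pj /Mw; case: (wta w =P v) => [->//|_]; rewrite mul0r eqxx. Qed.
Lemma pj_hom v x : homw v x -> pj v x = x.
Proof. by move=> h; rewrite /pj (hom_Mw _ h) eqxx scale1r. Qed.

End Weights.

(** * Simple reflections: from the kernel of a skew derivation to the reflected algebra *)

Section RankOne.
Variables (K : fieldType) (c s : K).
Definition qint (t : nat) : K := \sum_(r < t) s ^+ r.
Lemma qintS t : qint t.+1 = qint t + s ^+ t. Proof. by rewrite /qint big_ord_recr. Qed.
Lemma qint0 : qint 0 = 0. Proof. by rewrite /qint big_ord0. Qed.
Lemma qintSl t : qint t.+1 = 1 + s * qint t.
Proof.
rewrite /qint big_ord_recl expr0 mulr_sumr; congr (_ + _).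
by apply: eq_bigr => r _; rewrite -exprS.
Qed.

(* dl i maps the r-th term of the alpha_i-string of a letter j to cst r times the previous one,
   for c = chi i j and s = chi i i *)
Fixpoint cst (r : nat) : K :=
  if r is r'.+1 then cst r' + (c * s ^+ r' - (c * s ^+ r')^-1) else 0.

Hypotheses (c0 : c != 0) (s0 : s != 0).

(** Summing the two geometric progressions leaves a quantum integer times [c ^+ 2 * s ^+ r - 1]. So
    a string can end in two ways: at a zero of the quantum integer, as for an odd isotropic root, or
    at the Cartan condition. *)
Lemma cstE r : cst r.+1 * (c * s ^+ r) = qint r.+1 * (c ^+ 2 * s ^+ r - 1).
Proof.
have H (a t : K) : t != 0 -> (a + (t - t^-1)) * t = a * t + (t ^+ 2 - 1) by move=> ?; field.
have nz t : c * s ^+ t != 0 by rewrite mulf_neq0 ?expf_neq0.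
elim: r => [|r IH].
  by rewrite /= H ?nz // qintS qint0 expr0; ring.
rewrite [cst _]/= -/(cst r.+1) H ?nz // exprS.
have -> : cst r.+1 * (c * (s * s ^+ r)) = s * (cst r.+1 * (c * s ^+ r)) by ring.
have E : qint r.+1 + s * s ^+ r = 1 + s * qint r.+1 by rewrite -exprS -qintS qintSl.
rewrite IH [qint r.+2]qintSl -E.
transitivity (c ^+ 2 * (s * s ^+ r) * (qint r.+1 + s * s ^+ r) - (1 + s * qint r.+1)).
  by ring.
by rewrite -E; ring.
Qed.

Lemma cst_eq0 r : (cst r.+1 == 0) = (qint r.+1 * (c ^+ 2 * s ^+ r - 1) == 0).
Proof. by rewrite -cstE !mulf_eq0 expf_eq0 (negbTE c0) (negbTE s0) andbF !orbF. Qed.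
End RankOne.

Ltac shring := apply: shP => ?; rewrite !(shDE, shNE, shZE); ring.

Section Raising.
Variables (n : nat) (K : fieldType) (Lam : zmodType) (X : Lam -> Lam -> K).
Hypothesis hX : bichar X.
Variables (al : 'I_n -> Lam) (i : 'I_n).
Local Notation chi := (chiX X al).
Local Notation F := (sh chi).
Local Notation e := (letr chi i).
Local Notation s := (X (al i) (al i)).
Local Notation Tw := (Th (X := X) (al := al)).
Implicit Types (x y : F) (w z : word n) (j k : 'I_n).

Let s0 : s != 0 := bi_neq0 hX _ _.

(** The q-commutator with the letter [i], an adjoint action; [Bop] is its mirror image. [Aop]
    preserves the kernel of [dr i] and [Bop] that of [dl i], since the two terms created by deriving
    the letter cancel. *)
Definition Aop x : F := e * x - Tw (- al i) x * e.
Definition Bop x : F := x * e - e * Tw (- al i) x.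

Lemma Aop_linear : linear Aop.
Proof.
move=> a x y; rewrite /Aop linearP mulrDr mulrDl -scalerAr -scalerAl.
by rewrite scalerBr opprD addrACA.
Qed.
Lemma Bop_linear : linear Bop.
Proof.
move=> a x y; rewrite /Bop linearP mulrDr mulrDl -scalerAr -scalerAl.
by rewrite scalerBr opprD addrACA.
Qed.
HB.instance Definition _ := GRing.isLinear.Build K F F *:%R Aop Aop_linear.
HB.instance Definition _ := GRing.isLinear.Build K F F *:%R Bop Bop_linear.

Lemma Th_letr v j : Tw v (letr chi j) = X v (al j) *: letr chi j.
Proof. by rewrite (ThE hX) ch_letr. Qed.

Lemma dlMT k x y : dl k (x * y) = dl k x * Tw (al k) y + x * dl k y.
Proof. by rewrite dlM (ch_chiX hX). Qed.
Lemma drMT k x y : dr k (x * y) = dr k x * y + Tw (al k) x * dr k y.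
Proof. by rewrite drM ?(ch_chiX hX) // => a b; exact: chiXC. Qed.

Lemma dl_e k : dl k e = (k == i)%:R *: 1. Proof. exact: dl_letr. Qed.
Lemma dr_e k : dr k e = (k == i)%:R *: 1. Proof. exact: dr_letr. Qed.

Lemma ThNK v x : Tw v (Tw (- v) x) = x.
Proof. by rewrite (ThD hX) subrr (Th0 hX). Qed.

Lemma AopM x y : Aop (x * y) = Aop x * y + Tw (- al i) x * Aop y.
Proof.
rewrite /Aop (ThM hX) mulrBl mulrBr !mulrA; rewrite [RHS]addrA subrK //.
Qed.

Lemma Aop1 : Aop 1 = 0.
Proof. by rewrite /Aop (Th1 hX) mulr1 mul1r subrr. Qed.

Lemma dr_AopK x : dr i x = 0 -> dr i (Aop x) = 0.
Proof.
move=> h; rewrite /Aop linearB /= !drMT dr_e eqxx scale1r mul1r mulr1 (dr_Th hX) h.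
by rewrite linear0 scaler0 mul0r mulr0 add0r addr0 ThNK subrr.
Qed.

Lemma dl_BopK x : dl i x = 0 -> dl i (Bop x) = 0.
Proof.
move=> h; rewrite /Bop linearB /= !dlMT dl_e eqxx scale1r mul1r mulr1 (dl_Th hX) h.
by rewrite linear0 scaler0 mul0r mulr0 add0r addr0 ThNK subrr.
Qed.

(** The rank-one commutation relation: [Aop] raises, [dl i] lowers, and their commutator is the
    torus element minus its inverse. *)
Lemma dl_Aop x : dl i (Aop x) = Aop (dl i x) + (Tw (al i) x - Tw (- al i) x).
Proof.
rewrite /Aop linearB /= !dlMT dl_e eqxx scale1r mul1r mulr1 (dl_Th hX) Th_letr.
by rewrite -scalerAl -scalerAr scalerA (biNl hX) mulVf // scale1r; shring.
Qed.

Lemma dr_Bop x : dr i (Bop x) = Bop (dr i x) + (Tw (al i) x - Tw (- al i) x).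
Proof.
rewrite /Bop linearB /= !drMT dr_e eqxx scale1r mul1r mulr1 (dr_Th hX) Th_letr.
by rewrite -scalerAl -scalerAr scalerA (biNl hX) mulfV // scale1r; shring.
Qed.

Lemma dl_Aopj j x : j != i -> dl j (Aop x) = Aop (dl j x).
Proof.
move=> ji; rewrite /Aop linearB /= !dlMT dl_e (negbTE ji) scale0r mul0r mulr0 add0r addr0.
rewrite (dl_Th hX) Th_letr -scalerAl -scalerAr scalerA (biNl hX) (biC hX (al j)) mulVf ?scale1r //.
exact: bi_neq0.
Qed.

Lemma dr_Aopj j x : j != i -> dr j (Aop x) =
  X (al i) (al j) *: (e * dr j x) - (X (al i) (al j))^-1 *: (Tw (- al i) (dr j x) * e).
Proof.
move=> ji; rewrite /Aop linearB /= !drMT dr_e (negbTE ji) scale0r mul0r mulr0 add0r addr0.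
by rewrite (dr_Th hX) Th_letr -!scalerAl (biNl hX) (biC hX (al j)).
Qed.

Lemma iter_dr_linear t : linear (iter t (@dr n K chi i)).
Proof. by elim: t => [|t IH] a x y //=; rewrite IH linearP. Qed.
HB.instance Definition _ t :=
  GRing.isLinear.Build K F F *:%R (iter t (@dr n K chi i)) (iter_dr_linear t).

Lemma iter_drE t x w : iter t (dr i) x w = x (w ++ nseq t i).
Proof.
elim: t x w => [|t IH] x w; first by rewrite cats0.
by rewrite iterSr IH /dr rcons_cat -cats1 -[[:: i]]/(nseq 1 i) cat_nseq /ncons -iterD addn1.
Qed.

Lemma iter_dr_Th t v x : iter t (dr i) (Tw v x) = X v (al i) ^+ t *: Tw v (iter t (dr i) x).
Proof.
elim: t => [|t IH]; first by rewrite scale1r.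
by rewrite /= IH linearZ /= (dr_Th hX) scalerA exprSr.
Qed.

Lemma iter_dr_el t x : iter t (dr i) (e * x) =
  qint s t *: iter t.-1 (dr i) x + s ^+ t *: (e * iter t (dr i) x).
Proof.
elim: t => [|t IH]; first by rewrite qint0 scale0r add0r scale1r.
rewrite /= IH linearD !linearZ /= !drMT dr_e eqxx scale1r mul1r Th_letr -scalerAl.
have -> : qint s t *: dr i (iter t.-1 (dr i) x) = qint s t *: iter t (dr i) x.
  by case: (t) => [|t'] //; rewrite qint0 !scale0r.
by rewrite qintS scalerDr scalerA exprSr scalerDl addrA.
Qed.

Lemma iter_dr_re t x : iter t (dr i) (x * e) =
  iter t (dr i) x * e + qint s t *: Tw (al i) (iter t.-1 (dr i) x).
Proof.
elim: t => [|t IH]; first by rewrite qint0 scale0r addr0.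
rewrite /= IH linearD linearZ /= !drMT dr_e eqxx scale1r mulr1 (dr_Th hX) scalerA.
have -> : (qint s t * s) *: Tw (al i) (dr i (iter t.-1 (dr i) x)) =
          (qint s t * s) *: Tw (al i) (iter t (dr i) x).
  by case: (t) => [|t'] //; rewrite qint0 mul0r !scale0r.
by rewrite qintSl scalerDl scale1r [s * _]mulrC addrA.
Qed.

Lemma iter_dr_Aopj t j x : j != i -> iter t.+1 (dr i) (dr j x) = 0 ->
  iter t.+1 (dr i) (dr j (Aop x)) = (qint s t.+1 *
    (X (al i) (al j) - (X (al i) (al j))^-1 * (s ^+ t)^-1)) *: iter t (dr i) (dr j x).
Proof.
move=> ji h; rewrite dr_Aopj // linearB !linearZ /=.
rewrite -![dr i (iter t _ _)]/(iter t.+1 (dr i) _) iter_dr_el iter_dr_re /=.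
rewrite -![dr i (iter t _ _)]/(iter t.+1 (dr i) _) !iter_dr_Th h linear0 scaler0 mul0r mulr0.
rewrite scaler0 addr0 add0r [Tw (al i) (_ *: _)]linearZ /= ThNK scalerN !scalerA -scalerBl.
congr (_ *: _).
by rewrite (biNl hX) exprVn; ring.
Qed.

Lemma inUp_Aop x : inUp x -> inUp (Aop x).
Proof.
move=> h; apply: inUpB; apply: inUpM => //; [exact: inUp_letr| |exact: inUp_letr].
exact: inUp_Mw.
Qed.

Lemma inUp_Bop x : inUp x -> inUp (Bop x).
Proof.
move=> h; apply: inUpB; apply: inUpM => //; [exact: inUp_letr|exact: inUp_letr|].
exact: inUp_Mw.
Qed.

Lemma hom_Aop v x : homw (al := al) v x -> homw (al := al) (v + al i) (Aop x).
Proof.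
move=> h; have he := @hom_letr n K Lam X al i.
apply: (subspB (@hom_subsp _ _ _ X al _)); first by rewrite addrC; exact: homM.
by apply: homM => //; exact: hom_Mw_hom.
Qed.

Section Serre.
Variables (j : 'I_n) (ji : j != i).
Local Notation c := (X (al i) (al j)).
Local Notation ej := (letr chi j).

Lemma hom_iterAop r : homw (al := al) (al j + al i *+ r) (iter r Aop ej).
Proof.
elim: r => [|r IH]; first by rewrite addr0; exact: hom_letr.
by rewrite /= mulrSr addrA; exact: hom_Aop.
Qed.

Lemma Th_iterAop r : Tw (al i) (iter r Aop ej) = (c * s ^+ r) *: iter r Aop ej.
Proof.
by rewrite /Th (hom_Mw _ (@hom_iterAop r)) (biDr hX) (biMnr hX).
Qed.

Lemma ThN_iterAop r : Tw (- al i) (iter r Aop ej) = (c * s ^+ r)^-1 *: iter r Aop ej.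
Proof.
by rewrite /Th (hom_Mw _ (@hom_iterAop r)) (biNl hX) (biDr hX) (biMnr hX).
Qed.

Lemma dl_iterAop r : dl i (iter r.+1 Aop ej) = cst c s r.+1 *: iter r Aop ej.
Proof.
elim: r => [|r IH].
  rewrite /= dl_Aop dl_letr eq_sym (negbTE ji) scale0r linear0 !add0r.
  by rewrite (Th_iterAop 0) (ThN_iterAop 0) -scalerBl.
rewrite iterS dl_Aop IH linearZ /= -[Aop (iter r _ _)]/(iter r.+1 Aop ej).
rewrite Th_iterAop ThN_iterAop -scalerBl -scalerDl //.
Qed.

Lemma iterAop1 r : iter r.+1 Aop 1 = 0.
Proof. by elim: r => [|r IH]; [exact: Aop1|rewrite iterS IH linear0]. Qed.

Lemma dlk_iterAop r k : k != i -> dl k (iter r Aop ej) = iter r Aop (dl k ej).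
Proof. by move=> ki; elim: r => //= r IH; rewrite dl_Aopj // IH. Qed.

(** An element without constant term vanishes once all its left derivatives do. Here [dl i] produces
    the factor [cst], and any other derivation commutes with [Aop] and leaves [Aop] applied to a
    scalar. *)
Lemma serre r : cst c s r.+1 = 0 -> iter r.+1 Aop ej = 0.
Proof.
move=> h; apply: sh_ext.
  by rewrite /= /Aop shBE !shM0E letr0 mul0r mulr0 subrr.
move=> k; case: (eqVneq k i) => [->|ki]; first by rewrite dl_iterAop h scale0r linear0.
rewrite dlk_iterAop // dl_letr linear0.
case: (eqVneq k j) => _; last first.
  rewrite scale0r; elim: (r.+1) => //= t ->; exact: linear0.
by rewrite scale1r iterAop1.
Qed.

(* a lift of iter r Aop (letr j) to formal combinations of words, to be paired with U *)
Fixpoint serre_list r : seq (K * word n) :=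
  if r is r'.+1 then
    [seq (p.1, i :: p.2) | p <- serre_list r'] ++
    [seq (- (X (- al i) (wta al p.2)) * p.1, rcons p.2 i) | p <- serre_list r']
  else [:: (1, [:: j])].

Lemma lmon_serre_list r : lmon chi (serre_list r) = iter r Aop ej.
Proof.
elim: r => [|r IH] /=.
  by rewrite lmon_cons lmon_nil addr0 scale1r monw1.
rewrite lmon_cat lmon_map_cons IH /Aop; congr (_ + _).
rewrite -IH /lmon linear_sum mulr_suml -sumrN big_map; apply: eq_bigr => p _ /=.
rewrite linearZ /= /Th (hom_Mw _ (phom_hom (@phom_monw _ _ chi p.2))).
by rewrite -cats1 monw_cat monw1 -!scalerAl scalerA -scaleNr; congr (_ *: _); ring.
Qed.

Lemma pr_serre_list r x : dr i x = 0 -> pr (serre_list r) x = x (nseq r i ++ [:: j]).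
Proof.
elim: r x => [|r IH] x h; first by rewrite /pr big_seq1 mul1r.
rewrite /pr /= big_cat !big_map /= [X in _ + X]big1 ?addr0; last first.
  by move=> p _; rewrite -[x (rcons _ _)]/(dr i x p.2) h mulr0.
by have := IH (dl i x); rewrite /pr /= => -> //; apply: shP => w; rewrite /dr /dl -rcons_cons -[x _]/(dr i x _) h.
Qed.

(** The coefficients in question belong to words ending in [i ... i j]. No word in the support of
    [x] ends in [i], so a left derivative of [x] paired with the Serre element sees only the term
    with [j] last; that pairing is zero by [serre]. *)
Lemma serre_vanish r x : cst c s r.+1 = 0 -> inUp x -> dr i x = 0 ->
  iter r.+1 (dr i) (dr j x) = 0.
Proof.
move=> hc hx h; apply: shP => w; rewrite iter_drE /dr -cats1 -catA.
have hw : dr i (dls w x) = 0.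
  by apply: shP => v; rewrite /dr /dls -rcons_cat -[x _]/(dr i x _) h.
rewrite -[LHS]/(dls w x (nseq r.+1 i ++ [:: j])) -pr_serre_list //.
rewrite (@pr_eq _ _ _ _ [::]) /pr ?big_nil //; first exact: inUp_dls.
by rewrite lmon_serre_list serre // lmon_nil.
Qed.
End Serre.

End Raising.

(** * Polynomials in one letter over the kernel of its right derivation *)

Section Horner.
Variables (n : nat) (K : fieldType) (Lam : zmodType) (X : Lam -> Lam -> K).
Hypothesis hX : bichar X.
Variables (al : 'I_n -> Lam) (i : 'I_n).
Local Notation chi := (chiX X al).
Local Notation F := (sh chi).
Local Notation e := (letr chi i).
Local Notation s := (X (al i) (al i)).
Local Notation Tw := (Th (X := X) (al := al)).
Implicit Types (x y u : F) (w z : word n) (j k : 'I_n) (S : seq F).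

Let s0 : s != 0 := bi_neq0 hX _ _.

Definition qfac t : K := \prod_(r < t) qint s r.+1.
Lemma qfacS t : qfac t.+1 = qfac t * qint s t.+1.
Proof. by rewrite /qfac big_ord_recr. Qed.

Definition inK x := inUp x /\ dr i x = 0.

Lemma inK_subsp : subsp inK.
Proof.
split; first by split; [exact: inUp0|rewrite linear0].
move=> a x y [h1 h2] [g1 g2]; split; first by apply: inUpD => //; exact: inUpZ.
by rewrite linearP /= h2 g2 scaler0 addr0.
Qed.
Lemma inK1 : inK 1. Proof. by split; [exact: inUp1|exact: dr1]. Qed.
Lemma inKM x y : inK x -> inK y -> inK (x * y).
Proof.
move=> [h1 h2] [g1 g2]; split; first exact: inUpM.
by rewrite (drMT hX) h2 g2 mul0r mulr0 addr0.
Qed.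
Lemma inK_Aop x : inK x -> inK (Aop i x).
Proof. by move=> [h1 h2]; split; [exact: inUp_Aop|exact: dr_AopK]. Qed.
Lemma inK_Mw f x : inK x -> inK (Mw f x).
Proof. by move=> [h1 h2]; split; [exact: inUp_Mw|rewrite dr_Mw h2 linear0]. Qed.
Lemma inK_letr j : j != i -> inK (letr chi j).
Proof.
move=> ji; split; first exact: inUp_letr.
by rewrite dr_letr eq_sym (negbTE ji) scale0r.
Qed.
Lemma inK_iterAop t x : inK x -> inK (iter t (Aop i) x).
Proof. by elim: t => //= t IH /IH; exact: inK_Aop. Qed.

Lemma dl_eX t : dl i (e ^+ t.+1) = qint s t.+1 *: e ^+ t.
Proof.
elim: t => [|t IH]; first by rewrite expr1 dl_letr eqxx qintS qint0 add0r expr0.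
rewrite exprS (dlMT hX) dl_letr eqxx scale1r mul1r IH -scalerAr -exprS.
have -> : Tw (al i) (e ^+ t.+1) = s ^+ t.+1 *: e ^+ t.+1.
  elim: (t.+1) => [|r IHr]; first by rewrite (Th1 hX) scale1r.
  by rewrite exprS (ThM hX) IHr (Th_letr hX) -scalerAl -scalerAr scalerA -!exprS.
by rewrite -scalerDl addrC -qintS.
Qed.

(** The substitute for dividing by quantum factorials: where the factorial vanishes, as in degree
    two for an odd isotropic letter, the power vanishes as well. *)
Lemma eX_eq0 t : qfac t = 0 -> e ^+ t = 0.
Proof.
elim: t => [|t IH]; first by rewrite /qfac big_ord0 => /eqP; rewrite oner_eq0.
rewrite qfacS => /eqP; rewrite mulf_eq0 => /orP[/eqP/IH h|/eqP h].
  by rewrite exprS h mulr0.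
apply: sh_ext; first by rewrite exprS shM0E letr0 mul0r.
move=> k; rewrite linear0; case: (eqVneq k i) => [->|ki]; first by rewrite dl_eX h scale0r.
elim: (t.+1) => [|r IHr]; first exact: dl1.
by rewrite exprS (dlMT hX) IHr dl_letr (negbTE ki) scale0r mul0r mulr0 addr0.
Qed.

Lemma dr_eX t : dr i (e ^+ t.+1) = qint s t.+1 *: e ^+ t.
Proof.
elim: t => [|t IH]; first by rewrite expr1 dr_letr eqxx qintS qint0 add0r expr0.
rewrite exprS (drMT hX) dr_letr eqxx scale1r mul1r IH (Th_letr hX) -scalerAl -scalerAr scalerA -exprS.
by rewrite [qint s t.+2]qintSl scalerDl scale1r mulrC.
Qed.

Lemma iter_dr_keX t u0 r : dr i u0 = 0 -> (r < t)%N -> iter t (dr i) (u0 * e ^+ r) = 0.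
Proof.
move=> h; elim: t r u0 h => // t IH r u0 h rt; rewrite iterSr (drMT hX) h mul0r add0r.
case: r rt => [|r] rt; first by rewrite expr0 dr1 mulr0 linear0.
by rewrite dr_eX -scalerAr linearZ /= IH ?scaler0 // (dr_Th hX) h linear0 scaler0.
Qed.

Lemma iter_dr_keXX t u0 : dr i u0 = 0 ->
  iter t (dr i) (u0 * e ^+ t) = qfac t *: Tw (al i *+ t) u0.
Proof.
elim: t u0 => [|t IH] u0 h.
  by rewrite /qfac big_ord0 scale1r mulr0n (Th0 hX) expr0 mulr1.
rewrite iterSr (drMT hX) h mul0r add0r dr_eX -scalerAr linearZ /= IH; last first.
  by rewrite (dr_Th hX) h linear0 scaler0.
by rewrite scalerA (ThD hX) -mulrSr qfacS mulrC.
Qed.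

(** A polynomial in the letter [i] with coefficients on the left. Every element of the subalgebra
    has this form with coefficients killed by [dr i] ([inK_hsum]), and iterating [dr i] isolates the
    top one. *)
Definition hsum S : F := \sum_(t < size S) S`_t * e ^+ t.

Lemma hsum_rcons S x : hsum (rcons S x) = hsum S + x * e ^+ size S.
Proof.
rewrite /hsum size_rcons big_ord_recr /= nth_rcons ltnn eqxx; congr (_ + _).
by apply: eq_bigr => t _; rewrite nth_rcons ltn_ord.
Qed.

Lemma hsum_cons S x : hsum (x :: S) = x + hsum S * e.
Proof.
rewrite /hsum big_ord_recl /= expr0 mulr1 mulr_suml; congr (_ + _).
by apply: eq_bigr => t _; rewrite -mulrA -exprSr.
Qed.

Lemma iter_dr_hsum S x : (forall y, y \in S -> dr i y = 0) -> dr i x = 0 ->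
  iter (size S) (dr i) (hsum (rcons S x)) = qfac (size S) *: Tw (al i *+ size S) x.
Proof.
move=> hS hx; rewrite hsum_rcons linearD /= iter_dr_keXX //.
rewrite /hsum linear_sum big1 ?add0r // => t _.
by apply: iter_dr_keX => //; apply: hS; apply: mem_nth.
Qed.

(** In positive degree [N], applying [dr i] [N] times leaves the twisted top coefficient times a
    quantum factorial. One of the two must be zero, and in either case the top term disappears. *)
Lemma hsum_dr0 S : (forall y, y \in S -> dr i y = 0) -> dr i (hsum S) = 0 -> hsum S = S`_0.
Proof.
elim/last_ind: S => [|S x IH] hS h0; first by rewrite /hsum big_ord0.
have hx : dr i x = 0 by apply: hS; rewrite mem_rcons mem_head.
have hS' y : y \in S -> dr i y = 0 by move=> yS; apply: hS; rewrite mem_rcons inE yS orbT.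
case: (posnP (size S)) => [/size0nil eS|S_gt0].
  by rewrite eS hsum_rcons /hsum big_ord0 add0r expr0 mulr1.
have E : x * e ^+ size S = 0.
  have := iter_dr_hsum hS' hx; case: (size S) S_gt0 => // N _; rewrite iterSr h0 linear0.
  move/esym/eqP; rewrite scaler_eq0 => /orP[/eqP/eX_eq0->|/eqP E]; first by rewrite mulr0.
  by rewrite -(ThNK hX (- (al i *+ N.+1)) x) opprK E linear0 mul0r.
rewrite hsum_rcons E addr0 nth_rcons S_gt0; apply: IH => //.
by move: h0; rewrite hsum_rcons E addr0.
Qed.

(* right coideal subalgebras of U stable under the torus operators Mw *)
Definition coid (E : F -> Prop) :=
  [/\ subsp E, E 1, forall x y, E x -> E y -> E (x * y),
      forall k x, E x -> E (dr k x) & (forall f x, E x -> E (Mw f x)) /\ forall x, E x -> inUp x].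

Lemma coid_iter_dr E t x : coid E -> E x -> E (iter t (dr i) x).
Proof. by case=> _ _ _ h _; elim: t => //= t IH /IH; exact: h. Qed.

(** Coefficients are recovered from the top: iterate [dr i], divide by the factorial and undo the
    torus twist. If the factorial is zero, so is the power of [e], and the coefficient is replaced
    by 0. *)
Lemma hsum_coid E S : coid E -> (forall y, y \in S -> inK y) -> E e -> E (hsum S) ->
  exists S', [/\ size S' = size S, forall y, y \in S' -> E y /\ inK y & hsum S' = hsum S].
Proof.
move=> hE hS Ee; have [sE E1 EM Ed [EMw _]] := hE.
have EX t : E (e ^+ t) by elim: t => // t IH; rewrite exprS; apply: EM.
elim/last_ind: S hS => [|S x IH] hS h; first by exists [::].
have hx : inK x by apply: hS; rewrite mem_rcons mem_head.
have hS' y : y \in S -> inK y by move=> yS; apply: hS; rewrite mem_rcons inE yS orbT.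
have [E0|nE0] := eqVneq (qfac (size S)) 0.
  have e0 : hsum (rcons S x) = hsum S by rewrite hsum_rcons eX_eq0 // mulr0 addr0.
  rewrite e0 in h *; have [S' [s1 s2 s3]] := IH hS' h.
  exists (rcons S' 0); rewrite !size_rcons s1; split=> //; last first.
    by rewrite hsum_rcons mul0r addr0.
  move=> y; rewrite mem_rcons inE => /orP[/eqP->|/s2//].
  by split; apply: subsp0 => //; exact: inK_subsp.
have Ex : E x.
  have := @iter_dr_hsum S x (fun y yS => (hS' y yS).2) hx.2 => h1.
  have -> : x = (qfac (size S))^-1 *: Tw (- (al i *+ size S)) (iter (size S) (dr i) (hsum (rcons S x))).
    rewrite h1 linearZ /= scalerA mulVf // scale1r (ThD hX) addNr (Th0 hX) //.
  by apply: subspZ => //; apply: EMw; apply: coid_iter_dr.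
have h' : E (hsum S).
  have -> : hsum S = hsum (rcons S x) - x * e ^+ size S by rewrite hsum_rcons addrK.
  by apply: subspB => //; apply: EM.
have [S' [s1 s2 s3]] := IH hS' h'.
exists (rcons S' x); rewrite !size_rcons s1; split=> //; last by rewrite !hsum_rcons s3 s1.
by move=> y; rewrite mem_rcons inE => /orP[/eqP->|/s2//].
Qed.

Section Generation.
Variable E : F -> Prop.
Hypotheses (sE : subsp E) (E1 : E 1) (EM : forall x y, E x -> E y -> E (x * y))
  (EA : forall x, E x -> E (Aop i x)) (EMw : forall f x, E x -> E (Mw f x))
  (El : forall j, j != i -> E (letr chi j)).

Definition dec x := exists2 S, (forall y, y \in S -> E y) & x = hsum S.

Lemma dec0 : dec 0. Proof. by exists [::] => //; rewrite /hsum big_ord0. Qed.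

Lemma dec_cons u0 y : E u0 -> dec y -> dec (u0 + y * e).
Proof.
move=> h [S hS ->]; exists (u0 :: S); last by rewrite hsum_cons.
by move=> z; rewrite inE => /orP[/eqP->|/hS].
Qed.

Lemma decP x : dec x -> x = 0 \/ exists u0 y, [/\ E u0, dec y & x = u0 + y * e].
Proof.
case=> -[_ ->|u0 S hS ->]; first by left; rewrite /hsum big_ord0.
right; exists u0, (hsum S); rewrite hsum_cons; split=> //.
  by apply: hS; rewrite mem_head.
by exists S => // y yS; apply: hS; rewrite inE yS orbT.
Qed.

Lemma dec_ind (P : F -> Prop) : P 0 ->
  (forall u0 y, E u0 -> dec y -> P y -> P (u0 + y * e)) -> forall x, dec x -> P x.
Proof.
move=> P0 PS x [S hS ->]; elim: S hS => [|u0 S IH] hS; first by rewrite /hsum big_ord0.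
have hS' y : y \in S -> E y by move=> yS; apply: hS; rewrite inE yS orbT.
rewrite hsum_cons; apply: PS; [by apply: hS; rewrite mem_head|by exists S|exact: IH].
Qed.

Lemma decD x y : dec x -> dec y -> dec (x + y).
Proof.
move=> hx; elim/dec_ind: x / hx y => [y|u0 x hk hx IH y hy]; first by rewrite add0r.
case: (decP hy) => [->|[u1 [y' [hk1 hy' ->]]]]; first by rewrite addr0; exact: dec_cons.
rewrite addrACA -mulrDl; apply: dec_cons; [exact: subspD|exact: IH].
Qed.

Lemma dec_mulE u0 x : E u0 -> dec x -> dec (u0 * x).
Proof.
move=> hk hx; elim/dec_ind: x / hx => [|u1 x hk1 hx IH]; first by rewrite mulr0; exact: dec0.
by rewrite mulrDr mulrA; apply: dec_cons => //; apply: EM.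
Qed.

Lemma decE u0 : E u0 -> dec u0.
Proof. by move=> h; rewrite -[u0]addr0 -(mul0r e); apply: dec_cons => //; exact: dec0. Qed.

Lemma dec_mule x : dec x -> dec (e * x).
Proof.
move=> hx; elim/dec_ind: x / hx => [|u0 x hk hx IH]; first by rewrite mulr0; exact: dec0.
(* The letter moves to the right past a coefficient at the cost of [Aop]. *)
have -> : e * (u0 + x * e) = Aop i u0 + (Tw (- al i) u0 + e * x) * e.
  by rewrite /Aop mulrDr mulrDl mulrA addrA subrK.
apply: dec_cons; first exact: EA.
by apply: decD => //; apply: decE; apply: EMw.
Qed.

Lemma dec_inUp x : inUp x -> dec x.
Proof.
move=> hx; elim/inUp_ind: x / hx => [|w].
  split; first exact: dec0.
  move=> a x y hx hy; apply: decD => //; rewrite -[x]mul1r scalerAl.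
  by apply: dec_mulE => //; apply: subspZ.
elim: w => [|k w IH]; first by rewrite monw_nil; exact: decE.
rewrite monw_cons; case: (eqVneq k i) => [->|ki]; first exact: dec_mule.
by apply: dec_mulE => //; apply: El.
Qed.

(** Polynomials in [e] over [E] exhaust the whole subalgebra, by [dec_inUp]; an element killed by
    [dr i] is then its own constant coefficient. This serves as an induction principle on the kernel
    of [dr i]. *)
Lemma inK_generated x : (forall y, E y -> inK y) -> inK x -> E x.
Proof.
move=> EK [hx h0]; have [S hS ex] := dec_inUp hx.
have -> : x = S`_0.
  rewrite ex; apply: hsum_dr0; last by rewrite -ex.
  by move=> y /hS /EK [].
case: S hS {ex} => [|u0 S] hS; first exact: subsp0.
by apply: hS; rewrite mem_head.
Qed.
End Generation.

Lemma inK_hsum x : inUp x -> exists2 S, (forall y, y \in S -> inK y) & x = hsum S.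
Proof.
apply: (dec_inUp (E := inK)); [exact: inK_subsp|exact: inK1|exact: inKM|exact: inK_Aop
  |exact: inK_Mw|exact: inK_letr].
Qed.

End Horner.

Lemma rcons_nseq (T : Type) (a : T) r : rcons (nseq r a) a = nseq r.+1 a.
Proof. by elim: r => //= r ->. Qed.

(** * The transport map of a simple reflection *)

Section Reflection.
Variables (n : nat) (K : fieldType) (Lam : zmodType) (X : Lam -> Lam -> K).
Hypothesis hX : bichar X.

Definition refl (al : 'I_n -> Lam) (i : 'I_n) (m : 'I_n -> nat) : 'I_n -> Lam :=
  fun j => if j == i then - al i else al j + al i *+ m j.

(* the conditions making m j the length of the string of alpha_j through
   alpha_i; the third one is the second one for the reflected simple system *)
Definition cartan (al : 'I_n -> Lam) (i : 'I_n) (m : 'I_n -> nat) := forall j, j != i ->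
  let s := X (al i) (al i) in let c := X (al i) (al j) in
  [/\ qint s (m j).+1 * (c ^+ 2 * s ^+ m j - 1) = 0,
      forall t, (t < m j)%N -> qint s t.+1 != 0 /\ c ^+ 2 * s ^+ t != 1 &
      forall t, (0 < t <= m j)%N -> c ^+ 2 * s ^+ (m j + t) != 1].

Variables (al : 'I_n -> Lam) (i : 'I_n) (m : 'I_n -> nat).
Hypothesis hm : cartan al i m.
Local Notation al' := (refl al i m).
Local Notation chi := (chiX X al).
Local Notation chi' := (chiX X al').
Local Notation F := (sh chi).
Local Notation F' := (sh chi').
Local Notation e := (letr chi i).
Local Notation s := (X (al i) (al i)).
Local Notation Tw := (Th (X := X) (al := al)).
Local Notation Tw' := (Th (X := X) (al := al')).
Implicit Types (x y : F) (w z : word n) (j k : 'I_n).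

Let s0 : s != 0 := bi_neq0 hX _ _.

(** For [k = i] the raising operator, of weight opposite to [dr i]. Otherwise [dr k] followed by as
    many [dr i] as [serre_vanish] permits before the result is zero on the kernel of [dr i]; this
    lowers the weight by the reflected simple root. *)
Definition Dop k x : F := if k == i then Aop i x else iter (m k) (dr i) (dr k x).

Lemma Dop_linear k : linear (Dop k).
Proof. by rewrite /Dop; case: (k == i) => a x y; rewrite !linearP. Qed.
HB.instance Definition _ k := GRing.isLinear.Build K F F *:%R (Dop k) (Dop_linear k).

Lemma refl_i : al' i = - al i. Proof. by rewrite /refl eqxx. Qed.
Lemma refl_j j : j != i -> al' j = al j + al i *+ m j.
Proof. by rewrite /refl => /negbTE->. Qed.

Lemma cst_serre j : j != i -> cst (X (al i) (al j)) s (m j).+1 = 0.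
Proof.
move=> ji; have [h _ _] := hm ji.
by apply/eqP; rewrite cst_eq0 ?(bi_neq0 hX) // h.
Qed.

Lemma inK_Dop k x : inK i x -> inK i (Dop k x).
Proof.
move=> hx; rewrite /Dop; case: (eqVneq k i) => [_|ki]; first exact: inK_Aop.
have [h1 h2] := hx; split; last first.
  by rewrite -[dr i _]/(iter (m k).+1 (dr i) (dr k x)); apply: serre_vanish (cst_serre ki) h1 h2.
elim: (m k) => [|t IH] /=; apply: inUp_dr => //; exact: chiXC.
Qed.

Lemma iter_dr_mull t x y : dr i y = 0 ->
  iter t (dr i) (x * y) = iter t (dr i) x * y.
Proof.
move=> h; elim: t => //= t ->.
by rewrite (drMT hX) h mulr0 addr0.
Qed.

Lemma iter_dr_mulr t x y : dr i x = 0 ->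
  iter t (dr i) (x * y) = Tw (al i *+ t) x * iter t (dr i) y.
Proof.
move=> h; elim: t => [|t IH]; first by rewrite mulr0n (Th0 hX).
by rewrite /= IH (drMT hX) (dr_Th hX) h linear0 scaler0 mul0r add0r (ThD hX) mulrS.
Qed.

Lemma DopM k x y : inK i x -> inK i y ->
  Dop k (x * y) = Dop k x * y + Tw (al' k) x * Dop k y.
Proof.
move=> [_ hx] [_ hy]; rewrite /Dop /refl; case: (eqVneq k i) => [_|ki].
  exact: AopM.
rewrite (drMT hX) linearD /= iter_dr_mull //; congr (_ + _).
by rewrite iter_dr_mulr ?(ThD hX) 1?addrC // (dr_Th hX) hx linear0 scaler0.
Qed.

Lemma Dop1 k : Dop k 1 = 0.
Proof.
rewrite /Dop; case: (k == i); first exact: Aop1.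
by rewrite dr1 linear0.
Qed.

Lemma iter_dr_Mw t f x :
  iter t (dr i) (Mw f x) = Mw (fun u => f (u + al i *+ t)) (iter t (dr i) x).
Proof.
elim: t f => [|t IH] f; first by apply: Mw_ext => u; rewrite addr0.
by rewrite /= IH dr_Mw; apply: Mw_ext => u; rewrite -addrA -mulrS.
Qed.

Lemma Dop_Mw k f x : Dop k (Mw f x) = Mw (fun u => f (u + al' k)) (Dop k x).
Proof.
rewrite /Dop /refl; case: (eqVneq k i) => [_|ki].
  rewrite /Aop linearB /= (Mw_mull hX _ _ (@hom_letr n K Lam X al i)) (Mw_mulr hX _ _ (@hom_letr n K Lam X al i)).
  rewrite /Th !MwM; congr (_ - _).
    by congr (_ * _); apply: Mw_ext => u; rewrite addrC addKr.
  by congr (_ * _); apply: Mw_ext => u; rewrite addrK mulrC.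
rewrite dr_Mw iter_dr_Mw; apply: Mw_ext => u.
by congr (f _); rewrite -addrA; congr (_ + _); rewrite addrC.
Qed.

(* The coefficient of a word in Tm x is obtained by applying to x the skew derivations Dop k
   that play the role of dr k for the reflected simple system (compare Lusztig's T_i). *)
Definition Tm x : F' := fun w => foldr Dop x w [::].

Lemma foldr_Dop_linear w : linear (fun x => foldr Dop x w).
Proof. by elim: w => [|k w IH] a x y //=; rewrite IH linearP. Qed.
Lemma Tm_linear : linear Tm.
Proof. by move=> a x y; apply: shP => w; rewrite /Tm foldr_Dop_linear. Qed.
HB.instance Definition _ := GRing.isLinear.Build K F F' *:%R Tm Tm_linear.

Lemma dr_Tm k x : dr k (Tm x) = Tm (Dop k x).
Proof. by apply: shP => w; rewrite /dr /Tm foldr_rcons. Qed.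

Lemma Tm0E x : Tm x [::] = x [::]. Proof. by []. Qed.

Lemma Tm1 : Tm 1 = 1.
Proof.
apply: shP => w; case/lastP: w => [|w k] //.
rewrite -[LHS]/(dr k (Tm 1) w) -[RHS]/(dr k 1 w) dr_Tm Dop1 linear0 dr1 //.
Qed.

Lemma Tm_Mw f x : Tm (Mw f x) = Mw f (Tm x).
Proof.
apply: shP => w; elim/last_ind: w f x => [|w k IH] f x.
  by rewrite Tm0E /Mw !wta_nil.
rewrite -[LHS]/(dr k (Tm (Mw f x)) w) dr_Tm Dop_Mw IH /Mw wta_rcons.
by rewrite -dr_Tm.
Qed.

Lemma TmM x y : inK i x -> inK i y -> Tm (x * y) = Tm x * Tm y.
Proof.
move=> hx hy; apply: shP => w; elim/last_ind: w x y hx hy => [|w k IH] x y hx hy.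
  by rewrite Tm0E !shM0E.
rewrite -[LHS]/(dr k (Tm (x * y)) w) -[RHS]/(dr k (Tm x * Tm y) w) dr_Tm (drMT hX).
have E : Tw' (al' k) (Tm x) = Tm (Tw (al' k) x) by rewrite /Th Tm_Mw.
rewrite DopM // linearD /= !shDE !dr_Tm E !IH //; try exact: inK_Dop.
exact: inK_Mw.
Qed.

(** Under the first vanishing, [t + 1] derivations after [Aop] return the [t]-th derivative times a
    scalar, and the second clause of [cartan] makes that scalar nonzero. *)
Lemma iter_dr_Aop0 t j x : j != i -> (t < m j)%N -> iter t.+1 (dr i) (dr j x) = 0 ->
  iter t.+1 (dr i) (dr j (Aop i x)) = 0 -> iter t (dr i) (dr j x) = 0.
Proof.
move=> ji tm h; rewrite (iter_dr_Aopj hX) // => /eqP; rewrite scaler_eq0 => /orP[|/eqP//].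
have [_ /(_ _ tm) [q1 q2] _] := hm ji.
have c0 : X (al i) (al j) != 0 by exact: bi_neq0.
rewrite mulf_eq0 (negbTE q1) /= subr_eq0 => /eqP E.
case/eqP: q2; rewrite expr2 {1}E; have st0 : s ^+ t != 0 by rewrite expf_neq0.
by field; rewrite c0 st0.
Qed.

Lemma count_Aop b x : (forall w, x w != 0 -> (count (predC1 i) w <= b)%N) ->
  forall w, Aop i x w != 0 -> (count (predC1 i) w <= b)%N.
Proof.
move=> h w; rewrite /Aop shDE shNE => hw.
have H (y z : F) : (y * z) w != 0 -> (forall v, y v != 0 -> (count (predC1 i) v = 0)%N) ->
  (forall v, z v != 0 -> (count (predC1 i) v <= b)%N) -> (count (predC1 i) w <= b)%N.
  move=> /shM_neq0 [a [c [/shuf_perm/seq.permP p ha hc]]] hy hz.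
  by rewrite p count_cat (hy _ ha); exact: hz.
have H2 (y z : F) : (z * y) w != 0 -> (forall v, y v != 0 -> (count (predC1 i) v = 0)%N) ->
  (forall v, z v != 0 -> (count (predC1 i) v <= b)%N) -> (count (predC1 i) w <= b)%N.
  move=> /shM_neq0 [a [c [/shuf_perm/seq.permP p ha hc]]] hy hz.
  by rewrite p count_cat (hy _ hc) addn0; exact: hz.
have he v : e v != 0 -> (count (predC1 i) v = 0)%N.
  by move=> /(@phom_letr _ _ chi i) /seq.permP -> /=; rewrite eqxx.
case: (eqVneq ((e * x) w) 0) => [E|/H]; last by apply.
have: (Tw (- al i) x * e) w != 0 by move: hw; rewrite E add0r oppr_eq0.
move/H2; apply => // v hv; apply: h; apply: contra hv => /eqP E'.
by rewrite /Th /Mw E' mulr0.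
Qed.

(** Induction on the number of letters other than [i]. If the image of [x] vanishes, so do the
    images of all its iterates under [Aop], hence by induction every [Dop j] of them. Then
    [iter_dr_Aop0] descends from [m j] derivations to none, giving [dr j x = 0] for all [j != i]. *)
Lemma Tm_inj x : inK i x -> Tm x = 0 -> x = 0.
Proof.
move=> hx; have [b] : exists b, forall w, x w != 0 -> (count (predC1 i) w < b)%N.
  have [[P ->] _] := hx.
  exists (\max_(p <- P) size p.2).+1 => w hw; rewrite ltnS.
  have [p pP pw] : exists2 p, p \in P & monw chi p.2 w != 0.
    apply: contrapT => H; case/eqP: hw; rewrite lmonE big_seq big1 // => p pP.
    case: (eqVneq (monw chi p.2 w) 0) => [->|h]; first by rewrite mulr0.
    by case: H; exists p.
  rewrite (leq_trans (count_size _ _)) // (perm_size (phom_monw pw)).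
  exact: (@leq_bigmax_seq _ P xpredT (fun p : K * word n => size p.2) p pP).
elim: b x hx => [|b IH] x hx hb hT.
  by apply: shP => w; apply/eqP; case: eqP => // /eqP /hb.
have hK t : inK i (iter t (Aop i) x) by exact: inK_iterAop.
have hbt t w : iter t (Aop i) x w != 0 -> (count (predC1 i) w <= b)%N.
  elim: t w => [|t IHt] w; [exact: hb|exact: count_Aop].
have hTt t : Tm (iter t (Aop i) x) = 0.
  elim: t => //= t IHt.
  have -> : Aop i (iter t (Aop i) x) = Dop i (iter t (Aop i) x) by rewrite /Dop eqxx.
  by rewrite -dr_Tm IHt linear0.
have hD t j : j != i -> Dop j (iter t (Aop i) x) = 0.
  move=> ji; apply: IH; [exact: inK_Dop| |by rewrite -dr_Tm hTt linear0].
  move=> w; rewrite /Dop (negbTE ji) iter_drE /dr => /hbt; apply: leq_trans.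
  by rewrite -cats1 !count_cat /= ji; lia.
have hdr r t j : j != i -> (r <= m j)%N -> iter (m j - r) (dr i) (dr j (iter t (Aop i) x)) = 0.
  move=> ji; elim: r t => [|r IHr] t rm.
    by have := hD t j ji; rewrite /Dop (negbTE ji) subn0.
  have e1 : (m j - r = (m j - r.+1).+1)%N by lia.
  apply: iter_dr_Aop0 => //; first by lia.
    by rewrite -e1; apply: IHr; exact: ltnW.
  by rewrite -e1 -iterS; apply: IHr; exact: ltnW.
apply: shP => w; case/lastP: w => [|w j].
  by rewrite -Tm0E hT.
rewrite -[x _]/(dr j x w); case: (eqVneq j i) => [->|ji]; first by rewrite hx.2.
by have := hdr (m j) 0%N j ji (leqnn _); rewrite subnn /= => ->.
Qed.

Section ImageOfLetter.
Variables (j : 'I_n) (ji : j != i).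
Let jw r : word n := j :: nseq r i.

Lemma c'E : X (al' i) (al' j) = (X (al i) (al j) * s ^+ m j)^-1.
Proof. by rewrite refl_i refl_j // (biNl hX) (biDr hX) (biMnr hX). Qed.
Lemma s'E : X (al' i) (al' i) = s.
Proof. by rewrite refl_i (biNl hX) (biNr hX) invrK. Qed.

Lemma perm_nseq w r : perm_eq w (nseq r i) -> w = nseq r i.
Proof.
move=> p; have /all_pred1P -> : all (pred1 i) w.
  by rewrite (perm_all _ p) all_nseq /= eqxx orbT.
by rewrite (perm_size p) size_nseq.
Qed.

Lemma jw_only r (y : F') : phom (jw r) y -> dl i y = 0 ->
  y = y (jw r) *: delta chi' (jw r).
Proof.
move=> hy h0; apply: shP => w; rewrite shZE /delta.
case: (w =P jw r) => [->|ne]; first by rewrite mulr1.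
rewrite mulr0; apply/eqP; case: eqP => // /eqP hw; case: ne.
have p := hy _ hw; case: w hw p => [|k w] hw p; first by have := perm_size p.
have ki : k != i by apply/eqP => E; move: hw; rewrite E -[y _]/(dl i y w) h0 eqxx.
have kj : k = j.
  have : k \in jw r by rewrite -(perm_mem p) mem_head.
  by rewrite inE mem_nseq (negbTE ki) andbF orbF => /eqP.
by move: p; rewrite kj perm_cons => /perm_nseq ->.
Qed.

(** These words are built one [i] at a time by [Bop]. The result is killed by [dl i], so it is
    supported on a single word, and its coefficient is nonzero by the third clause of [cartan]. *)
Lemma delta_jw_in r : (r <= m j)%N -> inUp (delta chi' (jw r)).
Proof.
pose c' := X (al' i) (al' j); pose s' := X (al' i) (al' i).
have dl0 t : dl i (delta chi' (jw t)) = 0.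
  by apply: shP => w; rewrite /dl /delta eqseq_cons eq_sym (negbTE ji).
have hph t : phom (jw t.+1) (Bop i (delta chi' (jw t))).
  apply: phomB; last first.
    have := @phomM _ _ chi' [:: i] (jw t) (letr chi' i) (Th (- al' i) (delta chi' (jw t))).
    move=> H; apply: phom_perm (H _ _); [|exact: phom_letr|].
      by rewrite /jw /= -[i :: _ :: _]/([:: i] ++ [:: j] ++ nseq t i) perm_catCA.
    move=> v hv; apply: (@phom_delta _ _ chi'); apply: contra hv => /eqP E.
    by rewrite /Th /Mw E mulr0.
  have := @phomM _ _ chi' (jw t) [:: i] _ (letr chi' i) (@phom_delta _ _ chi' (jw t)) (@phom_letr _ _ chi' i).
  by apply: phom_perm; rewrite perm_catC /jw /= -[i :: _ :: _]/([:: i] ++ [:: j] ++ nseq t i) perm_catCA.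
have hB t : Bop i (delta chi' (jw t)) = cst c' s' t.+1 *: delta chi' (jw t.+1).
  rewrite (jw_only (hph t)) ?(dl_BopK hX) //; congr (_ *: _).
  have ed r' : jw r'.+1 = rcons (jw r') i by rewrite /jw /= rcons_nseq.
  have hd r' : homw (al' j + al' i *+ r') (delta chi' (jw r')).
    move=> w hw; rewrite (wta_perm _ (phom_delta hw)) wta_cons /wta big_nseq; congr (_ + _).
    by elim: r' {hw} => //= r' ->; rewrite mulrS.
  elim: t => [|t IHt].
    rewrite ed -[Bop i _ _]/(dr i (Bop i (delta chi' (jw 0))) (jw 0)) (dr_Bop hX).
    have -> : dr i (delta chi' (jw 0)) = 0.
      by apply: shP => w; rewrite /dr /delta -[jw 0]/(rcons [::] j) eqseq_rcons [i == j]eq_sym (negbTE ji) andbF.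
    rewrite linear0 add0r /Th !(hom_Mw _ (hd 0%N)) shDE shNE !shZE /delta eqxx !mulr1 /=.
    by rewrite mulr0n addr0 (biNl hX) add0r expr0 mulr1.
  rewrite [jw t.+2]ed -[Bop i _ _]/(dr i (Bop i (delta chi' (jw t.+1))) (jw t.+1)) (dr_Bop hX).
  have -> : dr i (delta chi' (jw t.+1)) = delta chi' (jw t).
    by apply: shP => w; rewrite /dr /delta ed eqseq_rcons eqxx andbT.
  rewrite shDE IHt /Th !(hom_Mw _ (hd t.+1)) shDE shNE !shZE /delta eqxx !mulr1.
  by rewrite (biNl hX) (biDr hX) (biMnr hX) [cst _ _ t.+2]/=.
elim: r => [|r IH] rm.
  exact: inUp_letr.
have nz : cst c' s' r.+1 != 0.
  rewrite cst_eq0 ?(bi_neq0 hX) // /c' /s' s'E c'E mulf_eq0 negb_or.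
  have [_ h1 h2] := hm ji; have [-> _] := h1 _ rm; rewrite subr_eq0 /=.
  have c0 : X (al i) (al j) != 0 by exact: bi_neq0.
  have h3 := h2 (m j - r)%N; apply: contraNneq (h3 _) => [E|]; last by lia.
  have sr0 : s ^+ r != 0 by rewrite expf_neq0.
  have csm : X (al i) (al j) * s ^+ m j != 0 by rewrite mulf_neq0 ?expf_neq0.
  have Er : s ^+ r = (X (al i) (al j) * s ^+ m j) ^+ 2.
    apply: (mulfI (expf_neq0 2 (invr_neq0 csm))).
    by rewrite E exprVn mulVf // expf_neq0.
  apply/eqP/(mulIf sr0); rewrite mul1r -mulrA -exprD [RHS]Er exprMn -exprM; congr (_ * _ ^+ _).
  by move: rm; lia.
have -> : delta chi' (jw r.+1) = (cst c' s' r.+1)^-1 *: Bop i (delta chi' (jw r)).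
  by rewrite hB scalerA mulVf // scale1r.
by apply: inUpZ; apply: inUp_Bop => //; apply: IH; exact: ltnW.
Qed.

(** Each final [i] of a word applies one more [Aop], and [j] can be read only when the string
    through [al j] is full. For [r = 0] the letter [j] is sent to a multiple of the word [j]
    followed by [m j] letters [i]. *)
Lemma Tm_iterAop w r : Tm (iter r (Aop i) (letr chi j)) w != 0 ->
  w = jw (m j - r) /\ (r <= m j)%N.
Proof.
elim/last_ind: w r => [|w k IH] r.
  rewrite Tm0E; case: r => [|r'] h; first by rewrite /= letr0 eqxx in h.
  by move: h; rewrite iterS /Aop shDE shNE !shM0E letr0 mul0r mulr0 subrr eqxx.
rewrite -[Tm _ _]/(dr k (Tm (iter r (Aop i) (letr chi j))) w) dr_Tm.
rewrite /Dop; case: (eqVneq k i) => [->|ki].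
  rewrite -iterS => /IH [-> rm]; split; last exact: ltnW.
  have -> : (m j - r = (m j - r.+1).+1)%N by lia.
  by rewrite /jw /= rcons_nseq.
have hK : inK i (Dop k (iter r (Aop i) (letr chi j))).
  by apply: inK_Dop; apply: inK_iterAop => //; exact: inK_letr.
have hp : phom (rcons (nseq r i) j) (iter r (Aop i) (letr chi j)).
  elim: (r) => [|t IHt]; first exact: phom_letr.
  rewrite iterS /Aop (ThE hX) (phom_ch _ IHt) -scalerAl.
  apply: phomB; first exact: (phomM (@phom_letr _ _ chi i) IHt).
  apply: phomZ; have := phomM IHt (@phom_letr _ _ chi i); apply: phom_perm.
  by rewrite perm_catC.
set y := iter (m k) _ _ => hw.
have ye : y = Dop k (iter r (Aop i) (letr chi j)) by rewrite /Dop (negbTE ki).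
have hy v : y v != 0 -> [/\ k = j, v = [::] & r = m j].
  move=> hyv; move: (hyv); rewrite /y iter_drE /dr => /hp p.
  have := perm_mem p k; rewrite mem_rcons mem_head mem_rcons inE mem_nseq (negbTE ki) andbF orbF.
  move=> /esym/eqP kj; move: p; rewrite kj -!cats1 perm_cat2r => /perm_nseq E.
  have hv : y v != 0 -> v = [::].
    case/lastP: (v) E => // v' a E; have -> : a = i.
      have : a \in nseq r i by rewrite -E mem_cat mem_rcons mem_head.
      by rewrite mem_nseq => /andP[_ /eqP].
    by rewrite ye -[Dop _ _ _]/(dr i (Dop k (iter r (Aop i) (letr chi j))) v') hK.2 eqxx.
  have ev := hv hyv; split=> //.
  by have := congr1 size E; rewrite ev /= !size_nseq.
have y1 : y = y [::] *: 1.
  apply: shP => v; rewrite shZE; case: v => [|a v]; first by rewrite sh10E mulr1.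
  by rewrite mulr0; apply/eqP; case: eqP => // /eqP /hy [].
have hy0 : y [::] != 0.
  by apply: contra hw => /eqP E; rewrite y1 E scale0r linear0.
have [kj _ rm] := hy _ hy0; move: hw; rewrite y1 linearZ /= Tm1 shZE.
case: (w) => [|? ?]; last by rewrite mulr0 eqxx.
by rewrite rm subnn kj leqnn.
Qed.

Lemma Tm_letr_in : inUp (Tm (letr chi j)).
Proof.
have -> : Tm (letr chi j) = Tm (letr chi j) (jw (m j)) *: delta chi' (jw (m j)).
  apply: shP => w; rewrite shZE /delta; case: (w =P jw (m j)) => [->|ne]; first by rewrite mulr1.
  rewrite mulr0; apply/eqP; case: eqP => // /eqP h.
  by have [] := @Tm_iterAop w 0 h; rewrite subn0.
by apply: inUpZ; exact: delta_jw_in.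
Qed.

End ImageOfLetter.

(** By [inK_generated] the work lies in the letters other than [i]: the image of a product is a
    product, and [Aop] becomes [dr i] on the image. *)
Lemma Tm_inUp x : inK i x -> inUp (Tm x).
Proof.
move=> hx; pose E y := inK i y /\ inUp (Tm y).
suff : E x by case.
apply: (@inK_generated n K Lam X hX al i E) => //; last by move=> y [].
- split; first by split; [split; [exact: inUp0|exact: linear0]|rewrite linear0; exact: inUp0].
  move=> a y z [[h1 h3] h2] [[g1 g3] g2]; split; first by split; [apply: inUpD => //; exact: inUpZ|rewrite linearP /= h3 g3 scaler0 addr0].
  by rewrite linearP; apply: inUpD => //; exact: inUpZ.
- by split; [exact: inK1|rewrite Tm1; exact: inUp1].
- move=> y z [h1 h2] [g1 g2]; split; first exact: inKM.
  by rewrite TmM //; exact: inUpM.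
- move=> y [h1 h2]; split; first exact: inK_Aop.
  have -> : Aop i y = Dop i y by rewrite /Dop eqxx.
  by rewrite -dr_Tm; apply: inUp_dr => //; exact: chiXC.
- move=> f y [h1 h2]; split; first exact: inK_Mw.
  by rewrite Tm_Mw; exact: inUp_Mw.
- by move=> j ji; split; [exact: inK_letr|exact: Tm_letr_in].
Qed.

End Reflection.

(** * Transport of right coideal subalgebras along reflections *)

Section CoidealStep.
Variables (n : nat) (K : fieldType) (Lam : zmodType) (X : Lam -> Lam -> K).
Hypothesis hX : bichar X.

Section Ideal.
Variable al : 'I_n -> Lam.
Local Notation chi := (chiX X al).
Local Notation F := (sh chi).
Implicit Types (G E : F -> Prop) (x y g : F).

(** [G] times the augmentation ideal of [E], evaluation at the empty word being the counit. *)
Definition idl G E : F -> Prop := spn (fun x => exists g e, [/\ G g, E e, e [::] = 0 & x = g * e]).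

Lemma idl_subsp G E : subsp (idl G E).
Proof. by split; [exact: spn0|move=> a x y hx hy; apply: spnD => //; exact: spnZ]. Qed.

Lemma idl_gen G E g y : G g -> E y -> y [::] = 0 -> idl G E (g * y).
Proof. by move=> hg hy h0; apply: spn_gen; exists g, y. Qed.

Lemma idl_ind G E (P : F -> Prop) : subsp P ->
  (forall g y, G g -> E y -> y [::] = 0 -> P (g * y)) -> forall x, idl G E x -> P x.
Proof.
move=> hP h x; elim=> [|a _ z [g [y [hg hy h0 ->]]] _ hz]; first exact: subsp0.
by apply: hP.2 => //; exact: h.
Qed.
End Ideal.

Variables (al : 'I_n -> Lam) (i : 'I_n) (m : 'I_n -> nat).
Hypothesis hm : cartan X al i m.
Local Notation al' := (refl al i m).
Local Notation chi := (chiX X al).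
Local Notation chi' := (chiX X al').
Local Notation F := (sh chi).
Local Notation F' := (sh chi').
Local Notation e := (letr chi i).
Local Notation Tw := (Th (X := X) (al := al)).
Local Notation T := (@Tm n K Lam X al i m).
Implicit Types (G E : F -> Prop) (x y g : F) (S : seq F).

Definition tr E : F' -> Prop := fun x' => exists2 x, E x /\ inK i x & x' = T x.

Lemma coid_Aop E x : coid E -> E e -> E x -> E (Aop i x).
Proof.
move=> [hs _ hM _ [hMw _]] he hx.
by apply: (subspB hs); apply: hM => //; exact: hMw.
Qed.

Lemma coid_Dop E k x : coid E -> E e -> E x -> E (Dop i m k x).
Proof.
move=> hE he hx; rewrite /Dop; case: (k == i); first exact: coid_Aop.
by apply: coid_iter_dr => //; case: hE => _ _ _ h _; exact: h.
Qed.

Lemma coid_tr E : coid E -> E e -> coid (tr E).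
Proof.
move=> hE he; have [hs h1 hM hd [hMw hU]] := hE; split.
- split; first by exists 0; [split; [exact: subsp0|exact: subsp0 (inK_subsp _ _ _)]|rewrite linear0].
  move=> a _ _ [x [hx kx] ->] [y [hy ky] ->]; exists (a *: x + y); last by rewrite linearP.
  by split; [apply: hs.2|apply: (inK_subsp _ _ _).2].
- by exists 1; [split; [|exact: inK1]|rewrite (Tm1 hX)].
- move=> _ _ [x [hx kx] ->] [y [hy ky] ->]; exists (x * y); last by rewrite (TmM hX).
  by split; [apply: hM|exact: inKM].
- move=> k _ [x [hx kx] ->]; exists (Dop i m k x); last by rewrite dr_Tm.
  by split; [exact: coid_Dop|exact: inK_Dop].
- split; last by move=> _ [x [hx kx] ->]; exact: (Tm_inUp hX hm).
  move=> f _ [x [hx kx] ->]; exists (Mw f x); last by rewrite (Tm_Mw hX).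
  by split; [exact: hMw|exact: inK_Mw].
Qed.

Lemma coid_hsum G g : coid G -> G e -> G g ->
  exists2 S, (forall y, y \in S -> G y /\ inK i y) & g = hsum i S.
Proof.
move=> hG he hg; have [_ _ _ _ [_ hU]] := hG.
have [S0 kS0 E0] := inK_hsum hX i (hU _ hg).
by rewrite E0 in hg; have [S [_ hS ES]] := hsum_coid hX hG kS0 he hg; exists S; rewrite ?E0.
Qed.

Lemma coid_split G g : coid G -> G e -> G g ->
  exists g0 g1, [/\ G g0, inK i g0, G g1 & g = g0 + g1 * e].
Proof.
move=> hG he /(coid_hsum hG he)[S hS ->]; have [hs _ hM _ _] := hG.
have hsumG S' : (forall y, y \in S' -> G y /\ inK i y) -> G (hsum i S').
  elim: S' => [|y S' IH] h; first by rewrite /hsum big_ord0; exact: subsp0.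
  rewrite hsum_cons; apply: (subspD hs); first by case: (h y (mem_head _ _)).
  by apply: hM => //; apply: IH => z zS; apply: h; rewrite inE zS orbT.
case: S hS => [|y S] hS.
  exists 0, 0; split; rewrite ?mul0r ?addr0 /hsum ?big_ord0 //; try exact: subsp0.
  exact: subsp0 (inK_subsp _ _ _).
have [h1 h2] := hS y (mem_head _ _).
exists y, (hsum i S); split; rewrite ?hsum_cons //.
by apply: hsumG => z zS; apply: hS; rewrite inE zS orbT.
Qed.



Definition redu G E x := exists y z, [/\ idl (fun g => G g /\ inK i g) (fun g => E g /\ inK i g) y, G z & x = y + z * e].

(** Up to right multiples of [e], both factors of a generator can be taken in the kernel of [dr i].
    Powers of [e] in the left factor are pushed to the right past the element of [E], creating only
    its iterates under [Aop], which stay in [E]. *)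
Lemma idl_redu G E x : coid G -> coid E -> (forall y, E y -> G y) -> E e ->
  idl G E x -> redu G E x.
Proof.
move=> hG hE EG he; have [sG _ MG _ [wG _]] := hG; have [sE _ ME _ [wE _]] := hE.
have hP : subsp (redu G E).
  split; first by exists 0, 0; split; rewrite ?mul0r ?addr0 //; [exact: spn0|exact: subsp0].
  move=> a _ _ [y [z [hy hz ->]]] [y' [z' [hy' hz' ->]]].
  exists (a *: y + y'), (a *: z + z'); split; [exact: (idl_subsp _ _).2|exact: sG.2|].
  by rewrite mulrDl -scalerAl scalerDr addrACA.
have he' := EG _ he.
have cl g y : G g -> E y -> inK i y -> y [::] = 0 -> redu G E (g * y).
  move=> hg; have [S hS ->] := coid_hsum hG he' hg; move: {g hg} y.
  elim: S hS => [|u S IH] hS y hy ky y0.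
    by rewrite /hsum big_ord0 mul0r; exact: subsp0.
  have hS' z : z \in S -> G z /\ inK i z by move=> zS; apply: hS; rewrite inE zS orbT.
  have [Gu ku] := hS u (mem_head _ _).
  have hST : G (hsum i S).
    elim: (S) hS' => [|v S' IHS] h; first by rewrite /hsum big_ord0; exact: subsp0.
    rewrite hsum_cons; apply: (subspD sG); first by case: (h v (mem_head _ _)).
    by apply: MG => //; apply: IHS => z zS; apply: h; rewrite inE zS orbT.
  have -> : hsum i (u :: S) * y = u * y + hsum i S * Aop i y + hsum i S * Tw (- al i) y * e.
    by rewrite hsum_cons mulrDl -addrA; congr (_ + _); rewrite -!mulrA -mulrDr /Aop subrK.
  apply: (subspD hP); [apply: (subspD hP)|].
  - exists (u * y), 0; split; [|exact: subsp0|by rewrite mul0r addr0].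
    by apply: idl_gen.
  - apply: IH => //; [exact: coid_Aop|exact: inK_Aop|].
    by rewrite /Aop shDE shNE !shM0E letr0 mul0r mulr0 subrr.
  - exists 0, (hsum i S * Tw (- al i) y); split; [exact: spn0| |by rewrite add0r].
    by apply: MG => //; apply: EG; exact: wE.
apply: idl_ind => // g y hg hy y0.
have [y1 [y2 [hy1 ky1 hy2 E1]]] := coid_split hE he hy.
have y10 : y1 [::] = 0 by move: y0; rewrite E1 shDE shM0E letr0 mulr0 addr0.
rewrite E1 mulrDr; apply: (subspD hP); first exact: cl.
exists 0, (g * y2); split; [exact: spn0|by apply: MG => //; exact: EG|by rewrite add0r mulrA].
Qed.

(** The difference [x - y] is killed by [dr i] and is a polynomial in [e] without constant
    coefficient, hence zero by [hsum_dr0]. *)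
Lemma redu_inK G E x : coid G -> G e -> redu G E x -> inK i x ->
  idl (fun g => G g /\ inK i g) (fun g => E g /\ inK i g) x.
Proof.
move=> hG he [y [z [hy hz Ex]]] kx.
have ky : inK i y.
  apply: (idl_ind (P := inK i)) hy; first exact: inK_subsp.
  by move=> u v [_ hu] [_ hv] _; exact: inKM.
suff : x - y = 0 by move/eqP; rewrite subr_eq0 => /eqP ->.
have [S hS Ez] := coid_hsum hG he hz.
have Exy : x - y = hsum i (0 :: S) by rewrite hsum_cons add0r -Ez Ex addrC addKr.
rewrite Exy; apply: hsum_dr0 => //; last by rewrite -Exy linearB /= kx.2 ky.2 subr0.
move=> v; rewrite inE => /orP[/eqP->|/hS[_ []//]]; exact: linear0.
Qed.

Lemma idl_tr G E x : coid G -> coid E -> (forall y, E y -> G y) -> E e -> inK i x ->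
  idl (tr G) (tr E) (T x) -> idl G E x.
Proof.
move=> hG hE EG he kx h.
suff [y [hy ky ET]] : exists y, [/\ idl G E y, inK i y & T x = T y].
  suff -> : x = y by [].
  apply/eqP; rewrite -subr_eq0; apply/eqP/(Tm_inj hX hm); last by rewrite linearB /= ET subrr.
  exact: subspB (inK_subsp _ _ _) kx ky.
apply: (@idl_ind al' (tr G) (tr E) (fun x' => exists y, [/\ idl G E y, inK i y & x' = T y]) _ _ _ h).
  split; first by exists 0; split; [exact: spn0|exact: subsp0 (inK_subsp _ _ _)|rewrite linear0].
  move=> a _ _ [y [hy ky ->]] [z [hz kz ->]]; exists (a *: y + z); rewrite linearP.
  by split; [exact: (idl_subsp _ _).2|exact: (inK_subsp _ _ _).2|].
move=> _ _ [g [hg kg ->]] [y [hy ky ->]] y0; exists (g * y); split; last by rewrite (TmM hX).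
- exact: idl_gen.
- exact: inKM.
Qed.

(** The converse of [idl_tr]. It rests on the reduction to factors in the kernel of [dr i], because
    [Tm] is multiplicative only there. *)
Lemma tr_idl G E x : coid G -> coid E -> (forall y, E y -> G y) -> E e -> inK i x ->
  idl G E x -> idl (tr G) (tr E) (T x).
Proof.
move=> hG hE EG he kx /(idl_redu hG hE EG he) /(redu_inK hG (EG _ he)) /(_ kx).
apply: (@idl_ind al _ _ (fun x => idl (tr G) (tr E) (T x))).
  split; first by rewrite linear0; exact: spn0.
  by move=> a y z hy hz; rewrite linearP; exact: (idl_subsp _ _).2.
move=> g y [hg kg] [hy ky] y0; rewrite (TmM hX) //.
by apply: idl_gen; [exists g|exists y|].
Qed.
End CoidealStep.

(** * Descent along a chain of reflections *)

Section Path.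
Variables (n : nat) (K : fieldType) (Lam : zmodType) (X : Lam -> Lam -> K).
Hypothesis hX : bichar X.
Implicit Types (al : 'I_n -> Lam) (v : Lam).

Definition qpos al v := exists w, v = wta al w.
Definition indep al := forall w z, wta al w = wta al z -> perm_eq w z.

Lemma qposD al u v : qpos al u -> qpos al v -> qpos al (u + v).
Proof. by move=> [w ->] [z ->]; exists (w ++ z); rewrite wta_cat. Qed.

Lemma qposM al u t : qpos al u -> qpos al (u *+ t).
Proof.
move=> h; elim: t => [|t IH]; first by exists [::]; rewrite mulr0n wta_nil.
by rewrite mulrS; exact: qposD.
Qed.

Lemma qpos_simple al i : qpos al (al i).
Proof. by exists [:: i]; rewrite wta_cons wta_nil addr0. Qed.

Lemma wta_eq0 al w : indep al -> wta al w = 0 -> w = [::].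
Proof. by move=> h h0; have := h w [::]; rewrite wta_nil => /(_ h0) /perm_nilP. Qed.

Lemma qpos_opp al v : indep al -> qpos al v -> qpos al (- v) -> v = 0.
Proof.
move=> hI [w ->] [z hz]; have : wta al (w ++ z) = 0 by rewrite wta_cat -hz subrr.
by move/(wta_eq0 hI); case: w {hz} => //; rewrite wta_nil.
Qed.

Lemma wta_refl al i m w : wta (refl al i m) w + al i *+ count_mem i w =
  wta al (filter (predC1 i) w) + al i *+ (\sum_(k <- w | k != i) m k).
Proof.
elim: w => [|k w IH] /=; first by rewrite !wta_nil big_nil.
rewrite wta_cons big_cons /refl; case: (eqVneq k i) => [->|ki] /=.
  by rewrite add1n mulrS addrACA addNr add0r IH.
by rewrite add0n mulrnDr wta_cons addrACA -IH addrA.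
Qed.

Lemma indep_refl al i m : indep al -> indep (refl al i m).
Proof.
move=> hI w z h.
pose s u := (\sum_(k <- u | k != i) m k)%N.
have H : wta al (filter (predC1 i) w ++ nseq (s w + count_mem i z) i) =
  wta al (filter (predC1 i) z ++ nseq (s z + count_mem i w) i).
  have hn t : wta al (nseq t i) = al i *+ t.
    by elim: t => [|t IH]; rewrite ?wta_nil // wta_cons IH mulrS.
  by rewrite !wta_cat !hn !mulrnDr !addrA -!wta_refl h addrAC.
have P := hI _ _ H.
have P1 : perm_eq (filter (predC1 i) w) (filter (predC1 i) z).
  have := perm_filter (predC1 i) P; rewrite !filter_cat !filter_id.
  have hf t : filter (predC1 i) (nseq t i) = [::] by elim: t => //= t ->; rewrite eqxx.
  by rewrite !hf !cats0.
have es : s w = s z by rewrite /s -!(big_filter w) -!(big_filter z); apply: perm_big.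
have ec : count_mem i w = count_mem i z.
  have := perm_size P; rewrite !size_cat !size_nseq (perm_size P1) es.
  by move/eqP; rewrite !eqn_add2l => /eqP.
apply/seq.permP => a.
have ca u : count a u = (count a (filter (predC1 i) u) + a i * count_mem i u)%N.
  elim: u => [|k u IH] /=; first by rewrite muln0.
  by rewrite IH; case: (eqVneq k i) => [->|_] /=; lia.
by rewrite (ca w) (ca z) ec (seq.permP P1).
Qed.

(** All that is retained of the root system: simple systems closed under reflections, and a finite
    list containing their simple roots in which every member is positive or negative for each
    system. Finiteness of the list bounds the chain of reflections. *)
Definition groupoid (Ch : ('I_n -> Lam) -> Prop) (Phi : seq Lam) :=
  [/\ forall al i, Ch al -> exists2 m, cartan X al i m & Ch (refl al i m),
      forall al, Ch al -> indep al,
      forall al i, Ch al -> al i \in Phi &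
      forall al v, Ch al -> v \in Phi -> qpos al v \/ qpos al (- v)].

Lemma hom_Tm al i m v (x : sh (chiX X al)) :
  homw v x -> homw v (Tm i m x : sh (chiX X (refl al i m))).
Proof.
move=> /pj_hom e; have -> : Tm i m x = pj v (Tm i m x) by rewrite /pj -(Tm_Mw hX) -/(pj v x) e.
exact: hom_pj.
Qed.

Section Base.
Variable al : 'I_n -> Lam.
Hypothesis hI : indep al.
Local Notation F := (sh (chiX X al)).
Implicit Types (E G : F -> Prop) (x y g : F).

Lemma hom_letrP k x : homw (al k) x -> x = x [:: k] *: letr (chiX X al) k.
Proof.
move=> hx; apply: shP => w; rewrite shZE /letr /delta.
case: (w =P [:: k]) => [->|ne]; first by rewrite mulr1.
rewrite mulr0; apply/eqP; case: eqP => // /eqP /hx hw; case: ne.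
have : wta al w = wta al [:: k] by rewrite hw wta_cons wta_nil addr0.
by move/hI/perm_small_eq; apply.
Qed.

Lemma coid_pj E v x : coid E -> E x -> E (pj v x).
Proof. by case=> _ _ _ _ [h _]; exact: h. Qed.

Lemma coid_drs E w x : coid E -> E x -> E (drs w x).
Proof.
case=> _ _ _ h _; elim: w x => [|k w IH] x hx; first by rewrite drs_nil.
by rewrite drs_cons; apply: h; exact: IH.
Qed.

(** Stripping [w] from the right leaves an element of weight [al k], which can only be a multiple of
    the letter. *)
Lemma coid_letr E k w x : coid E -> E x -> homw (al k + wta al w) x -> x (k :: w) != 0 ->
  E (letr (chiX X al) k).
Proof.
move=> hE hx hh nz; have hd : homw (al k) (drs w x).
  by have := hom_drs (w := w) hh; rewrite addrK.
have -> : letr (chiX X al) k = (x (k :: w))^-1 *: drs w x.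
  by rewrite (hom_letrP hd) scalerA /drs mulVf // scale1r.
by case: (hE) => hs _ _ _ _; apply: subspZ => //; exact: coid_drs.
Qed.

Lemma coid_noletr E y : coid E -> (forall k, ~ E (letr (chiX X al) k)) ->
  E y -> y [::] = 0 -> y = 0.
Proof.
move=> hE hn hy y0; apply: shP => -[|k w]; first by rewrite y0.
apply/eqP; case: eqP => // /eqP nz; case: (hn k).
apply: (@coid_letr _ _ w (pj (al k + wta al w) y)) => //; first exact: coid_pj.
  exact: hom_pj.
by rewrite /pj /Mw wta_cons eqxx mul1r.
Qed.

Lemma idl_triv G E x : (forall y, E y -> y [::] = 0 -> y = 0) -> idl G E x -> x = 0.
Proof.
move=> h; apply: (@idl_ind n K Lam X al G E (fun x => x = 0)).
  by split=> // a y z -> ->; rewrite scaler0 addr0.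
by move=> g y _ hy y0; rewrite (h y hy y0) mulr0.
Qed.

Lemma coid_splith G i g v : coid G -> G (letr (chiX X al) i) -> G g -> homw v g ->
  exists g0 g1, [/\ G g0 /\ homw v g0, inK i g0, G g1 & g = g0 + g1 * letr (chiX X al) i].
Proof.
move=> hG he hg hv; have [g0 [g1 [h0 k0 h1 E0]]] := coid_split hX hG he hg.
have [_ _ _ _ [hMw _]] := hG.
exists (pj v g0), (Mw (fun u => (u + al i == v)%:R) g1); split; [|exact: inK_Mw|exact: hMw|].
  by split; [exact: hMw|exact: hom_pj].
rewrite -(Mw_mulr hX (fun u => (u == v)%:R) g1 (@hom_letr n K Lam X al i)) -{1}(pj_hom hv) {1}E0.
by rewrite /pj linearD.
Qed.

End Base.

Variables (Ch : ('I_n -> Lam) -> Prop) (Phi : seq Lam).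
Hypothesis hCh : groupoid Ch Phi.

Variables (al0 : 'I_n -> Lam) (be : Lam).
Hypotheses (hal0 : Ch al0) (be0 : be != 0).

(* positive roots common to the initial and the current simple system; reflecting in a simple
   root al i of the coideal subalgebra removes al i and adds nothing *)
Definition msr al := count (fun v => `[< qpos al0 v >] && `[< qpos al v >]) Phi.

Lemma msr_refl al i m : Ch al -> Ch (refl al i m) -> qpos al0 (al i) ->
  (msr (refl al i m) < msr al)%N.
Proof.
move=> hc hc' hi; have [_ hI hS hsgn] := hCh.
pose p v := `[< qpos al0 v >] && `[< qpos al v >].
pose p' v := `[< qpos al0 v >] && `[< qpos (refl al i m) v >].
have sub v : v \in Phi -> p' v -> p v && (v != al i).
  move=> hv /andP[/asboolP v0 /asboolP v1].
  have ai0 : al i != 0.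
    by apply/eqP => E; have := @wta_eq0 al [:: i] (hI _ hc); rewrite wta_cons wta_nil addr0 => /(_ E).
  have vi : v != al i.
    apply/eqP => E; case/eqP: ai0; rewrite -E; apply: (qpos_opp (hI _ hc')) => //.
    by rewrite E -[X in qpos _ X](_ : refl al i m i = _); [exact: qpos_simple|rewrite /refl eqxx].
  rewrite /p vi andbT; apply/andP; split; first exact/asboolP.
  apply/asboolP; case: (hsgn _ _ hc hv) => // -[z hz].
  case: v1 => w hw; have H := wta_refl al i m w.
  have P : perm_eq (filter (predC1 i) w ++ nseq (\sum_(k <- w | k != i) m k) i ++ z) (nseq (count_mem i w) i).
    have hn t : wta al (nseq t i) = al i *+ t.
      by elim: t => [|t IH]; rewrite ?wta_nil // wta_cons IH mulrS.
    apply: (hI _ hc); rewrite !wta_cat !hn addrA -H -hw -hz addrAC subrr add0r //.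
  have w0 : filter (predC1 i) w = [::].
    have := perm_filter (predC1 i) P; rewrite !filter_cat filter_id.
    have hf t : filter (predC1 i) (nseq t i) = [::] by elim: t => //= t ->; rewrite eqxx.
    by rewrite !hf => /perm_nilP; case: (filter _ w).
  have v2 : qpos al0 (- v).
    have -> : - v = al i *+ count_mem i w.
      have s0 : (\sum_(k <- w | k != i) m k = 0)%N by rewrite -(big_filter w) -[filter _ _]/(filter (predC1 i) w) w0 big_nil.
      by move: H; rewrite w0 wta_nil s0 mulr0n addr0 -hw addrC => /eqP; rewrite addr_eq0 => /eqP ->.
    exact: qposM.
  by exists [::]; rewrite wta_nil (qpos_opp (hI _ hal0) v0 v2).
have ap : p (al i) by rewrite /p; apply/andP; split; apply/asboolP => //; exact: qpos_simple.
have haP := hS _ i hc.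
rewrite /msr -/p -/p'.
apply: (@leq_trans (count p' Phi + count_mem (al i) Phi)%N).
  by rewrite -addn1 leq_add2l -has_count; apply/hasP; exists (al i) => /=.
elim: (Phi) sub => [|v s IH] sub //=.
have IH' : (count p' s + count_mem (al i) s <= count p s)%N.
  by apply: IH => u us; apply: sub; rewrite inE us orbT.
have := sub v (mem_head _ _); case: (p' v) => [/(_ isT)/andP[-> /negbTE ->]|_].
  by rewrite !add0n !add1n addSn ltnS.
case: (eqVneq v (al i)) => [->|_]; rewrite ?ap !add0n; first by rewrite !add1n addnS ltnS.
exact: leq_trans IH' (leq_addl _ _).
Qed.

(* When E contains no letter any more it is trivial, so G1 lives in weights N be and contains a
   letter, of weight be, whose weight space is a line. *)
Lemma path_coid N al (E G1 : sh (chiX X al) -> Prop) : Ch al -> coid E -> coid G1 ->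
  (forall y, E y -> G1 y) ->
  (forall v x, E x -> homw v x -> x != 0 -> qpos al0 v) ->
  (forall v x, G1 x -> homw v x -> (forall t, v <> be *+ t) -> idl G1 E x) ->
  (exists g, [/\ G1 g, homw be g & ~ idl G1 E g]) -> (msr al < N)%N ->
  (exists al' k, Ch al' /\ al' k = be) /\
  forall G : sh (chiX X al) -> Prop, coid G -> (forall y, E y -> G y) ->
  forall g1 g2, G g1 -> G g2 -> homw be g1 -> homw be g2 ->
  exists a1 a2 : K, (a1 != 0) || (a2 != 0) /\ idl G E (a1 *: g1 + a2 *: g2).
Proof.
have [hR hI hS hsgn] := hCh.
elim: N al E G1 => // N IH al E G1 hc hE hG EG hd ha [g [gG gbe gI]] hN.
have [[i he]|hno] := pselect (exists i, E (letr (chiX X al) i)); last first.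
  have E0 y : E y -> y [::] = 0 -> y = 0.
    by apply: coid_noletr => //; [exact: hI|move=> k hk; apply: hno; exists k].
  have I0 G x : idl G E x -> x = 0 by exact: idl_triv.
  have gn : g != 0 by apply/eqP => E1; apply: gI; rewrite E1; exact: spn0.
  have [w hw] : exists w, g w != 0.
    apply: contrapT => hn; case/eqP: gn; apply: shP => w.
    by apply/eqP; case: eqP => // /eqP h; case: hn; exists w.
  have ew := gbe _ hw; case: w hw ew => [|k w] hw ew.
    by move: be0; rewrite -ew wta_nil eqxx.
  have hk : G1 (letr (chiX X al) k).
    apply: (@coid_letr al (hI _ hc) _ k w g) => //.
    by rewrite -wta_cons ew.
  (* The ideal is zero here, so a nonzero letter of [G1] must have one of the exceptional
     weights. *)
  have [t et] : exists t, al k = be *+ t.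
    apply: contrapT => hn.
    have : idl G1 E (letr (chiX X al) k).
      by apply: ha hk (@hom_letr n K Lam X al k) _ => t et; apply: hn; exists t.
    move/I0 => /(congr1 (fun f : sh (chiX X al) => f [:: k])).
    by rewrite /letr /delta eqxx => /eqP; rewrite oner_eq0.
  (* [be] is the weight of [k :: w], so the single letter [k] has the content of [t] copies of this
     word; hence [t = 1] and [w] is empty. *)
  have P : perm_eq [:: k] (flatten (nseq t (k :: w))).
    apply: (hI _ hc); rewrite wta_cons wta_nil addr0 et -ew.
    by elim: t {et} => [|t IHt]; rewrite ?wta_nil // mulrS /= -cat_cons wta_cat IHt.
  have [t1 w0] : t = 1%N /\ w = [::].
    move: (perm_size P); rewrite size_flatten /shape map_nseq /= sumn_nseq.
    by case: t {et P} => [|[|t]] //=; case: (w) => [|? ?] //=; rewrite ?muln0 //; lia.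
  have ek : al k = be by rewrite et t1.
  split; first by exists al, k.
  move=> G _ _ g1 g2 _ _; rewrite -ek => /(hom_letrP (hI _ hc)) E1 /(hom_letrP (hI _ hc)) E2.
  have [z|nz] := eqVneq (g1 [:: k]) 0.
    exists 1, 0; rewrite oner_eq0; split=> //; rewrite E1 z scale0r scaler0 scale0r addr0; exact: spn0.
  exists (g2 [:: k]), (- g1 [:: k]); rewrite oppr_eq0 nz orbT; split=> //.
  move: (g1 [:: k]) (g2 [:: k]) E1 E2 => c1 c2 -> ->.
  by rewrite !scalerA mulrC mulNr scaleNr subrr; exact: spn0.
have hei : letr (chiX X al) i != 0.
  apply/eqP => /(congr1 (fun f : sh (chiX X al) => f [:: i])).
  by rewrite /letr /delta eqxx => /eqP; rewrite oner_eq0.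
have ai : qpos al0 (al i) by apply: (hd _ _ he) => //; exact: hom_letr.
have [m hm hc'] := hR _ i hc.
have lt := msr_refl hc hc' ai.
have hG' := coid_tr hX hm hG (EG _ he); have hE' := coid_tr hX hm hE he.
have subtr (A B : sh (chiX X al) -> Prop) : (forall y, A y -> B y) ->
  forall y, tr (m := m) (i := i) A y -> tr (m := m) (i := i) B y.
  by move=> AB _ [x [hx kx] ->]; exists x => //; split=> //; exact: AB.
have homT v (x : sh (chiX X al)) : homw v x -> homw v (Tm i m x : sh (chiX X (refl al i m))).
  exact: hom_Tm.
have homI (A : sh (chiX X al) -> Prop) v x' : coid A -> tr (m := m) (i := i) A x' -> homw v x' ->
  exists x, [/\ A x, inK i x, homw v x & x' = Tm i m x].
  move=> hA [x [hx kx] ->] /pj_hom e; exists (pj v x); split; [exact: coid_pj|exact: inK_Mw|exact: hom_pj|].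
  by rewrite /pj (Tm_Mw hX).
have [] := IH _ _ _ hc' hE' hG' (subtr _ _ EG).
- move=> v x' hx' hv nz; have [x [hx kx hxv Ex]] := homI _ _ _ hE hx' hv.
  by apply: (hd v x) => //; apply: contra nz => /eqP E0; rewrite Ex E0 linear0.
- move=> v x' hx' hv nv; have [x [hx kx hxv Ex]] := homI _ _ _ hG hx' hv.
  by rewrite Ex; apply: (tr_idl hX hm) => //; exact: ha hxv nv.
(* The part of [g] that is a right multiple of the letter lies in the ideal, so the part in the
   kernel of [dr i] stays outside it. *)
- have [g0 [g1 [[h0 h0v] k0 h1 E0]]] := coid_splith hG (EG _ he) gG gbe.
  exists (Tm i m g0); split; [by exists g0|exact: homT|].
  move/(idl_tr hX hm hG hE EG he k0) => h; apply: gI; rewrite E0.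
  by apply: subspD (idl_subsp _ _) h _; apply: idl_gen.
- exact: leq_trans lt _.
move=> h1 h2; split=> // G hGG EGG g1 g2 hg1 hg2 hv1 hv2.
have [u1 [u1' [[uG1 uv1] uk1 uG1' E1]]] := coid_splith hGG (EGG _ he) hg1 hv1.
have [u2 [u2' [[uG2 uv2] uk2 uG2' E2]]] := coid_splith hGG (EGG _ he) hg2 hv2.
have [] := h2 _ (coid_tr hX hm hGG (EGG _ he)) (subtr _ _ EGG) (Tm i m u1) (Tm i m u2).
- by exists u1.
- by exists u2.
- exact: homT.
- exact: homT.
move=> a1 [a2 [nz]]; rewrite -!linearZ -linearD => /(idl_tr hX hm hGG hE EGG he) hI'.
exists a1, a2; split=> //; rewrite E1 E2 !scalerDr addrACA; apply: subspD (idl_subsp _ _) (hI' _) _.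
  by apply: subspD (inK_subsp _ _ _) _ _; apply: subspZ => //; exact: inK_subsp.
by apply: subspD (idl_subsp _ _) _ _; apply: subspZ (idl_subsp _ _) _; apply: idl_gen.
Qed.

End Path.

(** * Supports of shuffle products below a Lyndon word *)

Section SplitWords.
Variable n : nat.
Implicit Types (l a b x y z w : word n).

Lemma below_prefix l a b : below l (a ++ b) -> below l a.
Proof. by move=> h m lm lt; apply: wle_lt_trans (wle_catr a b) (h m lm lt). Qed.

Lemma below_short l x : lyndon l -> below l x -> (size x < size l)%N -> wlt x l.
Proof.
move=> ll /(belowP ll) [//|[z' -> _]].
by rewrite size_cat ltnNge leq_addr.
Qed.

Lemma split_lyndon l x y : lyndon l -> below l x -> below l y -> shuf x y l ->
  (y = [::] /\ x = l) \/ (x = [::] /\ y = l).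
Proof.
move=> ll bx by_ sh; case: (eqVneq y [::]) => [e|yn].
  by left; split=> //; rewrite e in sh; exact: shuf_nil sh.
case: (eqVneq x [::]) => [e|xn].
  by right; split=> //; rewrite e in sh; exact: shuf_nil (shuf_sym sh).
have s := shuf_size sh.
have x0 : (0 < size x)%N by rewrite lt0n size_eq0.
have y0 : (0 < size y)%N by rewrite lt0n size_eq0.
have xl : wlt x l by apply: below_short => //; rewrite s -addn1 leq_add2l.
have yl : wlt y l by apply: below_short => //; rewrite s -add1n leq_add2r.
by have := lyndon_no_shuffle ll sh (elimN eqP xn) (elimN eqP yn) xl; rewrite yl.
Qed.

Lemma split_lyndon_lt l x y : lyndon l -> below l x -> wlt y l -> shuf x y l ->
  y = [::] /\ x = l.
Proof.
move=> ll bx yl sh; have [//|[_ e]] := split_lyndon ll bx (below_le (wltW yl)) sh.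
by move: yl; rewrite e wlt_irr.
Qed.

Lemma below_drop l x : lyndon l -> below l (l ++ x) -> below l x.
Proof.
move=> ll /(belowP ll)[h|[z' /eqP]].
  by have := wlt_le_trans h (wle_catr l x); rewrite wlt_irr.
by rewrite eqseq_cat // eqxx => /eqP ->.
Qed.

(** Copies of [l] are removed one at a time. Each comes entirely from [x], since a Lyndon word is
    not a shuffle of two nonempty words below it. *)
Lemma split_power l t x y : lyndon l -> below l x -> wlt y l ->
  shuf x y (flatten (nseq t l)) -> y = [::].
Proof.
move=> ll; elim: t x y => [|t IH] x y bx yl /=.
  by move/shuf_size/esym/eqP; rewrite addn_eq0 => /andP[_ /nilP].
case/shuf_cat=> [x1 [x2 [y1 [y2 [ex ey s1 s2]]]]].
have [e1 e2] : y1 = [::] /\ x1 = l.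
  apply: split_lyndon_lt => //; first by apply: (@below_prefix _ _ x2); rewrite -ex.
  by apply: wle_lt_trans yl; rewrite ey; exact: wle_catr.
rewrite ey e1; apply: (IH x2) => //; first by apply: below_drop => //; move: (bx); rewrite ex e2.
by move: yl; rewrite ey e1.
Qed.

Lemma shuf_power_le l t a b c z : lyndon l -> below l a -> size a = (t * size l)%N ->
  wlt b l -> wle b c -> shuf a b z -> wle z (flatten (nseq t l) ++ c).
Proof.
move=> ll; elim: t a z => [|t IH] a z ba sa bl bc sh.
  move/eqP: sa; rewrite mul0n size_eq0 => /eqP a0; rewrite a0 in sh.
  by rewrite -(shuf_nil (shuf_sym sh)).
have bz : below l z by apply: below_shuf sh => //; exact: below_le (wltW bl).
case: (belowP ll bz) => [h|[z' ez bz']].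
  by apply: wltW; rewrite /= -catA; exact: wlt_catw.
rewrite ez /= -catA wle_cat2l; move: sh; rewrite ez.
case/shuf_cat=> [x1 [x2 [y1 [y2 [ex ey s1 s2]]]]].
have [e1 e2] : y1 = [::] /\ x1 = l.
  apply: split_lyndon_lt => //; first by apply: (@below_prefix _ _ x2); rewrite -ex.
  by apply: wle_lt_trans bl; rewrite ey; exact: wle_catr.
apply: (IH x2) => //; first by apply: below_drop => //; move: (ba); rewrite ex e2.
  by move: sa; rewrite ex e2 size_cat mulSn => /addnI.
by rewrite ey e1.
Qed.

(** A shuffle is either below [l] or begins with [l], which then comes whole from one of the two
    words. If it comes from [b], the next factor [m] equals [l] and the induction passes to the
    shorter list. *)
Lemma shuf_prod_le l ls a b z : lyndon l -> all (@lyndon n) ls -> sorted (@wge n) (l :: ls) ->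
  wle a l -> size a = size l -> wle b (flatten ls) -> shuf a b z ->
  wle z (l ++ flatten ls).
Proof.
move=> ll; elim: ls b z => [|m ls IH] b z hl hs al sa bl sh.
  have b0 : b = [::] by case/orP: bl => [/eqP//|]; rewrite wlts0.
  by rewrite cats0; rewrite b0 in sh; rewrite -(shuf_nil sh).
have ba := below_le al.
have bb : below l b.
  move=> k lk lt; apply: wle_lt_trans bl _; apply: below_flatten (lk) lt.
  exact: sorted_wge_all hs.
case: (belowP ll (below_shuf ba bb sh)) => [h|[z' ez bz']].
  exact/wltW/wlt_catw.
move: sh; rewrite ez wle_cat2l.
case/shuf_cat=> [x1 [x2 [y1 [y2 [ex ey s1 s2]]]]].
have ba1 : below l x1 by apply: (@below_prefix _ _ x2); rewrite -ex.
have bb1 : below l y1 by apply: (@below_prefix _ _ y2); rewrite -ey.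
have [[e1 e2]|[e1 e2]] := split_lyndon ll ba1 bb1 s1.
  have x20 : x2 = [::].
    by move: sa; rewrite ex e2 size_cat -[RHS]addn0 => /addnI/eqP; rewrite size_eq0 => /eqP.
  by move: s2; rewrite x20 => /shuf_sym/shuf_nil <-; move: bl; rewrite ey e1.
have ml : wle m l by have /andP[] := sorted_wge_all hs.
have eml : m = l.
  case/orP: ml => [/eqP//|ml]; have : wlt (flatten (m :: ls)) l.
    by apply: (sorted_first_lt ll _ ml); case/andP: hs.
  move/(wle_lt_trans bl); rewrite ey e2 => h.
  by have := wlt_le_trans h (wle_catr l y2); rewrite wlt_irr.
move: bl; rewrite ey e2 /= eml wle_cat2l => bl2.
have hs' : sorted (@wge n) (l :: ls) by move: hs; rewrite eml => /andP[].
apply: (IH y2) => //; first by case/andP: hl.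
by move: s2; rewrite ex e1.
Qed.

End SplitWords.

Section SplitShuffle.
Variables (n : nat) (K : fieldType) (chi : 'I_n -> 'I_n -> K).
Local Notation F := (sh chi).
Implicit Types (x y : F) (p w z : word n).

Lemma dls_vanish p x y : (forall a1 a2 c1 c2, x (a1 ++ a2) != 0 -> y (c1 ++ c2) != 0 ->
  ~ shuf a1 c1 p) -> dls p (x * y) = 0.
Proof.
move=> h; apply: shP => w; apply/eqP; case: eqP => // /eqP /shM_neq0[a [b [sh ha hb]]].
have [a1 [a2 [c1 [c2 [ea eb s1 _]]]]] := shuf_cat sh.
by case: (h a1 a2 c1 c2); rewrite -?ea -?eb.
Qed.

Lemma ch_neq0 f x w : ch f x w != 0 -> x w != 0.
Proof. by rewrite /ch mulf_eq0 negb_or => /andP[]. Qed.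


Lemma dls_splitl p x y : (forall a1 a2 c1 c2, x (a1 ++ a2) != 0 -> y (c1 ++ c2) != 0 ->
  shuf a1 c1 p -> c1 = [::]) ->
  dls p (x * y) = dls p x * ch (fun a => \prod_(b <- p) chi b a) y.
Proof.
elim: p x y => [|k p IH] x y h.
  rewrite !dls_nil; congr (_ * _); apply: shP => w.
  by rewrite /ch big1 ?mul1r // => a _; rewrite big_nil.
rewrite dls_cons dlM linearD /= [X in _ + X]dls_vanish ?addr0 => [|a1 a2 c1 c2 hx hy s].
  rewrite IH => [|a1 a2 c1 c2 hx /ch_neq0 hy s].
    congr (_ * _); apply: shP => w; rewrite /ch mulrA -big_split /=; congr (_ * _).
    by apply: eq_bigr => a _; rewrite big_cons mulrC.
  by apply: (h (k :: a1) a2 c1 c2) => //; constructor.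
have : k :: c1 = [::] by apply: (h a1 a2 (k :: c1) c2) => //; constructor.
by [].
Qed.

End SplitShuffle.

Lemma count_lt (T : eqType) (p q : pred T) (s : seq T) z : (forall v, p v -> q v) ->
  z \in s -> q z -> ~~ p z -> (count p s < count q s)%N.
Proof.
move=> pq + qz pz; elim: s => //= v s IH; rewrite inE => /orP[/eqP <-|/IH h].
  by rewrite qz (negbTE pz) add0n add1n ltnS; exact: sub_count.
case: (boolP (p v)) => [/pq ->|_]; first by rewrite ltn_add2l.
exact: leq_trans h (leq_addl _ _).
Qed.

(** * The coideal subalgebras attached to a Lyndon word *)

Section Initial.
Variables (n : nat) (K : fieldType) (Lam : zmodType) (X : Lam -> Lam -> K).
Hypothesis hX : bichar X.
Variables (Ch : ('I_n -> Lam) -> Prop) (Phi : seq Lam).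
Hypothesis hCh : groupoid X Ch Phi.
Variable al : 'I_n -> Lam.
Hypothesis hal : Ch al.
Local Notation chi := (chiX X al).
Local Notation F := (sh chi).
Implicit Types (x y g : F) (l m z w a b : word n).

Let hI : indep al. Proof. by case: hCh => _ h _ _; exact: h. Qed.
Let chiC : forall i j, chi i j = chi j i. Proof. exact: chiXC. Qed.
Let chin : forall i j, chi i j != 0. Proof. exact: chiX_neq0. Qed.

Lemma hom_phom v w x : homw v x -> x w != 0 -> phom w x.
Proof. by move=> h hw z hz; apply: hI; rewrite (h _ hz) (h _ hw). Qed.

Lemma phom_homw w x : phom w x -> homw (wta al w) x.
Proof. exact: phom_hom. Qed.

Lemma coid_inUp : coid (@inUp n K chi).
Proof.
split; [exact: inUp_subsp|exact: inUp1|exact: inUpM|by move=> k x; exact: inUp_dr|].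
by split=> // f x; exact: inUp_Mw.
Qed.

Lemma coid_supp (A : word n -> Prop) : A [::] -> (forall a b, A (a ++ b) -> A a) ->
  (forall a b z, A a -> A b -> shuf a b z -> A z) ->
  coid (fun x => inUp x /\ forall w, x w != 0 -> A w).
Proof.
move=> A0 Ap As; split.
- split; first by split; [exact: inUp0|move=> w; rewrite sh0E eqxx].
  move=> c x y [hx hx'] [hy hy']; split; first by apply: inUpD => //; exact: inUpZ.
  move=> w; rewrite shDE shZE; case: (eqVneq (x w) 0) => [->|/hx' //].
  by rewrite mulr0 add0r => /hy'.
- split; first exact: inUp1.
  by move=> [|k w] //; rewrite (_ : (1 : F) (k :: w) = 0) ?eqxx.
- move=> x y [hx hx'] [hy hy']; split; first exact: inUpM.
  by move=> w /shM_neq0[a [b [s /hx' ha /hy' hb]]]; exact: As s.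
- move=> k x [hx hx']; split; first exact: inUp_dr.
  by move=> w; rewrite /dr -cats1 => /hx'; exact: Ap.
- split=> [f x [hx hx']|x []//]; split; first exact: inUp_Mw.
  by move=> w; rewrite /Mw mulf_eq0 negb_or => /andP[_ /hx'].
Qed.

Section Lyndon.
Variable l : word n.
Hypothesis ll : lyndon l.
(** [Elow] is the subalgebra exhausted along the path. [Gbel] lies over it, and modulo the ideal
    formed by the two only the weights of powers of [l] survive ([Gbel_idl]). *)
Definition Elow x := inUp x /\ forall w, x w != 0 -> wlt w l.
Definition Gbel x := inUp x /\ forall w, x w != 0 -> below l w.

Lemma coid_Elow : coid Elow.
Proof.
apply: coid_supp; first by rewrite wlt0s lyndon_ne.
  by move=> a b; apply: wle_lt_trans; exact: wle_catr.
by move=> a b z; exact: shuf_lt.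
Qed.

Lemma coid_Gbel : coid Gbel.
Proof.
apply: coid_supp; first by apply: below_le; case: (l) => // *; exact/orP/or_intror.
  by move=> a b; exact: below_prefix.
by move=> a b z; exact: below_shuf.
Qed.

Lemma Elow_Gbel x : Elow x -> Gbel x.
Proof. by case=> hx h; split=> // w /h /wltW; exact: below_le. Qed.

Lemma wta_power t : wta al (flatten (nseq t l)) = wta al l *+ t.
Proof. by elim: t => [|t IH]; rewrite ?wta_nil //= wta_cat IH mulrS. Qed.

(* If l^t z2 is the largest word of x, with z2 < l, then the product of the left and right
   parts of x at that word lies in the ideal and has the same largest word. *)
Lemma Gbel_idl v x : Gbel x -> homw v x -> (forall t, v <> wta al l *+ t) -> idl Gbel Elow x.
Proof.
move=> hx hv nv; have [->|xn] := eqVneq x 0; first exact: spn0.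
have [w hw] : exists w, x w != 0.
  apply: contrapT => hn; case/eqP: xn; apply: shP => w.
  by apply/eqP; case: eqP => // /eqP h; case: hn; exists w.
have [z hz] := maxat_exists (hom_phom hv hw) xn.
(* Induction on the number of rearrangements of [z] that lie below [z]. *)
move: {w hw xn} (leqnn (count (fun u => wlt u z) (permutations z)).+1).
move: {2}(_.+1) => N; elim: N x z hx hv hz => // N IH x z hx hv [xz hz] hN.
have [hxU hxb] := hx; have hp := hom_phom hv xz.
have [t [z2 [ez z2l]]] := below_power ll (hxb _ xz).
set p := flatten (nseq t l) in ez.
have z2n : z2 != [::].
  apply/eqP => e; apply: (nv t); rewrite -(hv _ xz) ez e cats0 wta_power //.
pose u1 := drs z2 x; pose u2 := dls p x.
have u1p : phom p u1.
  by move=> a; rewrite /u1 /drs => /hp; rewrite ez perm_cat2r.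
have u2p : phom z2 u2 by apply: phom_dls; rewrite -ez.
have Gu1 : Gbel u1.
  split; first exact: inUp_drs.
  by move=> a /hxb; exact: below_prefix.
have u2le b : u2 b != 0 -> wle b z2 by move/hz; rewrite ez wle_cat2l.
have Eu2 : Elow u2.
  split; first exact: inUp_dls.
  by move=> b /u2le; move/wle_lt_trans; apply.
have u20 : u2 [::] = 0.
  apply/eqP; case: eqP => // /eqP /u2p; rewrite perm_sym => /perm_nilP e.
  by rewrite e in z2n.
pose y := u1 * u2.
have hy : idl Gbel Elow y by exact: idl_gen.
have Gy : Gbel y by case: coid_Gbel => _ _ hM _ _; apply: hM => //; exact: Elow_Gbel.
have hvy : homw v y.
  by rewrite -(hv _ xz) ez wta_cat /y; apply: homM; exact: phom_homw.
have yz : y z != 0.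
  have -> : y z = u1 p * ((\prod_(a <- z2) (\prod_(b <- p) chi b a)) * u2 z2).
    rewrite ez -[y _]/(dls p y z2) /y dls_splitl => [|a1 a2 c1 c2 h1 h2 s].
      rewrite (dls_full u1p) // -scalerAl mul1r //.
    apply: (split_power ll _ _ s).
      by apply: (below_prefix (b := a2)); case: Gu1 => _; apply.
    by apply: wle_lt_trans (wle_catr c1 c2) _; case: Eu2 => _; apply.
  rewrite !mulf_neq0 //; try by rewrite /u1 /u2 /drs /dls -ez.
  by rewrite prodf_seq_neq0; apply/allP => a _; rewrite prodf_seq_neq0; apply/allP => b _; exact: chin.
have yle b : y b != 0 -> wle b z.
  move/shM_neq0=> [a [c [s ha hc]]]; rewrite ez.
  apply: (shuf_power_le ll _ _ _ _ s).
  - by case: Gu1 => _; apply.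
  - by rewrite (perm_size (u1p _ ha)) size_flatten /shape map_nseq sumn_nseq mulnC.
  - by case: Eu2 => _; apply.
  - exact: u2le.
pose c := x z / y z; pose x' := x - c *: y.
have -> : x = x' + c *: y by rewrite subrK.
apply: (subspD (idl_subsp _ _)); last by apply: subspZ => //; exact: idl_subsp.
have x'z : x' z = 0 by rewrite /x' shBE shZE divfK // subrr.
have x'le b : x' b != 0 -> wlt b z.
  move=> h; have /orP[/eqP e|//] : wle b z; last by move: h; rewrite e x'z eqxx.
  case: (eqVneq (x b) 0) => [e|/hz //]; apply: yle; apply: contra h => /eqP e'.
  by rewrite /x' shBE shZE e e' mulr0 subrr.
have [->|x'n] := eqVneq x' 0; first exact: spn0.
have hv' : homw v x' by apply: (subspB (@hom_subsp n K Lam X al v)) => //; apply: (subspZ _ (@hom_subsp n K Lam X al v)).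
have Gx' : Gbel x'.
  by case: coid_Gbel => hs _ _ _ _; apply: (subspB hs) => //; exact: subspZ.
have [w hw] : exists w, x' w != 0.
  apply: contrapT => hn; case/eqP: x'n; apply: shP => w.
  by apply/eqP; case: eqP => // /eqP h; case: hn; exists w.
have [z' hz'] := maxat_exists (hom_phom hv' hw) x'n.
have z'z := x'le _ hz'.1.
apply: (IH x' z') => //; rewrite -ltnS; apply: leq_trans hN; rewrite ltnS.
have pz : perm_eq z' z by apply: hI; rewrite (hv _ xz) (hv' _ hz'.1).
rewrite (seq.permP (perm_permutations pz)).
apply: (count_lt (z := z')) => //; last by rewrite wlt_irr.
  by move=> b hb; exact: wlt_trans z'z.
by rewrite mem_permutations.
Qed.

(** In a product [g * y] the word [l] can come only from [g], leaving the constant term of [y],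
    which is zero. So an element with largest word [l] stays outside the ideal. *)
Lemma idl_at_lyndon x : idl Gbel Elow x -> x l = 0.
Proof.
apply: (@idl_ind n K Lam X al Gbel Elow (fun x => x l = 0)).
  by split=> // a y z hy hz; rewrite shDE shZE hy hz mulr0 addr0.
move=> g y [_ hg] [_ hy] y0.
have -> : (g * y) l = dls l (g * y) [::] by rewrite /dls cats0.
rewrite dls_splitl ?shM0E /ch ?y0 ?mulr0 ?big_nil ?mulr0 // => a1 a2 c1 c2 h1 h2 s.
have [] // := split_lyndon_lt ll _ _ s.
  by apply: (below_prefix (b := a2)); exact: hg.
exact: wle_lt_trans (wle_catr c1 c2) (hy _ h2).
Qed.

Lemma lyndon_path : domin chi l ->
  (exists al' k, Ch al' /\ al' k = wta al l) /\
  forall g1 g2, inUp g1 -> inUp g2 -> homw (wta al l) g1 -> homw (wta al l) g2 ->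
  exists a1 a2 : K, (a1 != 0) || (a2 != 0) /\ idl (@inUp n K chi) Elow (a1 *: g1 + a2 *: g2).
Proof.
move=> /domin_phom[u [hu [ul hmax] hp]].
have be0 : wta al l != 0.
  by apply/eqP => /(wta_eq0 hI) e; have := lyndon_ne ll; rewrite e.
have [] := @path_coid n K Lam X hX Ch Phi hCh al (wta al l) hal be0
  (msr Phi al al).+1 al Elow Gbel hal coid_Elow coid_Gbel Elow_Gbel.
- move=> v x _ hv xn; have [w hw] : exists w, x w != 0.
    apply: contrapT => hn; case/eqP: xn; apply: shP => w.
    by apply/eqP; case: eqP => // /eqP h; case: hn; exists w.
  by exists w; rewrite (hv _ hw).
- by move=> v x; exact: Gbel_idl.
- exists u; split; [|exact: phom_homw|].
    by split=> // w /hmax; exact: below_le.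
  by move/idl_at_lyndon => e; rewrite e eqxx in ul.
- exact: ltnSn.
move=> h1 h2; split=> // g1 g2; apply: h2; [exact: coid_inUp|by move=> y []].
Qed.

End Lyndon.

Lemma monwM_lmon a Q : monw chi a * lmon chi Q = lmon chi [seq (p.1, a ++ p.2) | p <- Q].
Proof.
rewrite /lmon big_map mulr_sumr; apply: eq_bigr => p _.
by rewrite -scalerAr monw_cat.
Qed.

Lemma pr_lmonM R a Q : pr R (monw chi a * lmon chi Q) = pr Q (dls a (lmon chi R)).
Proof. by rewrite monwM_lmon pr_sym pr_map_cat. Qed.

Lemma pr_sub0 (A : word n -> bool) Q y : spanm A y ->
  (forall w, A w -> lmon chi Q w = 0) -> pr Q y = 0.
Proof. by move=> [S [hS ->]] h; rewrite pr_sym; apply: (pr_spanm (A := A)) => //; [exists Q|exists S]. Qed.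

(** Left multiplication by a monomial [a] is adjoint to [dls a]. For [a] shorter than [v] the
    derivative is spanned by monomials at least [l], where [y] vanishes; at equal length it is a
    scalar and meets the constant term of [y]; beyond that it is zero. *)
Lemma pr_idl0 l R v x : phom v (lmon chi R) ->
  (forall a, (size a < size v)%N -> spanm (wle l) (dls a (lmon chi R))) ->
  idl (@inUp n K chi) (Elow l) x -> pr R x = 0.
Proof.
move=> hp h; apply: (@idl_ind n K Lam X al _ _ (fun x => pr R x = 0)).
  split; first by rewrite /pr big1 // => p _; rewrite sh0E mulr0.
  by move=> a y z hy hz; rewrite pr_linear hy hz mulr0 addr0.
move=> g y hg [[Q ->] hy] y0; elim/inUp_ind: g / hg => [|a].
  split; first by rewrite mul0r /pr big1 // => p _; rewrite sh0E mulr0.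
  by move=> a u z hu hz; rewrite mulrDl -scalerAl pr_linear hu hz mulr0 addr0.
rewrite pr_lmonM; case: (ltngtP (size a) (size v)) => sa.
- apply: pr_sub0 (h _ sa) _ => w lw; apply/eqP; case: eqP => // /eqP /hy wl.
  by have := wle_lt_trans lw wl; rewrite wlt_irr.
- by rewrite (dls_over hp sa) /pr big1 // => p _; rewrite sh0E mulr0.
rewrite (dls_full hp sa); set c := lmon _ _ _.
have -> : c *: (1 : F) = lmon chi [:: (c, [::])] by rewrite /lmon big_seq1 monw_nil.
by rewrite pr_sym /pr big_seq1 y0 mulr0.
Qed.

End Initial.

(** * Triangularity of the Lyndon basis *)

Section Triangular.
Variables (n : nat) (K : fieldType) (Lam : zmodType) (X : Lam -> Lam -> K).
Hypothesis hX : bichar X.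
Variables (Ch : ('I_n -> Lam) -> Prop) (Phi : seq Lam).
Hypothesis hCh : groupoid X Ch Phi.
Variable al : 'I_n -> Lam.
Hypothesis hal : Ch al.
Local Notation chi := (chiX X al).
Local Notation F := (sh chi).
Implicit Types (x y : F) (l m z w a b : word n) (ls : seq (word n)).

Let chiC : forall i j, chi i j = chi j i. Proof. exact: chiXC. Qed.
Let chin : forall i j, chi i j != 0. Proof. exact: chiX_neq0. Qed.

Definition rl l : F := rlf chi (size l) l.
Definition yw ls : F := \prod_(m <- ls) rl m.

Lemma yw_cons m ls : yw (m :: ls) = rl m * yw ls. Proof. exact: big_cons. Qed.
Lemma yw_rcons m ls : yw (rcons ls m) = yw ls * rl m.
Proof. by rewrite /yw -cats1 big_cat big_seq1. Qed.

Lemma rl_lybr l : lyndon l -> lybr l (rl l).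
Proof. by move=> h; apply: rlf_lybr. Qed.

Lemma rl_phom l : phom l (rl l). Proof. exact: rlf_phom. Qed.

Lemma yw_phom ls : phom (flatten ls) (yw ls).
Proof.
elim: ls => [|m ls IH]; first by rewrite /yw big_nil; exact: phom1.
by rewrite yw_cons; apply: phomM => //; exact: rl_phom.
Qed.

Lemma yw_inUp ls : all (@lyndon n) ls -> inUp (yw ls).
Proof.
elim: ls => [_|m ls IH /= /andP[lm hl]]; first by rewrite /yw big_nil; exact: inUp1.
by rewrite yw_cons; apply: inUpM; [case: (rl_lybr lm)|exact: IH].
Qed.

Lemma yw_lead ls : all (@lyndon n) ls -> leadp (flatten ls) (yw ls).
Proof.
elim: ls => [_|m ls IH /= /andP[lm hl]].
  by exists 0; [exact: spanm0|rewrite /yw big_nil monw_nil addr0].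
have [_ lx _ _] := rl_lybr lm; have [x' hx' ex] := lx.
have ly := IH hl; have [y' hy' ey] := ly.
exists (monw chi m * y' + x' * yw ls); last first.
  by rewrite yw_cons {1}ex mulrDl {1}ey mulrDr monw_cat addrA.
apply: spanmD.
  apply: (spanmM (A := QE m 0) _ _ hy') => [w1 w2|]; last first.
    by apply: spanm_monw; rewrite /QE wle_refl addn0 eqxx.
  rewrite /QE /QS !addn0 => /andP[h1 /eqP s1] /andP[h2 /eqP s2].
  rewrite !size_cat s1 s2 eqxx andbT; case/orP: h1 => [/eqP <-|h1]; first by rewrite wlt_cat2l.
  by apply/dltW/dlt_cat/wlt_dlt; rewrite ?s1.
apply: (spanmM _ hx' (leadp_QE ly)) => w1 w2.
rewrite /QE /QS !addn0 => /andP[h1 /eqP s1] /andP[h2 /eqP s2].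
rewrite !size_cat s1 s2 eqxx andbT.
by apply/dltW/dlt_cat/wlt_dlt; rewrite ?s1.
Qed.

Lemma pr_lead l R x : leadp l (lmon chi R) -> inUp x -> (forall w, wlt l w -> x w = 0) ->
  pr R x = x l.
Proof.
move=> [x' hx' e] hx h0; have [S [hS eS]] := hx'.
have -> : pr R x = pr ((1, l) :: S) x.
  by apply: pr_eq => //; rewrite e lmon_cons scale1r eS.
rewrite /pr big_cons mul1r -/(pr S x) (pr_spanm (A := QS l 0)) ?addr0 //.
  by rewrite -eS.
by move=> w /andP[h _]; exact: h0.
Qed.

Lemma dls_mul u v x y a : phom u x -> phom v y ->
  spn (fun f => exists b c : word n, (size b + size c)%N = size a /\ f = dls b x * dls c y)
    (dls a (x * y)).
Proof.
move=> hx hy; elim/last_ind: a => [|a k IH].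
  by rewrite dls_nil; apply: spn_gen; exists [::], [::]; rewrite !dls_nil.
rewrite dls_rcons size_rcons; apply: (spn_linear (phi := dl k) (dl_linear k) _ IH).
move=> _ [b [c [s ->]]]; rewrite dlM; have [t ->] := ch_dls (chi k) c hy.
rewrite -!dls_rcons -scalerAr; apply: spnD; [apply: spnZ|]; apply: spn_gen.
  by exists (rcons b k), c; rewrite size_rcons addSn s.
by exists b, (rcons c k); rewrite size_rcons addnS s.
Qed.

Lemma spanm_true x : inUp x -> spanm (fun _ => true) x.
Proof. by move=> [P ->]; exists P; split=> //; apply/allP. Qed.

Lemma dls_yw l ls a : all (@lyndon n) ls -> all (fun m => wlt l m) ls ->
  (size a < size (flatten ls))%N -> spanm (wlt l) (dls a (yw ls)).
Proof.
elim: ls a => [|m ls IH] a //= /andP[lm hl] /andP[hlm hls] sa.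
have [_ lx dx _] := rl_lybr lm.
rewrite yw_cons; have := dls_mul a (rl_phom (l := m)) (yw_phom (ls := ls)).
apply: spn_ind_sub; [exact: spanm0|by case: (@spanm_subsp _ _ chi (wlt l))|].
move=> _ [b [c [s ->]]]; case: (ltngtP (size b) (size m)) => sb.
- have h : spanm (wlt l) (dls b (rl m)).
    case: (eqVneq b [::]) => [->|bn].
      rewrite dls_nil; apply: spanm_sub (leadp_QE lx) => w /andP[h _].
      exact: wlt_le_trans hlm h.
    have := dx b; rewrite lt0n size_eq0 bn sb => /(_ isT); apply: spanm_sub => w /andP[h _].
    exact: wlt_trans hlm h.
  apply: (spanmM (B := fun _ => true) _ h) => [w1 w2 h1 _|]; first exact: wlt_catw.
  by apply: spanm_true; apply: inUp_dls; exact: yw_inUp.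
- by rewrite (dls_over (rl_phom (l := m)) sb) mul0r; exact: spanm0.
rewrite (dls_full (rl_phom (l := m)) sb) -scalerAl mul1r; apply: spanmZ; apply: IH => //.
by move: sa; rewrite -s sb size_cat ltn_add2l.
Qed.

Lemma rl_supp_yw ls : all (@lyndon n) ls -> sorted (@wge n) ls ->
  (forall m, m \in ls -> forall w, rl m w != 0 -> wle w m) ->
  forall w, yw ls w != 0 -> wle w (flatten ls).
Proof.
elim: ls => [|m ls IH] hl hs h w.
  by rewrite /yw big_nil; case: w => // k w; rewrite (_ : (1 : F) (k :: w) = 0) ?eqxx.
rewrite yw_cons => /shM_neq0[a [b [sh ha hb]]]; have /andP[lm hl'] := hl.
apply: (shuf_prod_le lm hl' hs _ _ _ sh).
- by apply: h => //; exact: mem_head.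
- exact: perm_size (rl_phom ha).
- apply: IH => //; first by move: hs => /= /path_sorted.
  by move=> k kls; apply: h; rewrite inE kls orbT.
Qed.

Lemma pr_rl0 l R x : lyndon l -> lmon chi R = rl l -> idl (@inUp n K chi) (Elow l) x -> pr R x = 0.
Proof.
move=> ll e; have [hp lx dx _] := rl_lybr ll.
apply: (pr_idl0 (v := l)); rewrite e // => a sa.
case: (eqVneq a [::]) => [->|an].
  by rewrite dls_nil; apply: spanm_sub (leadp_QE lx) => w /andP[].
have := dx a; rewrite lt0n size_eq0 an sa => /(_ isT); apply: spanm_sub => w /andP[h _].
exact: wltW.
Qed.

Lemma pr_yw0 l ls R x : all (@lyndon n) ls -> all (fun m => wlt l m) ls ->
  lmon chi R = yw ls -> idl (@inUp n K chi) (Elow l) x -> pr R x = 0.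
Proof.
move=> hl hls e; apply: (pr_idl0 (v := flatten ls)); rewrite e; first exact: yw_phom.
by move=> a sa; apply: spanm_sub (dls_yw hl hls sa) => w; exact: wltW.
Qed.

Lemma lyndon_simple l : lyndon l -> domin chi l -> exists al' k, Ch al' /\ al' k = wta al l.
Proof. by move=> ll /(lyndon_path hX hCh hal ll)[]. Qed.

(* dominant words l and z would give two vectors of weight |l| independent modulo the ideal *)
Lemma no_larger_dominant l z : lyndon l -> domin chi l -> domin chi z -> perm_eq z l ->
  all (fun m => wlt l m) (cfl z) -> False.
Proof.
move=> ll dl_ dz p hz; have [hl hs ez] := cfl_spec z.
have lz : wlt l z.
  rewrite -ez; case: (cfl z) hz ez => [|f fs] /= => [_ e|/andP[lf _] _].
    by have := perm_size p; rewrite -e => /esym/eqP; rewrite size_eq0 (negbTE (lyndon_ne ll)).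
  exact: wlt_catw.
have [_ h2] := lyndon_path hX hCh hal ll dl_.
have [u1 [i1 [n1 m1] p1]] := domin_phom dl_; have [u2 [i2 [n2 m2] p2]] := domin_phom dz.
have v1 : homw (wta al l) u1 := phom_hom p1.
have v2 : homw (wta al l) u2 by rewrite -(wta_perm al p); exact: phom_hom.
have [a1 [a2 [nz hI]]] := h2 _ _ i1 i2 v1 v2.
have [_ lx _ [R1 e1]] := rl_lybr ll; have [R2 e2] := yw_inUp hl.
have E1 := pr_rl0 ll (esym e1) hI; have E2 := pr_yw0 hl hz (esym e2) hI.
(* Both pairings kill the ideal and form a triangular matrix on [u1], [u2] with nonzero diagonal, so
   no nontrivial combination can lie in the ideal. *)
have q21 : pr R2 u1 = 0.
  rewrite (pr_lead (l := z)) //; last 1 first.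
  - move=> w zw; apply/eqP; case: eqP => // /eqP /m1 wl.
    by have := wlt_trans lz zw; rewrite -[wlt _ _]negbK -wleNgt wl.
  - by apply/eqP; case: eqP => // /eqP /m1; rewrite wleNgt lz.
  - by rewrite -e2 -{1}ez; exact: yw_lead.
have q22 : pr R2 u2 = u2 z.
  rewrite (pr_lead (l := z)) //; first by rewrite -e2 -{1}ez; exact: yw_lead.
  by move=> w zw; apply/eqP; case: eqP => // /eqP /m2; rewrite wleNgt zw.
have q11 : pr R1 u1 = u1 l.
  rewrite (pr_lead (l := l)) //; first by rewrite -e1.
  by move=> w lw; apply/eqP; case: eqP => // /eqP /m1; rewrite wleNgt lw.
have a20 : a2 = 0.
  move: E2; rewrite pr_linear -[a2 *: u2]addr0 pr_linear q21 q22 mulr0 add0r.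
  rewrite (_ : pr R2 0 = 0) ?addr0; last by rewrite /pr big1 // => q _; rewrite sh0E mulr0.
  by move/eqP; rewrite mulf_eq0 (negbTE n2) orbF => /eqP.
move: E1; rewrite a20 scale0r pr_linear q11 (_ : pr R1 0 = 0) ?addr0; last first.
  by rewrite /pr big1 // => q _; rewrite sh0E mulr0.
move/eqP; rewrite mulf_eq0 (negbTE n1) orbF => /eqP a10.
by move: nz; rewrite a10 a20 eqxx.
Qed.

(** Let [z] be the largest word of [rl l] and suppose [z > l]. If some factor of [z] is at most [l],
    so is the last one, [m], to which induction applies. Pairing [rl l] with the product of brackets
    for [z] gives its coefficient at [z], which is nonzero. By adjunction it also pairs [rl m],
    supported on words at most [m], with proper left derivatives of [rl l], spanned by monomials
    above [l]: this is zero. *)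
Lemma rl_supp l : lyndon l -> domin chi l -> forall w, rl l w != 0 -> wle w l.
Proof.
have [N] := ubnP (size l); elim: N l => // N IH l sl ll dl_ w0 hw0.
have [_ lx dx [R1 e1]] := rl_lybr ll.
have rn : rl l != 0 by apply: contra hw0 => /eqP ->; rewrite sh0E.
have [z hz] := maxat_exists (rl_phom (l := l)) rn.
apply: wle_trans (hz.2 _ hw0) _; rewrite wleNgt; apply/negP => lz.
have dz : domin chi z by apply: maxat_domin hz; rewrite e1; exists R1.
have pz : perm_eq z l := rl_phom hz.1.
have [hl hs ez] := cfl_spec z.
case: (boolP (all (fun m => wlt l m) (cfl z))) => [|]; first exact: no_larger_dominant dz pz.
rewrite -has_predC => /hasP[m0 m0z /= nm0].
have [R2 e2] := yw_inUp hl.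
have q : pr R2 (rl l) = rl l z.
  rewrite (pr_lead (l := z)) //; first by rewrite -e2 -{1}ez; exact: yw_lead.
    by rewrite e1; exists R1.
  by move=> w zw; apply/eqP; case: eqP => // /eqP /hz.2; rewrite wleNgt zw.
case/lastP E : (cfl z) m0z => [|ls m] // m0z.
rewrite E in hl hs ez e2.
have ml : wle m l.
  apply: wle_trans (sorted_wge_last hs m0z) _.
  by rewrite wleNgt.
have /andP[lm hl'] : lyndon m && all (@lyndon n) ls by rewrite -all_rcons.
move: ez; rewrite flatten_rcons => ez.
have lsn : flatten ls != [::].
  apply/eqP => e; move: lz; rewrite -ez e /= -[wlt _ _]negbK -wleNgt ml //.
have sz : size l = (size (flatten ls) + size m)%N by rewrite -(perm_size pz) -ez size_cat.
have ls0 : (0 < size (flatten ls))%N by rewrite lt0n size_eq0.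
have mp : (0 < size m)%N by rewrite lt0n size_eq0 lyndon_ne.
have dm : domin chi m by move: dz; rewrite -ez; exact: domin_catr.
have hm : forall w, rl m w != 0 -> wle w m.
  by apply: IH => //; rewrite -ltnS; apply: leq_trans sl; rewrite ltnS sz -add1n leq_add2r.
case/eqP: hz.1; rewrite -q e1 pr_sym -e2 yw_rcons.
have [_ _ _ [Q eQ]] := rl_lybr lm.
have := leadp_QE (yw_lead hl').
apply: (@spanm_ind _ _ chi _ (fun x => pr R1 (x * rl m) = 0)).
  split; first by rewrite mul0r /pr big1 // => p _; rewrite sh0E mulr0.
  by move=> a x y hx hy; rewrite mulrDl -scalerAl pr_linear hx hy mulr0 addr0.
move=> a; rewrite /QE addn0 => /andP[_ /eqP sa].
rewrite eQ pr_lmonM -e1; have := dx a; rewrite sa ls0 sz -[X in (X < _)%N]addn0 ltn_add2l mp.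
move=> /(_ isT) h; apply: (pr_sub0 h) => w /andP[lw _]; rewrite -eQ.
apply/eqP; case: eqP => // /eqP /hm wm; have := wlt_le_trans lw (wle_trans wm ml).
by rewrite wlt_irr.
Qed.

Lemma domin_factor w m : domin chi w -> m \in cfl w -> domin chi m.
Proof.
have [_ _ ew] := cfl_spec w; move=> dw /(nthP [::])[t st et].
have e : w = flatten (take t (cfl w)) ++ (m ++ flatten (drop t.+1 (cfl w))).
  by rewrite -{1}ew -{1}(cat_take_drop t (cfl w)) (drop_nth [::]) // et flatten_cat.
by move: dw; rewrite e => /domin_catr/(domin_catl chiC).
Qed.

(** The product is nonzero because it pairs nontrivially with an element whose largest word is [w].
    If its coefficient at [w] were zero, its largest word [z] would be dominant and below [w]. Its
    coefficient at [z] is its pairing with the product for [z], hence by symmetry the coefficient of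
    the latter at [w], which vanishes as that product is supported on words at most [z]. *)
Theorem yw_max w : domin chi w -> maxat (yw (cfl w)) w.
Proof.
have supp v : domin chi v -> forall u, yw (cfl v) u != 0 -> wle u v.
  move=> dv u; have [hl hs ev] := cfl_spec v; rewrite -{2}ev; apply: rl_supp_yw => // m mv.
  by apply: rl_supp; [exact: (allP hl)|exact: domin_factor mv].
move=> dw; split; last exact: supp.
have [hl hs ew] := cfl_spec w; apply/eqP => e0.
have [R eR] := yw_inUp hl; have [u hu [un um]] := dw.
have lw : leadp w (lmon chi R) by rewrite -eR -{1}ew; exact: yw_lead.
have yn : yw (cfl w) != 0.
  apply: contra un => /eqP e; rewrite -(pr_lead lw hu); last first.
    by move=> v wv; apply/eqP; case: eqP => // /eqP /um; rewrite wleNgt wv.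
  have -> : pr R u = pr [::] u by apply: pr_eq => //; rewrite -eR e lmon_nil.
  by rewrite /pr big_nil.
have [z hz] := maxat_exists (yw_phom (ls := cfl w)) yn.
have zw : wlt z w.
  have /orP[/eqP e|//] := supp _ dw _ hz.1; by move: hz.1; rewrite e e0 eqxx.
have dz : domin chi z by apply: maxat_domin hz; exact: yw_inUp.
have [hlz _ ez] := cfl_spec z; have [S eS] := yw_inUp hlz.
case/eqP: hz.1; rewrite -(pr_lead (R := S)) //.
- rewrite eR pr_sym -eS (pr_lead lw) //; last 1 first.
  + by move=> v wv; apply/eqP; case: eqP => // /eqP /(supp _ dz) vz;
      have := wlt_trans wv (wle_lt_trans vz zw); rewrite wlt_irr.
  + by apply/eqP; case: eqP => // /eqP /(supp _ dz); rewrite wleNgt zw.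
  + exact: yw_inUp.
- by rewrite -eS -{1}ez; exact: yw_lead.
- exact: yw_inUp.
- by move=> v zv; apply/eqP; case: eqP => // /eqP /hz.2; rewrite wleNgt zv.
Qed.

End Triangular.

(** * Formal sums as functions on words *)

Section Link.
Variables (n : nat) (D : datum n) (chi : 'I_n -> 'I_n -> Kq).
Hypothesis chiE : forall i j,
  chi i j = (if par D i && par D j then -1 else 1) * qq ^ (- gram D i j).
Hypothesis chiC : forall i j, chi i j = chi j i.
Hypothesis chi_neq0 : forall i j, chi i j != 0.
Local Notation F := (sh chi).
Implicit Types (i j k : 'I_n) (w a b u : word n) (s t : fsum n).

Definition sem s : F := coef s.

Lemma semE s : sem s = \sum_(p <- s) p.1 *: delta chi p.2.
Proof.
apply: shP => w; rewrite sh_sumE /sem /coef big_mkcond; apply: eq_bigr => p _.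
by rewrite shZE /delta eq_sym; case: eqP => _; rewrite ?mulr1 ?mulr0.
Qed.

Lemma sem_cat s t : sem (s ++ t) = sem s + sem t.
Proof. by rewrite !semE big_cat. Qed.

Lemma sem_scale c s : sem (scale c s) = c *: sem s.
Proof.
by rewrite !semE big_map scaler_sumr; apply: eq_bigr => p _; rewrite scalerA.
Qed.

Lemma delta_nil : delta chi [::] = 1.
Proof. by apply: shP => -[|k w]. Qed.

Lemma sem_one : sem (Defs.one n) = 1.
Proof. by rewrite semE big_seq1 scale1r delta_nil. Qed.

Lemma sem_letter i : sem (letter i) = letr chi i.
Proof. by rewrite semE big_seq1 scale1r. Qed.

Lemma sem_flatten (T : Type) (r : seq T) (f : T -> fsum n) :
  sem (flatten [seq f x | x <- r]) = \sum_(x <- r) sem (f x).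
Proof.
elim: r => [|x r IH]; first by rewrite big_nil semE big_nil.
by rewrite /= sem_cat big_cons IH.
Qed.

Lemma sh_eq_dr (x y : F) : x [::] = y [::] -> (forall k, dr k x = dr k y) -> x = y.
Proof.
move=> h0 h; apply: shP => w; case/lastP: w => [//|w k].
by rewrite -[x _]/(dr k x w) -[y _]/(dr k y w) h.
Qed.

Lemma dr_delta k w i : dr k (delta chi (rcons w i)) = (k == i)%:R *: delta chi w.
Proof.
apply: shP => a; rewrite /dr /delta shZE eqseq_rcons andbC.
by case: (k == i) => /=; rewrite ?mul1r ?mul0r.
Qed.

Lemma delta0 w i : delta chi (rcons w i) [::] = 0.
Proof. by case: w. Qed.

Lemma sem_app_dr k i s : dr k (sem (app i s)) = (k == i)%:R *: sem s.
Proof.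
rewrite !semE big_map linear_sum scaler_sumr; apply: eq_bigr => p _ /=.
by rewrite linearZ /= dr_delta !scalerA mulrC.
Qed.

Lemma sem_app0 i s : sem (app i s) [::] = 0.
Proof. by rewrite semE big_map sh_sumE big1 // => p _; rewrite shZE delta0 mulr0. Qed.

Definition cf (v : Kq) w j : Kq :=
  (if wpar D w && par D j then -1 else 1) * v ^ (- wform D w j).

Lemma shr_cons v i j a b : shr D v (i :: a) (j :: b) =
  app i (shr D v a (j :: b)) ++ scale (cf v (rev (i :: a)) j) (app j (shr D v (i :: a) b)).
Proof. by []. Qed.

(** A family indexed by two words is determined by its boundary values and right derivatives. This
    identifies [shr] for [qq] and for its inverse with products of [delta] functions. *)
Lemma shr_unique v (g : word n -> word n -> F) :
  (forall b, g [::] b = delta chi b) -> (forall a, g a [::] = delta chi a) ->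
  (forall a i b j, g (rcons a i) (rcons b j) [::] = 0) ->
  (forall a i b j k, dr k (g (rcons a i) (rcons b j)) =
     (k == i)%:R *: g a (rcons b j) + (k == j)%:R * cf v (rcons a i) j *: g (rcons a i) b) ->
  forall a b, sem (shr D v (rev a) (rev b)) = g a b.
Proof.
move=> g0l g0r g0 gd; elim/last_ind => [|a i IHa] b.
  by rewrite /= revK semE big_seq1 scale1r g0l.
elim/last_ind: b => [|b j IHb].
  by rewrite rev_rcons /= -rev_rcons revK semE big_seq1 scale1r g0r.
rewrite !rev_rcons shr_cons -!rev_rcons sem_cat sem_scale !revK.
apply: sh_eq_dr => [|k].
  by rewrite g0 shDE shZE !sem_app0 mulr0 addr0.
rewrite gd linearD linearZ /= !sem_app_dr IHa; congr (_ + _).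
by rewrite scalerA IHb mulrC.
Qed.

Lemma cf_qq w j : cf qq w j = \prod_(a <- w) chi a j.
Proof.
rewrite /cf; elim: w => [|a w IH].
  by rewrite /wform !big_nil /wpar /= mul1r oppr0 expr0z.
have q0 : qq != 0 by rewrite /qq tofrac_eq0 polyX_eq0.
rewrite big_cons -IH /wform big_cons opprD expfzDr // chiE /wpar /= oddD.
rewrite oddb; move: (qq ^ _) (qq ^ _) => A B.
by case: (par D a); case: (odd _); case: (par D j) => /=; ring.
Qed.

Lemma cf_qqV w j : cf qq^-1 w j = (\prod_(a <- w) chi a j)^-1.
Proof.
rewrite -cf_qq /cf invfM exprz_inv invr_expz; congr (_ * _).
by case: ifP => _; rewrite ?invrN invr1.
Qed.

Lemma ch_delta f w : ch f (delta chi w) = (\prod_(a <- w) f a) *: delta chi w.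
Proof. by apply: phom_ch; exact: phom_delta. Qed.

Lemma sem_shr a b : sem (shr D qq (rev a) (rev b)) = delta chi a * delta chi b.
Proof.
apply: (shr_unique (g := fun a b => delta chi a * delta chi b)) => {a b}.
- by move=> b; rewrite delta_nil mul1r.
- by move=> a; rewrite delta_nil mulr1.
- by move=> a i b j; rewrite shM0E delta0 mul0r.
move=> a i b j k; rewrite (drM chiC) !dr_delta -scalerAl -scalerAr ch_delta -scalerAl scalerA.
congr (_ + _ *: _); case: eqP => [->|_]; rewrite ?mul0r // !mul1r cf_qq.
by apply: eq_bigr => c _; rewrite chiC.
Qed.

Definition cross a b : Kq := \prod_(d <- b) \prod_(c <- a) chi c d.

Lemma cross_rconsl a i b : cross (rcons a i) b = cross a b * \prod_(d <- b) chi i d.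
Proof.
by rewrite /cross -big_split /=; apply: eq_bigr => d _; rewrite -cats1 big_cat big_seq1.
Qed.

Lemma cross_rconsr a b j : cross a (rcons b j) = cross a b * \prod_(c <- a) chi c j.
Proof. by rewrite /cross -cats1 big_cat big_seq1. Qed.

Lemma prod_chi_neq0 a (f : 'I_n -> Kq) : (forall c, f c != 0) -> \prod_(c <- a) f c != 0.
Proof. by move=> h; rewrite prodf_seq_neq0; apply/allP => c _; exact: h. Qed.

(** Inverting [chi] on the pairs with the letter of [a] in front amounts to dividing by the factors
    of all pairs and keeping those with the letter of [b] in front, as in the product taken in the
    other order. *)
Lemma sem_shrV a b : sem (shr D qq^-1 (rev a) (rev b)) =
  (cross a b)^-1 *: (delta chi b * delta chi a).
Proof.
apply: (shr_unique (g := fun a b => (cross a b)^-1 *: (delta chi b * delta chi a))) => {a b}.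
- move=> b; rewrite delta_nil mulr1 /cross big1 ?invr1 ?scale1r // => d _.
  by rewrite big_nil.
- by move=> a; rewrite delta_nil mul1r /cross big_nil invr1 scale1r.
- by move=> a i b j; rewrite shZE shM0E delta0 mul0r mulr0.
move=> a i b j k; rewrite linearZ /= (drM chiC) !dr_delta -scalerAl -scalerAr ch_delta -scalerAl.
rewrite !scalerDr !scalerA addrC; congr (_ *: _ + _ *: _).
  case: eqP => [->|_]; rewrite ?mulr0 ?mul0r // ?mul1r.
  rewrite cross_rconsl invfM mulr1 divfK //.
  by apply: prod_chi_neq0 => c; exact: chi_neq0.
case: (k == j); rewrite ?mulr0 ?mul0r // mulr1 mul1r.
by rewrite cross_rconsr invfM mulrC cf_qqV.
Qed.

Lemma sem_diamond v (g : word n -> word n -> F) s t :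
  (forall a b, sem (shr D v (rev a) (rev b)) = g a b) ->
  sem (diamond D v s t) = \sum_(p <- s) \sum_(r <- t) (p.1 * r.1) *: g p.2 r.2.
Proof.
move=> h; rewrite /diamond; elim: s => [|p s IH]; first by rewrite semE !big_nil.
rewrite /= flatten_cat sem_cat IH big_cons sem_flatten; congr (_ + _).
by apply: eq_bigr => r _; rewrite sem_scale h.
Qed.

Lemma sem_star s t : sem (star D s t) = sem s * sem t.
Proof.
rewrite /star (sem_diamond _ _ sem_shr) !semE mulr_suml; apply: eq_bigr => p _.
by rewrite mulr_sumr; apply: eq_bigr => r _; rewrite -scalerAl -scalerAr scalerA.
Qed.

Definition hlist u s := all (fun p : Kq * word n => perm_eq p.2 u) s.

Lemma hlist_shr v a b : hlist (a ++ b) (shr D v a b).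
Proof.
elim: a b => [|i a IHa] b; first by rewrite /hlist /= andbT perm_rev.
elim: b => [|j b IHb]; first by rewrite /hlist /= andbT cats0 perm_rev.
rewrite /= /hlist all_cat; apply/andP; split.
  rewrite all_map; apply/allP => p /(allP (IHa _)) /= h.
  by rewrite -cats1 perm_catC /= perm_cons.
rewrite !all_map; apply/allP => p /(allP IHb) /= h.
by rewrite -cats1 perm_catC -[_ :: (_ ++ _)]/((i :: a) ++ [:: j] ++ b) -[X in perm_eq X]/([:: j] ++ p.2)
  perm_sym perm_catCA perm_cat2l perm_sym.
Qed.

Lemma hlist_diamond v a b s t : hlist a s -> hlist b t -> hlist (a ++ b) (diamond D v s t).
Proof.
move=> hs ht; apply/allP => p /flattenP[x /allpairsP[[p1 p2] [/(allP hs) h1 /(allP ht) h2 ->]]] /=.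
case/mapP => r /(allP (hlist_shr _ _ _)) h -> /=; apply: perm_trans h _.
by apply: perm_cat; rewrite perm_rev.
Qed.

Lemma sem_starqq u s t : hlist u s -> sem (starqq D s t) = brk u (sem s) (sem t).
Proof.
move=> hs; rewrite /starqq sem_cat sem_scale scaleN1r -/(star D s t) sem_star /brk; congr (_ - _).
rewrite (sem_diamond _ _ sem_shrV) exchange_big /= [X in ch _ X]semE linear_sum mulr_suml.
apply: eq_bigr => r _; rewrite [in RHS]semE mulr_sumr big_seq [in RHS]big_seq.
apply: eq_bigr => p ps; rewrite [in RHS]linearZ /= ch_delta -!scalerAl -scalerAr !scalerA.
congr (_ *: _); rewrite [RHS]mulrC mulrA; congr (_ * _).
rewrite /cross -prodfV; apply: eq_bigr => d _; rewrite /iw; congr (_^-1).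
exact/perm_big/(allP hs).
Qed.

Lemma hlist_rLf f w : hlist w (rLf D f w).
Proof.
elim: f w => [|f IH] w //=; case: ifP => _; first by rewrite /hlist /= perm_refl.
rewrite -{1}(cat_take_drop (costd w) w) /starqq /hlist all_cat; apply/andP; split.
  by apply: hlist_diamond; exact: IH.
by rewrite all_map; apply: hlist_diamond; exact: IH.
Qed.

Lemma sem_rL w : sem (rL D w) = rlf chi (size w) w.
Proof.
rewrite /rL; elim: (size w) {2 4}w => [|f IH] v.
  by apply: shP => u; rewrite /sem /coef big_nil.
rewrite /=; case: ifP => _; first by rewrite semE big_seq1 scale1r.
by rewrite (sem_starqq _ (hlist_rLf _ _)) !IH.
Qed.

Lemma sem_prodl (r : seq (fsum n)) : sem (prodl D r) = \prod_(s <- r) sem s.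
Proof.
elim: r => [|s r IH]; first by rewrite big_nil sem_one.
case: r IH => [|s' r] IH; first by rewrite big_seq1.
by rewrite big_cons -IH [prodl _ _]/(star D s (prodl D (s' :: r))) sem_star.
Qed.

Lemma sem_mon w : sem (mon D w) = monw chi w.
Proof. by rewrite /mon sem_prodl big_map; apply: eq_bigr => i _; exact: sem_letter. Qed.

Lemma sem_inU s : inU D s -> inUp (sem s).
Proof.
case=> r hr; exists r; rewrite /lmon.
have -> : sem s = sem (flatten [seq scale p.1 (mon D p.2) | p <- r]) by apply: shP.
by rewrite sem_flatten; apply: eq_bigr => p _; rewrite sem_scale sem_mon.
Qed.

Lemma dominant_domin w : dominant D w -> domin chi w.
Proof. by case=> s [/sem_inU hs [h1 h2]]; exists (sem s). Qed.

Lemma ismax_maxat s w : maxat (sem s) w -> ismax s w.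
Proof. by case. Qed.

End Link.

(** * The bar map and the PBW vectors *)

Lemma mulr1_invf (K : fieldType) (a b : K) : a * b = 1 -> a = b^-1.
Proof.
move=> e; have b0 : b != 0 by apply/eqP => b0; move/eqP: e; rewrite b0 mulr0 eq_sym oner_eq0.
by rewrite -[RHS]mul1r -e mulfK.
Qed.

Section Bar.
Local Notation tofrac := (@FracField.tofrac {poly rat}).

Lemma fraction_repr (x : Kq) : let r := generic_quotient.repr x in
  (frac r).2 != 0 /\ x * tofrac (frac r).2 = tofrac (frac r).1.
Proof.
move=> r; have d0 := denom_ratioP r; split=> //.
rewrite -[x]generic_quotient.reprK -/r.
unlock FracField.tofrac; rewrite -[LHS]FracField.pi_mul; apply/generic_quotient.eqmodP.
rewrite /= FracField.equivfE /FracField.mulf !numden_Ratio ?mulf_neq0 ?oner_neq0 //.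
by rewrite !mulr1 mulrC.
Qed.

Lemma qqX_neq k : (0 < k)%N -> qq ^+ k != 1 /\ qq ^+ k != -1.
Proof.
move=> k0; have H (c : rat) : qq ^+ k != tofrac c%:P.
  rewrite /qq -tofracXn; apply/eqP => /(congr1 (fun z => z - tofrac c%:P)).
  rewrite subrr -tofracB => /eqP; rewrite tofrac_eq0 subr_eq0 => /eqP /(congr1 (fun p : {poly rat} => size p)).
  rewrite size_polyXn => /eqP; rewrite eqn_leq => /andP[h _].
  by move: (leq_trans h (size_polyC_leq1 c)); rewrite ltnS leqNgt k0.
split; first by have := H 1; rewrite tofrac1.
by have := H (-1); rewrite polyCN tofracN tofrac1.
Qed.

Lemma qq_neq0 : qq != 0.
Proof. by rewrite /qq tofrac_eq0 polyX_eq0. Qed.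

Definition rat_Kq : rat -> Kq := tofrac \o polyC.
HB.instance Definition _ := GRing.RMorphism.on rat_Kq.

Lemma ratr_Kq (a : rat) : ratr a = rat_Kq a.
Proof. by rewrite (fmorph_eq_rat rat_Kq). Qed.

Lemma evKE c p : evK c p = (map_poly rat_Kq p).[c].
Proof. by rewrite /evK (eq_map_poly ratr_Kq). Qed.

Lemma evKD c p r : evK c (p + r) = evK c p + evK c r.
Proof. by rewrite !evKE rmorphD hornerD. Qed.
Lemma evKM c p r : evK c (p * r) = evK c p * evK c r.
Proof. by rewrite !evKE rmorphM hornerM. Qed.

Lemma evK_qq p : evK qq p = tofrac p.
Proof.
rewrite evKE /rat_Kq map_poly_comp /= horner_map; congr tofrac.
by rewrite -[RHS]comp_polyXr /comp_poly.
Qed.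

(** The evaluation point is transcendental over the rationals, since otherwise [qq] would be
    algebraic. Hence no denominator vanishes under the bar map. *)
Lemma evK_eq0 bp p : evK ((if bp then -1 else 1) * qq^-1) p = 0 -> p = 0.
Proof.
move=> h; apply/eqP/negPn/negP => pn.
have : algebraicOver rat_Kq qq.
  have a1 : algebraicOver rat_Kq ((if bp then -1 else 1) * qq^-1).
    by exists p => //; rewrite /root -evKE h.
  have a2 : algebraicOver rat_Kq (qq^-1).
    case: bp h a1 => h; last by rewrite mul1r => a1; exact: a1.
    by rewrite mulN1r => a1; have := algebraic_opp a1; rewrite opprK => a3; exact: a3.
  by have := algebraic_inv a2; rewrite invrK => a3; exact: a3.
case=> r rn; rewrite /root -evKE evK_qq tofrac_eq0 => /eqP r0.
by rewrite r0 eqxx in rn.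
Qed.

Variable bp : bool.
Local Notation c := ((if bp then -1 else 1) * qq^-1).
Local Notation phi := (barK bp).

(** Independence of the representative used in [barK]; the field morphism laws then reduce to
    arithmetic of fractions. *)
Lemma barK_frac (p r : {poly rat}) : r != 0 -> phi (tofrac p / tofrac r) = evK c p / evK c r.
Proof.
move=> rn; set x := _ / _; rewrite /barK; have [] := fraction_repr x.
case: (generic_quotient.repr x) => -[p' r'] /= rn' rn2 e.
have E : p * r' = p' * r.
  apply/eqP; rewrite -subr_eq0 -tofrac_eq0 tofracB !tofracM -e /x subr_eq0.
  by rewrite mulrAC divfK // tofrac_eq0.
have z t : t != 0 -> evK c t != 0 by apply: contra => /eqP /evK_eq0 ->.
apply: (mulIf (z _ rn)); rewrite divfK ?z //; apply: (mulIf (z _ rn2)).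
by rewrite mulrAC divfK ?z // -!evKM E.
Qed.

Lemma tofrac_frac (x : Kq) : exists p r, r != 0 /\ x = tofrac p / tofrac r.
Proof.
have [h1 h2] := fraction_repr x; exists (frac (generic_quotient.repr x)).1, (frac (generic_quotient.repr x)).2; split=> //.
by rewrite -h2 mulfK // tofrac_eq0.
Qed.

Lemma barK_tofrac p : phi (tofrac p) = evK c p.
Proof.
rewrite -[tofrac p]divr1 -tofrac1 barK_frac ?oner_neq0 //.
by rewrite [evK c 1]evKE rmorph1 hornerC divr1.
Qed.

Lemma barKD x y : phi (x + y) = phi x + phi y.
Proof.
have [p [r [rn ->]]] := tofrac_frac x; have [p' [r' [rn' ->]]] := tofrac_frac y.
have z t : t != 0 -> evK c t != 0 by apply: contra => /eqP /evK_eq0 ->.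
rewrite addf_div ?tofrac_eq0 // -!tofracM -tofracD !barK_frac ?mulf_neq0 //.
by rewrite evKD !evKM addf_div ?z.
Qed.

Lemma barKM x y : phi (x * y) = phi x * phi y.
Proof.
have [p [r [rn ->]]] := tofrac_frac x; have [p' [r' [rn' ->]]] := tofrac_frac y.
rewrite mulf_div -!tofracM !barK_frac ?mulf_neq0 //.
by rewrite !evKM mulf_div.
Qed.

Lemma barK1 : phi 1 = 1.
Proof. by rewrite -tofrac1 barK_tofrac evKE rmorph1 hornerC. Qed.

Lemma barK0 : phi 0 = 0.
Proof. by rewrite -tofrac0 barK_tofrac evKE rmorph0 horner0. Qed.

Lemma barKN x : phi (- x) = - phi x.
Proof. by apply/eqP; rewrite -subr_eq0 opprK -barKD addNr barK0. Qed.

Lemma barK_eq0 x : (phi x == 0) = (x == 0).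
Proof.
case: (eqVneq x 0) => [->|xn]; first by rewrite barK0 eqxx.
apply/negbTE/eqP => e; have := barKM x x^-1; rewrite divff // barK1 e mul0r => /eqP.
by rewrite oner_eq0.
Qed.

Lemma barKV x : phi x^-1 = (phi x)^-1.
Proof.
case: (eqVneq x 0) => [->|xn]; first by rewrite invr0 barK0 invr0.
by apply: mulr1_invf; rewrite -barKM mulVf // barK1.
Qed.

Lemma barK_qq : phi qq = c.
Proof. by rewrite /qq barK_tofrac evKE map_polyX hornerX. Qed.

Lemma barKXn x k : phi (x ^+ k) = phi x ^+ k.
Proof. by elim: k => [|k IH]; rewrite ?barK1 // !exprS barKM IH. Qed.

Lemma barKXz x (z : int) : phi (x ^ z) = phi x ^ z.
Proof. by case: z => k; rewrite ?NegzE -?invr_expz ?barKV barKXn. Qed.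

End Bar.

(** * Sigma as a semilinear antiautomorphism *)

Section Sigma.
Variables (n : nat) (K : fieldType) (chi : 'I_n -> 'I_n -> K) (phi : K -> K).
Hypotheses (phiD : {morph phi : x y / x + y}) (phiM : {morph phi : x y / x * y}).
Hypotheses (phi1 : phi 1 = 1) (phi_eq0 : forall x, (phi x == 0) = (x == 0)).
Hypothesis chiC : forall i j, chi i j = chi j i.
Hypothesis chi_neq0 : forall i j, chi i j != 0.
Hypothesis phi_chi : forall i j, phi (chi i j) = (chi i j)^-1.
Local Notation F := (sh chi).
Implicit Types (i j k : 'I_n) (w a b : word n) (x y : F).

Fixpoint pairchi w : K :=
  if w is a :: w' then (\prod_(b <- w') chi a b) * pairchi w' else 1.

Lemma pairchi_rcons w k : pairchi (rcons w k) = pairchi w * \prod_(b <- w) chi b k.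
Proof.
elim: w => [|a w IH] /=; first by rewrite !big_nil mul1r.
rewrite IH big_cons -cats1 big_cat big_seq1 /=; ring.
Qed.

Lemma pairchi_neq0 w : pairchi w != 0.
Proof.
elim: w => [|a w IH]; first exact: oner_neq0.
by rewrite /= mulf_neq0 // prodf_seq_neq0; apply/allP => b _; exact: chi_neq0.
Qed.

(** Words are reversed once by tau and once by the bar map, so supports do not move; what remains is
    [phi] on coefficients and the bar factor of the reversed word. *)
Definition Sg x : F := fun w => phi (x w) * pairchi (rev w).

Lemma phi_prod (I : Type) (r : seq I) (f : I -> K) : phi (\prod_(i <- r) f i) = \prod_(i <- r) phi (f i).
Proof. exact: (big_morph phi phiM phi1). Qed.

Lemma dl_Sg k x : dl k (Sg x) = ch (chi k) (Sg (dl k x)).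
Proof.
apply: shP => w; rewrite /dl /ch /Sg rev_cons pairchi_rcons.
rewrite (perm_big w) /=; last by rewrite perm_rev.
by rewrite (eq_bigr (chi k)) => [|a _]; [ring|exact: chiC].
Qed.

Lemma Sg_ch f x : Sg (ch f x) = ch (fun c => phi (f c)) (Sg x).
Proof. by apply: shP => w; rewrite /Sg /ch phiM phi_prod mulrA. Qed.

Lemma SgD x y : Sg (x + y) = Sg x + Sg y.
Proof. by apply: shP => w; rewrite shDE /Sg shDE phiD mulrDl. Qed.

Lemma chK k x : ch (chi k) (ch (fun c => phi (chi k c)) x) = x.
Proof.
apply: shP => w; rewrite /ch mulrA -big_split /= big1 ?mul1r // => a _.
by rewrite phi_chi mulfV.
Qed.

(** Compared through left derivatives: [dl k] of an image is a twisted image of [dl k], and because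
    [phi] inverts [chi], the twist passes from one factor to the other as the order is reversed. *)
Lemma SgM x y : Sg (x * y) = Sg y * Sg x.
Proof.
apply: shP => w; elim: w x y => [|k w IH] x y.
  by rewrite shM0E /Sg shM0E phiM /= !mulr1 mulrC.
have H (A B : F) : ch (chi k) (A * B) w = (ch (chi k) A * ch (chi k) B) w by rewrite chM.
transitivity (dl k (Sg (x * y)) w) => //.
transitivity (dl k (Sg y * Sg x) w) => //.
rewrite dl_Sg !dlM SgD linearD /= !shDE !dl_Sg addrC; congr (_ + _).
  by rewrite -H /ch IH.
by rewrite -(chK k (Sg y)) -H -Sg_ch /ch IH.
Qed.

Lemma Sg1 : Sg 1 = 1.
Proof.
apply: shP => -[|k w]; first by rewrite /Sg phi1 mulr1.
rewrite /Sg (_ : (1 : F) (k :: w) = 0) //.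
by have /eqP -> : phi 0 == 0; rewrite ?phi_eq0 // mul0r.
Qed.

Lemma Sg_prod (T : Type) (r : seq T) (f : T -> F) :
  \prod_(t <- rev r) Sg (f t) = Sg (\prod_(t <- r) f t).
Proof.
elim: r => [|t r IH]; first by rewrite !big_nil Sg1.
by rewrite rev_cons -cats1 big_cat big_seq1 /= IH big_cons SgM.
Qed.

Lemma Sg_maxat x w : maxat x w -> maxat (Sg x) w.
Proof.
have h v : (Sg x v != 0) = (x v != 0).
  by rewrite /Sg mulf_eq0 phi_eq0 (negbTE (pairchi_neq0 _)) orbF.
by case=> h0 h1; split=> [|v]; rewrite h //; exact: h1.
Qed.

End Sigma.

Lemma grp_mem n (ls : seq (word n)) g : g \in grp ls -> g.1 \in ls.
Proof.
elim: ls g => [|l ls IH] g //=; case: (grp ls) IH => [|[l' k] G] IH.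
  by rewrite inE => /eqP -> /=; rewrite mem_head.
case: eqP => [e|_]; rewrite !inE.
  case/orP => [/eqP -> /=|h]; first by rewrite eqxx.
  by rewrite IH ?orbT // inE h orbT.
case/or3P => [/eqP -> /=|/eqP ->|h]; first by rewrite eqxx.
  by rewrite (IH (l', k)) ?orbT // mem_head.
by rewrite IH ?orbT // inE h orbT.
Qed.

Lemma grp_prod n (A : nzRingType) (ls : seq (word n)) (y : word n -> A) :
  \prod_(g <- rev (grp ls)) y g.1 ^+ g.2 = \prod_(l <- rev ls) y l.
Proof.
elim: ls => [|l ls IH]; first by rewrite /rev /= !big_nil.
rewrite rev_cons -[in RHS]cats1 big_cat big_seq1 /= -IH.
case: (grp ls) => [|[l' k] G]; first by rewrite /rev /= big_seq1 big_nil mul1r.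
case: eqP => [->|_].
  by rewrite !rev_cons -!cats1 !big_cat !big_seq1 /= exprSr mulrA.
by rewrite [in LHS]rev_cons -[in LHS]cats1 big_cat big_seq1.
Qed.

Section Scalars.

Lemma qq_diff_neq0 (s : Kq) k : s * s = 1 -> s = 1 \/ s = -1 -> (0 < k)%N -> s * qq ^+ k - qq ^- k != 0.
Proof.
move=> ss hs k0; rewrite subr_eq0; apply/eqP => e.
have qk : qq ^+ k != 0 by rewrite expf_neq0 // qq_neq0.
have e2 : qq ^+ (k + k) = s.
  have : s * (s * qq ^+ k * qq ^+ k) = s by rewrite e mulVf // mulr1.
  by rewrite -mulrA -exprD mulrA ss mul1r.
have [h1 h2] := qqX_neq (k := (k + k)%N) (ltn_addl _ k0).
by case: hs => hs; move: h1 h2; rewrite e2 hs eqxx.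
Qed.

Lemma qnum_neq0 o d m : (0 < d)%N -> (0 < m)%N -> qnum o d m != 0.
Proof.
move=> d0 m0; have dm : (0 < d * m)%N by rewrite muln_gt0 d0.
have h1 k : (0 < k)%N -> qq ^+ k - qq ^- k != 0.
  by move=> k0; have := @qq_diff_neq0 1 k (mulr1 _) (or_introl erefl) k0; rewrite mul1r.
have h2 k : (0 < k)%N -> - qq ^+ k - qq ^- k != 0.
  move=> k0; have e : (-1) * (-1) = 1 :> Kq by rewrite mulrNN mulr1.
  by have := @qq_diff_neq0 (-1) k e (or_intror erefl) k0; rewrite mulN1r.
rewrite /qnum; case: o; rewrite mulf_neq0 ?invr_eq0 ?h1 ?h2 //.
rewrite -signr_odd; case: (odd m); rewrite ?expr1 ?expr0 ?mulN1r ?mul1r; first exact: h2.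
exact: h1.
Qed.

End Scalars.

Section Reduction.
Variables (n : nat) (D : datum n) (Lam : zmodType) (X : Lam -> Lam -> Kq).
Hypothesis hX : bichar X.
Variables (Ch : ('I_n -> Lam) -> Prop) (Phi : seq Lam) (al : 'I_n -> Lam).
Hypotheses (hCh : groupoid X Ch Phi) (hal : Ch al).
Hypothesis hchi : forall i j,
  X (al i) (al j) = (if par D i && par D j then -1 else 1) * qq ^ (- gram D i j).
Hypothesis hbar : barpi D -> forall i j, exists z, gram D i j = z * 2.
Hypothesis hnorm : forall l al' k, Ch al' -> al' k = wta al l -> (0 < dbeta D (wt l))%N.
Local Notation chi := (chiX X al).
Local Notation F := (sh chi).
Implicit Types (l w : word n) (i j k : 'I_n).

Let chiC : forall i j, chi i j = chi j i. Proof. exact: chiXC. Qed.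
Let chin : forall i j, chi i j != 0. Proof. exact: chiX_neq0. Qed.
Let phi := barK (barpi D).
Let phiD : {morph phi : x y / x + y} := barKD (barpi D).
Let phiM : {morph phi : x y / x * y} := barKM (barpi D).
Let phi1 : phi 1 = 1 := barK1 (barpi D).
Let phi_eq0 : forall x, (phi x == 0) = (x == 0) := barK_eq0 (barpi D).

Lemma phi_chi i j : phi (chi i j) = (chi i j)^-1.
Proof.
have s1 (b : bool) : phi (if b then -1 else 1) = (if b then -1 else 1).
  by case: b; rewrite /phi ?barKN barK1.
have s2 (b : bool) : (if b then -1 else 1 : Kq)^-1 = if b then -1 else 1.
  by case: b; rewrite ?invrN invr1.
rewrite /chiX hchi invfM s2 /phi barKM -/phi s1; congr (_ * _).
rewrite /phi barKXz barK_qq; case E : (barpi D); last first.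
  by rewrite mul1r exprz_inv invr_expz.
(* In this case [phi] sends [qq] to minus its inverse; the exponent is even, so the sign
   disappears. *)
have [z ->] := hbar E i j.
have m1 : (-1 : Kq) ^ (- (z * 2)) = 1.
  by rewrite -mulNr mulrC -exprz_exp -exprnP sqrrN expr1n exp1rz.
by rewrite expfzMl m1 mul1r exprz_inv invr_expz.
Qed.

Lemma qnb_neq0 l m : lyndon l -> domin chi l -> (0 < m)%N -> qnb D (wt l) m != 0.
Proof.
move=> ll dl_ m0; rewrite /qnb qnum_neq0 //.
by have [al' [k [h1 h2]]] := lyndon_simple hX hCh hal ll dl_; exact: hnorm h1 h2.
Qed.

Lemma qfact_neq0 l m : lyndon l -> domin chi l -> qfact D (wt l) m != 0.
Proof.
move=> ll dl_; rewrite /qfact prodf_seq_neq0; apply/allP => k.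
by rewrite mem_index_iota => /andP[k0 _] /=; exact: qnb_neq0.
Qed.

Lemma kap_neq0 l : lyndon l -> domin chi l -> kap D l != 0.
Proof.
rewrite /kap; move: (size l) => f; elim: f l => [|f IH] u lu du /=; first exact: oner_neq0.
case: leqP => s1; first exact: oner_neq0.
have [l1 l2 _] := costdP s1 lu.
have d1 : domin chi (take (costd u) u).
  by apply: (@domin_catl _ _ _ chiC _ (drop (costd u) u)); rewrite cat_take_drop.
have d2 : domin chi (drop (costd u) u).
  by apply: (@domin_catr _ _ _ (take (costd u) u)); rewrite cat_take_drop.
rewrite !mulf_neq0 ?IH //.
by case: ifP => _; exact: qnb_neq0.
Qed.

Lemma sem_sigmaF s : sem chi (sigmaF D s) = Sg phi (sem chi s).
Proof.
apply: shP => w; rewrite /Sg /sem /coef /sigmaF /barF /tauF -map_comp big_map /=.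
under eq_bigl => p do rewrite revK.
have phi0 : phi 0 = 0 by rewrite /phi barK0.
rewrite (big_morph phi (barKD (barpi D)) phi0) mulr_suml; apply: eq_bigr => p /eqP ->.
congr (_ * _); elim: (rev w) => [|a v IH].
  by rewrite /= expr0 oppr0 expr0z mulr1.
rewrite /= -IH exprD opprD expfzDr ?qq_neq0 //.
have -> : \prod_(b <- v) chi a b =
   (-1) ^+ (if par D a then count (par D) v else 0) * qq ^ (- (\sum_(b <- v) gram D a b)).
  elim: v {IH} => [|b v IHv]; first by rewrite !big_nil /= if_same expr0 oppr0 expr0z mulr1.
  rewrite !big_cons IHv /chiX hchi opprD expfzDr ?qq_neq0 //=.
  case: (par D a); last by rewrite !expr0 /= !mul1r.
  by case: (par D b); rewrite /= ?exprD ?expr1 ?add0n ?mul1r; ring.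
ring.
Qed.

Lemma sem_EL l : sem chi (EL D l) = (kap D l)^-1 *: Sg phi (rl X al l).
Proof. by rewrite /EL sem_scale sem_sigmaF (sem_rL hchi chiC chin). Qed.

Lemma sem_Edp l m : sem chi (Edp D l m) =
  ((qfact D (wt l) m)^-1 * (kap D l)^-1 ^+ m) *: Sg phi (rl X al l) ^+ m.
Proof.
rewrite /Edp sem_scale (sem_prodl hchi chiC).
have -> : \prod_(s <- nseq m (EL D l)) sem chi s = sem chi (EL D l) ^+ m.
  by elim: m => [|m IH]; rewrite /= ?big_nil ?expr0 // big_cons IH exprS.
by rewrite sem_EL exprZn scalerA.
Qed.

(** The product defining [EW] runs in the opposite order to that of [rW], which is what the
    antiautomorphism produces; the normalising scalars are gathered in [c]. *)
Lemma sem_EW w : exists2 c : Kq, (all (@lyndon n) (cfl w) -> (forall l, l \in cfl w -> domin chi l) -> c != 0) &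
  sem chi (EW D w) = c *: Sg phi (yw X al (cfl w)).
Proof.
rewrite /EW (sem_prodl hchi chiC) -map_rev big_map.
have H (r : seq (word n * nat)) : exists2 c : Kq,
  ((forall g, g \in r -> lyndon g.1 /\ domin chi g.1) -> c != 0) &
  \prod_(g <- r) sem chi (Edp D g.1 g.2) = c *: \prod_(g <- r) Sg phi (rl X al g.1) ^+ g.2.
  elim: r => [|g r [c hc e]]; first by exists 1; [rewrite oner_neq0|rewrite !big_nil scale1r].
  exists ((qfact D (wt g.1) g.2)^-1 * (kap D g.1)^-1 ^+ g.2 * c).
    move=> h; have [lg dg] := h g (mem_head _ _).
    rewrite !mulf_neq0 ?expf_neq0 ?invr_eq0 ?qfact_neq0 ?kap_neq0 ?hc // => g' g'r.
    by apply: h; rewrite inE g'r orbT.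
  by rewrite !big_cons e sem_Edp -scalerAl -scalerAr scalerA.
have [c hc ->] := H (rev (grp (cfl w))); exists c.
  by move=> hl hd; apply: hc => g; rewrite mem_rev => /grp_mem h; split; [exact: (allP hl)|exact: hd].
rewrite (grp_prod _ (fun l => Sg phi (rl X al l))); congr (_ *: _).
exact: (Sg_prod phiD phiM phi1 phi_eq0 chiC chin phi_chi).
Qed.

Theorem dominant_max w : dominant D w -> ismax (rW D w) w /\ ismax (EW D w) w.
Proof.
move=> dw; have dw' : domin chi w := dominant_domin hchi chiC dw.
have hm := yw_max hX hCh hal dw'; split.
  apply: (@ismax_maxat _ chi); rewrite /rW (sem_prodl hchi chiC) big_map.
  suff -> : \prod_(l <- cfl w) sem chi (rL D l) = yw X al (cfl w) by [].
  by apply: eq_bigr => l _; rewrite (sem_rL hchi chiC chin).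
apply: (@ismax_maxat _ chi); have [c hc ->] := sem_EW w.
have [hl _ _] := cfl_spec w.
have cn : c != 0 by apply: hc => // l; exact: domin_factor dw'.
have [h0 h1] : maxat (Sg phi (yw X al (cfl w))) w.
  exact: (Sg_maxat phi_eq0 chin hm).
by split=> [|v]; rewrite shZE mulf_eq0 (negbTE cn) //; exact: h1.
Qed.

End Reduction.

(** * Simple systems in a lattice with an integral form *)

Section Form.
Variables (Lam : zmodType) (B : Lam -> Lam -> int) (P : Lam -> bool).
Hypotheses (BC : forall u v, B u v = B v u) (BD : forall u v w, B (u + v) w = B u w + B v w).
Hypothesis PD : forall u v, P (u + v) = P u (+) P v.
Implicit Types (u v : Lam).

Lemma B0 u : B 0 u = 0.
Proof. by have := BD 0 0 u; rewrite addr0 => /eqP; rewrite -subr_eq0 opprD addNKr oppr_eq0 => /eqP. Qed.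

Lemma P0 : P 0 = false.
Proof. by have := PD 0 0; rewrite addr0; case: (P 0). Qed.

Definition XB u v : Kq := (if P u && P v then -1 else 1) * qq ^ (- B u v).

Lemma XB_bichar : bichar XB.
Proof.
split.
- by move=> u v; rewrite /XB andbC BC.
- move=> u v w; rewrite /XB PD BD opprD expfzDr ?qq_neq0 //; move: (qq ^ _) (qq ^ _) => a b.
  by case: (P u); case: (P v); case: (P w) => /=; ring.
- move=> u v; apply: mulf_neq0; last by apply: expfz_neq0; exact: qq_neq0.
  by case: ifP => _; rewrite ?oppr_eq0; exact: oner_neq0.
Qed.

Lemma XB_sq u v : XB u v ^+ 2 = qq ^ (- (B u v * 2)).
Proof.
have -> : qq ^ (- (B u v * 2)) = (qq ^ (- B u v)) ^+ 2 by rewrite -mulNr -exprz_exp exprnP.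
by rewrite /XB exprMn; case: ifP => _; rewrite ?sqrrN expr1n mul1r.
Qed.

Lemma qqz_sign (s : Kq) (z : int) : s = 1 \/ s = -1 -> z != 0 -> s * qq ^ z != 1.
Proof.
move=> hs zn; have s2 : s * s = 1 by case: hs => ->; rewrite ?mulr1 // mulrNN mulr1.
have [k [k0 hk]] : exists k : nat, (0 < k)%N /\ (z = k%:Z \/ z = - k%:Z).
  exists `|z|%N; rewrite absz_gt0; split=> //.
  by case: z {zn} => k; [left|right; rewrite NegzE].
have [h1 h2] := qqX_neq k0.
have h3 : qq ^+ k != s by case: hs => ->.
apply/eqP => e; case/eqP: h3; case: hk e => ->.
  by rewrite -exprnP => e; rewrite -[LHS]mul1r -s2 -mulrA e mulr1.
rewrite -invr_expz -exprnP => e.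
have q0 : qq ^+ k != 0 by apply: expf_neq0; exact: qq_neq0.
by rewrite -[LHS]mul1r -e divfK.
Qed.

(* the u-string through v ends at v + m u; in the first case u is odd isotropic *)
Definition rcond u v (m : nat) := (B u u = 0 /\ P u /\ m = (B u v != 0))
  \/ (B u u != 0 /\ B u u * m%:Z = - (B u v * 2) /\ ~~ (P u && odd m)).

Lemma XB_diag u k : exists2 t : Kq, t = 1 \/ t = -1 & XB u u ^+ k = t * qq ^ (- (B u u * k%:Z)).
Proof.
exists ((if P u && P u then -1 else 1) ^+ k).
  by case: (P u); rewrite /= ?expr1n; [rewrite -signr_odd; case: odd; [right|left]|left].
by rewrite /XB exprMn; congr (_ * _); rewrite -mulNr -exprz_exp exprnP.
Qed.

(** For an odd isotropic root [s = -1], so the second quantum integer vanishes and strings have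
    length at most one. Otherwise no positive power of [s] is 1, while [c ^+ 2 * s ^+ m j = 1]; the
    three clauses follow. *)
Lemma cartan_rcond n (al : 'I_n -> Lam) (i : 'I_n) (m : 'I_n -> nat) :
  (forall j, j != i -> rcond (al i) (al j) (m j)) -> cartan XB al i m.
Proof.
move=> h j /h {h} hr; set u := al i in hr *; set v := al j in hr *.
have hX := XB_bichar.
case: hr => [[b0 [pu ->]]|[bn [bm pm]]]; cbv zeta.
  have s1 : XB u u = -1 by rewrite /XB pu b0 oppr0 expr0z mulr1.
  rewrite s1 XB_sq; case: eqP => [bv|/eqP bv] /=.
    split=> [|t|t]; first by rewrite bv mul0r oppr0 !expr0z expr0 mulr1 subrr mulr0.
      by rewrite ltn0.
    by case/andP => t0; rewrite leqNgt t0.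
  have c1 (a : Kq) : a = 1 \/ a = -1 -> qq ^ (- (B u v * 2)) * a != 1.
    by move=> ha; rewrite mulrC; apply: qqz_sign => //; rewrite oppr_eq0 mulf_neq0.
  split=> [|t|t].
  - by rewrite /qint big_ord_recl big_ord1 /= expr0 expr1 addrN mul0r.
  - rewrite ltnS leqn0 => /eqP ->; rewrite /qint big_ord1 expr0; split; first exact: oner_neq0.
    by apply: c1; left.
  - by move=> /andP[t0 t1]; apply: c1; rewrite -signr_odd; case: odd; [right|left].
have st k : (0 < k)%N -> XB u u ^+ k != 1.
  move=> k0; have [t ht ->] := XB_diag u k; apply: qqz_sign => //.
  by rewrite oppr_eq0 mulf_neq0 // eqz_nat -lt0n.
have q1 k : qint (XB u u) k.+1 != 0.
  apply/eqP => e; case/eqP: (st k.+1 isT); apply/eqP; rewrite -subr_eq0 subrX1.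
  by rewrite -/(qint _ _) e mulr0.
have cm : XB u v ^+ 2 * XB u u ^+ m j = 1.
  rewrite XB_sq; have -> : XB u u ^+ m j = qq ^ (B u v * 2).
    rewrite /XB exprMn andbb; have -> : (if P u then -1 else 1 : Kq) ^+ m j = 1.
      by move: pm; case: (P u) => /=; rewrite ?expr1n // -signr_odd => /negbTE ->.
    by rewrite mul1r exprnP exprz_exp mulNr bm opprK.
  by rewrite -expfzDr ?qq_neq0 // addNr expr0z.
split=> [|t tm|t /andP[t0 _]].
- by rewrite cm subrr mulr0.
- split; first exact: q1.
  apply/eqP => e; have := st (m j - t)%N; rewrite subn_gt0 tm => /(_ isT) /eqP; apply.
  rewrite -[LHS]mul1r -e -mulrA -exprD subnKC ?cm //; exact: ltnW.
- by rewrite exprD mulrA cm mul1r st.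
Qed.

Section FormDatum.
Variables (n : nat) (D : datum n) (Ch : ('I_n -> Lam) -> Prop) (Phi : seq Lam) (al : 'I_n -> Lam).
Hypothesis hrefl : forall al i, Ch al -> exists m : 'I_n -> nat,
  (forall j, j != i -> rcond (al i) (al j) (m j)) /\ Ch (refl al i m).
Hypothesis hindep : forall al, Ch al -> indep al.
Hypothesis hsimple : forall al i, Ch al -> al i \in Phi.
Hypothesis hsign : forall al v, Ch al -> v \in Phi -> qpos al v \/ qpos al (- v).
Hypothesis hal : Ch al.
Hypothesis hgram : forall i j, gram D i j = B (al i) (al j).
Hypothesis hpar : forall i, par D i = P (al i).
Hypothesis hbar : barpi D -> forall i j, exists z, gram D i j = z * 2.
Hypothesis hroot : forall al k, Ch al ->
  (B (al k) (al k) = 0 /\ P (al k)) \/ (2 <= `|B (al k) (al k)|)%N.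

Lemma sum_wt (w : word n) (f : 'I_n -> int) : \sum_(i < n) wt w i * f i = \sum_(a <- w) f a.
Proof.
elim: w => [|a w IH]; first by rewrite big_nil big1 // => i _; rewrite mul0r.
rewrite big_cons -IH (bigD1 a) //= [in RHS](bigD1 a) //= addrA; congr (_ + _).
  by rewrite /wt /= eqxx PoszD mulrDl mul1r.
by apply: eq_bigr => i ia; rewrite /wt /= eq_sym (negbTE ia).
Qed.

Lemma B_wta (w z : word n) : B (wta al w) (wta al z) = \sum_(a <- w) \sum_(b <- z) gram D a b.
Proof.
elim: w => [|a w IH]; first by rewrite wta_nil B0 big_nil.
rewrite wta_cons BD IH big_cons; congr (_ + _); elim: z {IH} => [|b z IH].
  by rewrite wta_nil BC B0 big_nil.
by rewrite wta_cons BC BD BC [in X in _ + X]BC IH big_cons hgram.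
Qed.

Lemma bform_wt (w : word n) : bform D (wt w) (wt w) = B (wta al w) (wta al w).
Proof.
rewrite B_wta -sum_wt /bform; apply: eq_bigr => i _.
rewrite -sum_wt mulr_sumr; apply: eq_bigr => j _; by rewrite mulrA.
Qed.

Lemma rpar_wt (w : word n) : rpar D (wt w) = P (wta al w).
Proof.
have -> : rpar D (wt w) = odd (absz (\sum_(a <- w) (par D a : nat)%:Z)).
  rewrite /rpar -sum_wt big_mkcond; congr (odd (absz _)); apply: eq_bigr => i _.
  by case: (par D i); rewrite ?mulr1 ?mulr0.
have -> : \sum_(a <- w) (par D a : nat)%:Z = Posz (\sum_(a <- w) (par D a : nat))%N.
  by elim: w => [|a w IH]; rewrite ?big_nil // !big_cons IH PoszD.
rewrite absz_nat; elim: w => [|a w IH]; first by rewrite big_nil wta_nil P0.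
by rewrite big_cons oddD oddb IH wta_cons PD hpar.
Qed.

Theorem form_max (w : word n) : dominant D w -> ismax (rW D w) w /\ ismax (EW D w) w.
Proof.
apply: (@dominant_max n D Lam XB XB_bichar Ch Phi al) => //.
- split=> // al' i h; have [m [h1 h2]] := hrefl i h.
  by exists m => //; exact: cartan_rcond.
- by move=> i j; rewrite /XB hgram !hpar.
move=> l al' k hc e; rewrite /dbeta /isotropic rpar_wt bform_wt -e.
case: (hroot k hc) => [[-> ->]|h]; first by rewrite eqxx.
by case: ifP => // _; rewrite divn_gt0.
Qed.

End FormDatum.
End Form.

(** * Types A, B, C and D *)

Section Frames.
Variables (N : nat) (kd : 'I_N -> bool) (ws : int).
Local Notation Lam := {ffun 'I_N -> int}.
Implicit Types (u v : Lam) (p q r : nat).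

Definition wsg (b : bool) : int := if b then - ws else ws.
Definition Bamb u v : int := \sum_(a < N) wsg (kd a) * u a * v a.
Definition Pamb u : bool := odd (absz (\sum_(a < N | kd a) u a)).
Definition eps (a : 'I_N) : Lam := [ffun b => evec a b].
Local Notation B := Bamb.
Local Notation P := Pamb.

Lemma BambC u v : B u v = B v u.
Proof. by apply: eq_bigr => a _; rewrite mulrAC. Qed.
Lemma BambD u v w : B (u + v) w = B u w + B v w.
Proof. by rewrite /B -big_split /=; apply: eq_bigr => a _; rewrite ffunE; ring. Qed.
Lemma BambDr u v w : B w (u + v) = B w u + B w v.
Proof. by rewrite BambC BambD !(BambC w). Qed.
Lemma BambN u v : B (- u) v = - B u v.
Proof. by rewrite /B -sumrN; apply: eq_bigr => a _; rewrite ffunE; ring. Qed.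
Lemma BambNr u v : B u (- v) = - B u v.
Proof. by rewrite BambC BambN BambC. Qed.

Lemma odd_absD (x y : int) : odd (absz (x + y)) = odd (absz x) (+) odd (absz y).
Proof. lia. Qed.

Lemma PambD u v : P (u + v) = P u (+) P v.
Proof.
rewrite /P -odd_absD -big_split /=; congr (odd (absz _)).
by apply: eq_bigr => a _; rewrite ffunE.
Qed.
Lemma PambN u : P (- u) = P u.
Proof.
rewrite /P -[in RHS]abszN -sumrN; congr (odd (absz _)).
by apply: eq_bigr => a _; rewrite ffunE.
Qed.

Lemma B_eps a b : B (eps a) (eps b) = if a == b then wsg (kd a) else 0.
Proof.
rewrite /B (bigD1 a) //= big1 => [|c ca]; last first.
  by rewrite !ffunE /evec eq_sym (negbTE ca) mulr0 mul0r.
rewrite !ffunE /evec eqxx mulr1 addr0 [b == a]eq_sym.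
by case: eqP => _; rewrite ?mulr1 ?mulr0.
Qed.

Lemma P_eps a : P (eps a) = kd a.
Proof.
rewrite /P big_mkcond (bigD1 a) //= big1 => [|c ca]; last first.
  by rewrite !ffunE /evec eq_sym (negbTE ca) if_same.
by rewrite ffunE /evec eqxx addr0; case: (kd a).
Qed.

(* sgn = true allows sign changes of the basis vectors (all types but A) *)
Variable sgn : bool.
Definition isE v := exists a, v = eps a \/ (sgn /\ v = - eps a).

Lemma isE_B v : isE v -> B v v = wsg (P v).
Proof.
by case=> a [->|[_ ->]]; rewrite ?BambN ?BambNr ?opprK ?PambN B_eps eqxx P_eps.
Qed.

(** An ordering of the standard basis, with signs if [sgn] holds. Indices are natural numbers
    constrained only below [N], so neighbouring positions need no casts. *)
Definition frame (e : nat -> Lam) :=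
  [/\ forall p, (p < N)%N -> isE (e p),
      forall v, isE v -> exists p, (p < N)%N /\ (v = e p \/ (sgn /\ v = - e p)) &
      forall p q, (p < N)%N -> (q < N)%N -> p != q -> B (e p) (e q) = 0].

Lemma frB e : frame e -> forall p q, (p < N)%N -> (q < N)%N ->
  B (e p) (e q) = if p == q then wsg (P (e p)) else 0.
Proof.
case=> h1 _ h3 p q hp hq; case: eqP => [<-|/eqP ne]; last exact: h3.
by apply: isE_B; exact: h1.
Qed.

Lemma frame_op e e' (f : nat -> nat) : frame e -> (forall p, (p < N)%N -> (f p < N)%N) ->
  (forall p, (p < N)%N -> f (f p) = p) ->
  (forall p, (p < N)%N -> e' p = e (f p) \/ (sgn /\ e' p = - e (f p))) -> frame e'.
Proof.
move=> [h1 h2 h3] fN ff he; split.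
- move=> p hp; have [a ha] := h1 _ (fN _ hp); exists a.
  case: (he p hp) => [->//|[hs ->]]; case: ha => [->|[_ ->]]; [by right|left].
  by rewrite opprK.
- move=> v /h2[p [hp hv]]; exists (f p); split; first exact: fN.
  have := he _ (fN _ hp); rewrite ff // => -[->//|[hs ->]].
  by case: hv => [->|[_ ->]]; [right; rewrite opprK|left].
- move=> p q hp hq pq; have z : B (e (f p)) (e (f q)) = 0.
    by apply: h3; rewrite ?fN //; apply: contra pq => /eqP E; rewrite -(ff p) // E ff.
  by case: (he p hp) => [->|[_ ->]]; case: (he q hq) => [->|[_ ->]];
    rewrite ?BambN ?BambNr z ?oppr0.
Qed.

Definition swp p (e : nat -> Lam) q := e (if q == p then p.+1 else if q == p.+1 then p else q).
Definition flp p (e : nat -> Lam) q := if q == p then - e q else e q.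

Lemma frame_swp p e : frame e -> (p.+1 < N)%N -> frame (swp p e).
Proof.
move=> he hp; apply: (frame_op (f := fun q => if q == p then p.+1 else if q == p.+1 then p else q) he).
- by move=> q hq; case: eqP => // _; case: eqP => // _; lia.
- move=> q hq; case: (q =P p) => [->|]; first by rewrite eqxx; case: eqP => //; lia.
  by move=> n1; case: (q =P p.+1) => [->|n2]; [rewrite eqxx|case: eqP => //; case: eqP].
- by move=> q hq; left.
Qed.

Lemma frame_flp p e : sgn -> frame e -> (p < N)%N -> frame (flp p e).
Proof.
move=> hs he hp; apply: (frame_op (f := fun q => q) he) => // q hq.
by rewrite /flp; case: eqP => _; [right|left].
Qed.

Definition rcb (x y : int) (pi : bool) (m : nat) :=
  ((x == 0) && pi && (m == (y != 0))) || [&& x != 0, x * m%:Z == - (y * 2) & ~~ (pi && odd m)].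

Lemma rcbP u v m : rcb (B u u) (B u v) (P u) m -> rcond B P u v m.
Proof.
case/orP => [/andP[/andP[/eqP h1 h2] /eqP h3]|/and3P[h1 /eqP h2 h3]]; first by left.
by right.
Qed.

Section Chamber.
Variables (n : nat) (S : (nat -> Lam) -> nat -> Lam).

Definition Chf (al : 'I_n -> Lam) :=
  exists e (s : {perm 'I_n}), frame e /\ forall i, al i = S e (s i).

(** The permutation [t] allows a reflection to exchange nodes, as happens when a fork of type D
    turns into an end of type C. *)
Lemma Chf_refl : (forall e (p : 'I_n), frame e -> exists e' (t : {perm 'I_n}) (m : nat -> nat),
   [/\ frame e', S e' (t p) = - S e p &
    forall q : 'I_n, q != p -> rcond B P (S e p) (S e q) (m q) /\ S e' (t q) = S e q + S e p *+ m q]) ->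
  forall al i, Chf al -> exists m : 'I_n -> nat,
  (forall j, j != i -> rcond B P (al i) (al j) (m j)) /\ Chf (refl al i m).
Proof.
move=> H al i [e [s [he hal]]].
have [e' [t [m [he' hp hq]]]] := H e (s i) he.
have sj j : j != i -> s j != s i by rewrite (inj_eq perm_inj).
exists (fun j => m (s j)); split.
  by move=> j /sj /hq[h _]; rewrite !hal.
exists e', (s * t)%g; split=> // j; rewrite permM /refl; case: (eqVneq j i) => [->|/sj /hq[_ h]].
  by rewrite hp hal.
by rewrite h !hal.
Qed.

End Chamber.

End Frames.

Ltac dnat := repeat match goal with
  | |- context [@eq_op _ ?x ?y] => match type of x with nat =>
      first [ rewrite (_ : (x == y) = true); last lia | rewrite (_ : (x == y) = false); last lia ] end
  | |- context [leq ?x ?y] =>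
      first [ rewrite (_ : leq x y = true); last lia | rewrite (_ : leq x y = false); last lia ]
  end.

Section TypeAB.
Variables (N : nat) (kd : 'I_N -> bool) (ws : int).
Hypothesis hws : ws = 1 \/ ws = 2.
Local Notation Lam := {ffun 'I_N -> int}.
Local Notation B := (Bamb kd ws).
Local Notation P := (Pamb kd).

Definition SA (e : nat -> Lam) p := e p - e p.+1.
Definition SB (e : nat -> Lam) p := if (p.+1 < N)%N then e p - e p.+1 else e p.
(** The end node depends on the kind of the last vector: twice a delta vector as in type C, or the
    fork of type D for an epsilon vector. *)
Definition SC (e : nat -> Lam) p := if (p.+1 < N)%N then e p - e p.+1
  else if P (e p) then e p + e p else e p.-1 + e p.

Ltac vec := rewrite ?(mulr0n, mulr1n, mulr2n); apply/ffunP => ?; rewrite !ffunE; ring.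
Ltac bil he := rewrite ?(BambD, BambDr, BambN, BambNr) ?(PambD, PambN);
  do ?(rewrite (frB he); [|lia|lia]); dnat.
Ltac fin := rewrite /wsg; repeat match goal with |- context [P ?v] => case: (P v) end;
  case: hws => ->; by [].

Lemma SA_refl sgn e p : frame kd ws sgn e -> (p.+1 < N)%N -> exists e' m,
  [/\ frame kd ws sgn e', SA e' p = - SA e p &
   forall q, (q.+1 < N)%N -> q != p -> rcond B P (SA e p) (SA e q) (m q) /\ SA e' q = SA e q + SA e p *+ m q].
Proof.
move=> he hp; exists (swp p e), (fun q => (q.+1 == p) + (q == p.+1))%N; split.
- exact: frame_swp.
- by rewrite /SA /swp; dnat; vec.
move=> q hq qp; have [E|[E|E]] : q.+1 = p \/ q = p.+1 \/ (q.+1 <> p /\ q <> p.+1) by lia.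
- subst p; dnat; rewrite /SA /swp; split; last by dnat; vec.
  apply: rcbP; bil he. fin.
- subst q; dnat; rewrite /SA /swp; split; last by dnat; vec.
  by apply: rcbP; bil he; fin.
- dnat; rewrite /SA /swp; split; last by dnat; vec.
  by apply: rcbP; bil he; fin.
Qed.

Lemma SB_refl e p : frame kd ws true e -> (p < N)%N -> exists e' m,
  [/\ frame kd ws true e', SB e' p = - SB e p &
   forall q, (q < N)%N -> q != p -> rcond B P (SB e p) (SB e q) (m q) /\ SB e' q = SB e q + SB e p *+ m q].
Proof.
move=> he hp; case: (ltnP p.+1 N) => hp1.
  exists (swp p e), (fun q => (q.+1 == p) + (q == p.+1))%N; split.
  - exact: frame_swp.
  - by rewrite /SB /swp; dnat; vec.
  move=> q hq qp; have [E|[E|E]] : q.+1 = p \/ q = p.+1 \/ (q.+1 <> p /\ q <> p.+1) by lia.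
  - subst p; rewrite /SB /swp; dnat; split; last by vec.
    by apply: rcbP; bil he; fin.
  - subst q; rewrite /SB /swp; dnat; case: (ltnP p.+2 N) => h; dnat; (split; last by vec);
      by apply: rcbP; bil he; fin.
  - rewrite /SB /swp; dnat; case: (ltnP q.+1 N) => h; dnat; (split; last by vec);
      by apply: rcbP; bil he; fin.
exists (flp p e), (fun q => if q.+1 == p then 2 else 0)%N; split.
- exact: frame_flp.
- by rewrite /SB /flp; dnat; vec.
move=> q hq qp; have [E|E] : q.+1 = p \/ q.+1 <> p by lia.
- subst p; rewrite /SB /flp; dnat; split; last by vec.
  by apply: rcbP; bil he; fin.
- rewrite /SB /flp; dnat; split; last by vec.
  by apply: rcbP; bil he; fin.
Qed.

Lemma SC_refl_swp e p : frame kd ws true e -> (p.+1 < N)%N -> exists m,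
  SC (swp p e) p = - SC e p /\
  forall q, (q < N)%N -> q != p -> rcond B P (SC e p) (SC e q) (m q) /\ SC (swp p e) q = SC e q + SC e p *+ m q.
Proof.
move=> he hp.
(* The end node needs its own string lengths. For [p.+2 = N] the swap replaces the last vector, so
   the end may change between [e p.+1 + e p.+1], [e p + e p.+1] and [e p + e p], each obtained from
   the previous one by adding the reflecting root. For [p.+3 = N] only a fork is adjacent to the
   reflecting root. *)
exists (fun q => if q.+1 == N then
    if p.+2 == N then (if P (e p.+1) then (if P (e p) then 2 else 1) else P (e p) : nat)
    else if p.+3 == N then (~~ P (e N.-1) : nat) else 0
  else (q.+1 == p) + (q == p.+1))%N; split.
  by rewrite /SC /swp; dnat; vec.
move=> q hq qp; have [E|[E|E]] : q.+1 = p \/ q = p.+1 \/ (q.+1 <> p /\ q <> p.+1) by lia.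
- subst p; rewrite /SC /swp; dnat; split; last by vec.
  by apply: rcbP; bil he; fin.
- subst q; rewrite /SC /swp; dnat; case: (ltnP p.+2 N) => h; dnat.
    by split; [apply: rcbP; bil he; fin|vec].
  have eN : N.-1 = p.+1 by lia.
  by case E1 : (P (e p.+1)); case E2 : (P (e p)); rewrite /=; (split; last by vec);
    apply: rcbP; bil he; rewrite ?E1 ?E2; fin.
- rewrite /SC /swp; case: (ltnP q.+1 N) => h; dnat.
    by split; [apply: rcbP; bil he; fin|vec].
  case: (eqVneq p.+3 N) => h3; dnat.
    have -> : N.-1 = p.+2 by lia.
    have -> : q = p.+2 by lia.
    by case E1 : (P (e p.+2)); rewrite /=; dnat; (split; last by vec); apply: rcbP; bil he; rewrite ?E1; fin.
  by case E1 : (P (e q)); rewrite /=; dnat; (split; last by vec); apply: rcbP; bil he; rewrite ?E1; fin.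
Qed.

Lemma SC_refl_last e p : frame kd ws true e -> (p.+1 = N)%N -> (1 < N)%N ->
  exists e' (t : nat -> nat) m, [/\ frame kd ws true e', t = id \/ t = (fun q => if q == p then p.-1 else if q == p.-1 then p else q),
  SC e' (t p) = - SC e p &
  forall q, (q < N)%N -> q != p -> rcond B P (SC e p) (SC e q) (m q) /\ SC e' (t q) = SC e q + SC e p *+ m q].
Proof.
move=> he hp N1; case E1 : (P (e p)).
  exists (flp p e), id, (fun q => if q.+1 == p then 1 else 0)%N; split.
  - by apply: frame_flp => //; lia.
  - by left.
  - by rewrite /SC /flp; dnat; rewrite PambN E1; vec.
  move=> q hq qp; have [E|E] : q.+1 = p \/ q.+1 <> p by lia.
    rewrite /SC /flp; dnat; rewrite -E E E1; split; last by vec.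
    by apply: rcbP; bil he; rewrite ?E1; fin.
  rewrite /SC /flp; dnat; rewrite E1; split; last by vec.
  by apply: rcbP; bil he; rewrite ?E1; fin.
have [r Er] : exists r, p = r.+1 by exists p.-1; lia.
subst p; case E2 : (P (e r)).
  (* The end root is odd isotropic: the fork becomes an end of type C, and the last two nodes trade
     places. *)
  exists (flp r (swp r e)), (fun q => if q == r.+1 then r else if q == r then r.+1 else q),
    (fun q => if (q == r) || (q.+1 == r) then 1 else 0)%N; split.
  - by apply: frame_flp => //; [apply: frame_swp => //; lia|lia].
  - by right.
  - by rewrite /SC /flp /swp; dnat; rewrite E1; vec.
  move=> q hq qp; have [E|[E|E]] : q = r \/ q.+1 = r \/ (q <> r /\ q.+1 <> r) by lia.
  - subst q; rewrite /SC /flp /swp; dnat; rewrite ?E1 ?E2 /=; split; last by vec.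
    by apply: rcbP; bil he; rewrite ?E1 ?E2; fin.
  - subst r; rewrite /SC /flp /swp; dnat; rewrite ?E1 ?E2 /=; split; last by vec.
    by apply: rcbP; bil he; rewrite ?E1 ?E2; fin.
  - rewrite /SC /flp /swp; dnat; rewrite ?E1 ?E2 /=; split; last by vec.
    by apply: rcbP; bil he; rewrite ?E1 ?E2; fin.
(* Both vectors of the fork are epsilon vectors; the reflection exchanges them and changes both
   signs. *)
exists (flp r.+1 (flp r (swp r e))), id, (fun q => if (q.+1 == r) then 1 else 0)%N; split.
- by apply: frame_flp => //; [apply: frame_flp => //; [apply: frame_swp => //; lia|lia]|lia].
- by left.
- by rewrite /SC /flp /swp; dnat; rewrite ?PambN ?E1 ?E2; vec.
move=> q hq qp; have [E|[E|E]] : q = r \/ q.+1 = r \/ (q <> r /\ q.+1 <> r) by lia.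
- subst q; rewrite /SC /flp /swp; dnat; rewrite ?E1 ?E2 /=; split; last by vec.
  by apply: rcbP; bil he; rewrite ?E1 ?E2; fin.
- subst r; rewrite /SC /flp /swp; dnat; rewrite ?E1 ?E2 /=; split; last by vec.
  by apply: rcbP; bil he; rewrite ?E1 ?E2; fin.
- rewrite /SC /flp /swp; dnat; rewrite ?E1 ?E2 /=; split; last by vec.
  by apply: rcbP; bil he; rewrite ?E1 ?E2; fin.
Qed.

End TypeAB.

(** * Independence and sign coherence of the classical simple systems *)

Section ChamberProps.
Variables (N : nat) (kd : 'I_N -> bool) (ws : int).
Local Notation Lam := {ffun 'I_N -> int}.
Local Notation B := (Bamb kd ws).
Local Notation P := (Pamb kd).
Implicit Types (u v : Lam) (p q : nat).

Ltac vec := apply/ffunP => ?; rewrite !ffunE; ring.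

Definition Eseq (sgn : bool) : seq Lam :=
  [seq eps a | a <- enum 'I_N] ++ (if sgn then [seq - eps a | a <- enum 'I_N] else [::]).

Lemma EseqP sgn v : reflect (isE sgn v) (v \in Eseq sgn).
Proof.
rewrite mem_cat; apply: (iffP orP).
  case=> [/mapP[a _ ->]|]; first by exists a; left.
  by case: sgn => // /mapP[a _ ->]; exists a; right.
case=> a [->|[hs ->]]; [left|right; rewrite hs]; apply: map_f; exact: mem_enum.
Qed.

Lemma isE_opp v : isE true v -> isE true (- v).
Proof. by case=> a [->|[_ ->]]; exists a; [right|left; rewrite opprK]. Qed.

Lemma indep_dual n (al : 'I_n -> Lam) : (forall k, exists L : Lam -> int,
  [/\ forall u v, L (u + v) = L u + L v, forall j, j != k -> L (al j) = 0 & L (al k) != 0]) ->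
  indep al.
Proof.
move=> H w z e; apply/seq.permP => a; rewrite -!size_filter.
have ck k : count_mem k w = count_mem k z.
  have [L [LD L0 Lk]] := H k.
  have Lz : L 0 = 0 by have := LD 0 0; rewrite addr0 => /eqP; rewrite -subr_eq0 opprD addNKr oppr_eq0 => /eqP.
  have E y : L (wta al y) = (count_mem k y)%:Z * L (al k).
    elim: y => [|j y IH]; first by rewrite wta_nil Lz mul0r.
    rewrite wta_cons LD IH /= PoszD mulrDl; congr (_ + _).
    by case: (eqVneq j k) => [->|/L0 ->]; rewrite ?mul1r ?mul0r.
  have := congr1 L e; rewrite !E => /(mulIf Lk) [] //.
have P1 : perm_eq w z by apply/allP => k _; rewrite /= ck.
by rewrite !size_filter (seq.permP P1).
Qed.

Hypothesis ws0 : ws != 0.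
Variables (sgn : bool) (e : nat -> Lam).
Hypothesis he : frame kd ws sgn e.

Lemma wsg0 b : wsg ws b != 0. Proof. by case: b; rewrite /wsg ?oppr_eq0. Qed.

Lemma frame_neq p q : (p < N)%N -> (q < N)%N -> p != q -> e p != e q /\ e p != - e q.
Proof.
move=> hp hq pq; have z : B (e p) (e q) = 0 by case: he => _ _; apply.
have nz : B (e q) (e q) != 0 by rewrite (frB he) // eqxx wsg0.
split; apply/eqP => E; case/eqP: nz; first by rewrite -{1}E.
by rewrite -[X in B X _]opprK -E BambN z oppr0.
Qed.

(* ws times the sum of the first k + 1 coordinates of v in the orthogonal basis e *)
Definition Lco k v : int := \sum_(p < k.+1) B v (e p) * (if P (e p) then -1 else 1).

Lemma LcoD k u v : Lco k (u + v) = Lco k u + Lco k v.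
Proof. by rewrite /Lco -big_split; apply: eq_bigr => p _; rewrite BambD mulrDl. Qed.
Lemma LcoN k u : Lco k (- u) = - Lco k u.
Proof. by rewrite /Lco -sumrN; apply: eq_bigr => p _; rewrite BambN mulNr. Qed.

Lemma Lco_e k q : (k < N)%N -> (q < N)%N -> Lco k (e q) = if (q <= k)%N then ws else 0.
Proof.
move=> hk hq; have E (p : 'I_k.+1) : B (e q) (e p) * (if P (e p) then -1 else 1) = if val p == q then ws else 0.
  rewrite (frB he) //; last by apply: leq_trans (ltn_ord p) _.
  rewrite eq_sym; case: eqP => [->|_]; last by rewrite mul0r.
  by case: (P _); rewrite /wsg ?mulrNN mulr1.
rewrite /Lco (eq_bigr (fun i : 'I_k.+1 => if val i == q then ws else 0)) => [|i _]; last exact: E.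
rewrite -big_mkcond /=.
case: leqP => qk.
  by rewrite (big_pred1 (Ordinal (qk : (q < k.+1)%N))) // => p; rewrite -val_eqE.
by rewrite big_pred0 // => p; apply/eqP => E'; have := ltn_ord p; rewrite E' ltnS leqNgt qk.
Qed.

Section Coherent.
Variables (n : nat) (al : 'I_n -> Lam).

Lemma qpos_diff : (forall p, (p.+1 < N)%N -> qpos al (e p - e p.+1)) ->
  forall p q, (p <= q)%N -> (q < N)%N -> qpos al (e p - e q).
Proof.
move=> h p q pq; rewrite -(subnKC pq); elim: (q - p)%N => [|d IH] hq.
  by rewrite addn0 subrr; exists [::]; rewrite wta_nil.
rewrite addnS in hq *; have -> : e p - e (p + d).+1 = (e p - e (p + d)) + (e (p + d) - e (p + d).+1) by vec.
by apply: qposD; [apply: IH; exact: ltnW|exact: h].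
Qed.

Lemma qpos_diff2 : (forall p, (p.+1 < N)%N -> qpos al (e p - e p.+1)) ->
  forall p q, (p < N)%N -> (q < N)%N -> qpos al (e p - e q) \/ qpos al (- (e p - e q)).
Proof.
move=> h p q hp hq; case: (leqP p q) => pq; first by left; exact: qpos_diff.
by right; rewrite opprB; apply: qpos_diff => //; exact: ltnW.
Qed.

(** The sign choices reduce to differences of frame vectors, settled by [qpos_diff2], and to sums.
    The predicate [c] singles out the sums that have to be treated. *)
Lemma sign_coherent (c : Lam -> Lam -> bool) :
  (forall p, (p.+1 < N)%N -> qpos al (e p - e p.+1)) ->
  (forall u v, c (- u) (- v) = c u v) ->
  (forall p q, (p < N)%N -> (q < N)%N -> c (e p) (e q) -> qpos al (e p + e q)) ->
  forall u v, isE sgn u -> isE sgn v -> c u v -> qpos al (u + v) \/ qpos al (- (u + v)).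
Proof.
move=> hd cN hs u v; case: he => _ h2 _ /h2[p [hp eu]] /h2[q [hq ev]].
case: eu => [->|[_ ->]]; case: ev => [->|[_ ->]] huv.
- by left; exact: hs.
- exact: qpos_diff2.
- by rewrite addrC; exact: qpos_diff2.
- by right; rewrite opprD !opprK; apply: hs; rewrite // -cN.
Qed.

End Coherent.

End ChamberProps.

Section Chambers.
Variables (N n : nat) (kd : 'I_N -> bool) (ws : int).
Hypothesis hws : ws = 1 \/ ws = 2.
Local Notation Lam := {ffun 'I_N -> int}.
Local Notation B := (Bamb kd ws).
Local Notation P := (Pamb kd).
Implicit Types (u v : Lam) (p q : nat).

Ltac vec := apply/ffunP => ?; rewrite !ffunE; ring.
Ltac bil he := rewrite ?(BambD, BambDr, BambN, BambNr) ?(PambD, PambN);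
  do ?(rewrite (frB he); [|lia|lia]); dnat.

Let ws0 : ws != 0. Proof. by case: hws => ->. Qed.

Lemma indep_frame sgn e (S : (nat -> Lam) -> nat -> Lam) (s : {perm 'I_n}) (al : 'I_n -> Lam) :
  frame kd ws sgn e -> (forall i, al i = S e (s i)) ->
  (forall p, (p < n)%N -> exists L : Lam -> int, [/\ forall u v, L (u + v) = L u + L v,
      forall q, (q < n)%N -> q != p -> L (S e q) = 0 & L (S e p) != 0]) -> indep al.
Proof.
move=> he hal H; apply: indep_dual => k; have [L [h1 h2 h3]] := H _ (ltn_ord (s k)).
exists L; split=> // [j jk|]; rewrite hal //; apply: h2; first exact: ltn_ord.
by rewrite val_eqE (inj_eq perm_inj).
Qed.

Lemma qpos_S (e : nat -> Lam) (S : (nat -> Lam) -> nat -> Lam) (s : {perm 'I_n}) (al : 'I_n -> Lam) : (forall i, al i = S e (s i)) ->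
  forall p, (p < n)%N -> qpos al (S e p).
Proof.
move=> hal p hp; have -> : S e p = al ((s^-1)%g (Ordinal hp)) by rewrite hal permKV.
exact: qpos_simple.
Qed.

Section A.
Hypothesis nN : n.+1 = N.
Definition PhiA : seq Lam := [seq u - v | u <- Eseq N false, v <- Eseq N false].

Lemma SA_indep (al : 'I_n -> Lam) : Chf kd ws false (@SA N) al -> indep al.
Proof.
move=> [e [s [he hal]]]; apply: (indep_frame he hal) => p hp.
exists (Lco kd ws e p); split; first exact: LcoD.
- move=> q hq qp; rewrite /SA LcoD LcoN !(Lco_e he) //; try lia.
  by case: (ltngtP q p) qp => // h _; dnat; rewrite ?subrr ?subr0.
- by rewrite /SA LcoD LcoN !(Lco_e he); try lia; dnat; rewrite subr0.
Qed.

Lemma SA_simple (al : 'I_n -> Lam) i : Chf kd ws false (@SA N) al -> al i \in PhiA.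
Proof.
move=> [e [s [[h1 _ _] hal]]]; rewrite hal /SA; apply/allpairsP; exists (e (s i), e (s i).+1).
by split=> //; apply/EseqP; apply: h1; have := ltn_ord (s i); lia.
Qed.

Lemma SA_sign (al : 'I_n -> Lam) v : Chf kd ws false (@SA N) al -> v \in PhiA -> qpos al v \/ qpos al (- v).
Proof.
move=> [e [s [he hal]]] /allpairsP[[u1 u2] /= [/EseqP hu1 /EseqP hu2 ->]].
case: (he) => _ h2 _; have [p [hp [->|[]//]]] := h2 _ hu1; have [q [hq [->|[]//]]] := h2 _ hu2.
by apply: qpos_diff2 => // r hr; apply: (qpos_S (S := @SA N) hal); lia.
Qed.

Lemma SA_root (al : 'I_n -> Lam) i : Chf kd ws false (@SA N) al ->
  (B (al i) (al i) = 0 /\ P (al i)) \/ (2 <= `|B (al i) (al i)|)%N.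
Proof.
move=> [e [s [he hal]]]; rewrite hal /SA; have := ltn_ord (s i) => hi.
bil he; rewrite /wsg; case: (P _); case: (P _); case: hws => ->;
  first [by left | by right].
Qed.

Lemma SA_reflect (al : 'I_n -> Lam) i : Chf kd ws false (@SA N) al -> exists m : 'I_n -> nat,
  (forall j, j != i -> rcond B P (al i) (al j) (m j)) /\ Chf kd ws false (@SA N) (refl al i m).
Proof.
apply: Chf_refl => e p he; have hp : (p.+1 < N)%N by rewrite -nN ltnS.
have [e' [m [h1 h2 h3]]] := SA_refl hws he hp.
exists e', 1%g, m; split=> //; first by rewrite perm1.
by move=> q qp; rewrite perm1; apply: h3 => //; rewrite -nN ltnS.
Qed.
End A.

Section BType.
Hypotheses (nN : n = N) (ws2 : ws = 2).
Definition PhiB : seq Lam := Eseq N true ++ [seq u + v | u <- Eseq N true, v <- Eseq N true].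

Lemma SB_indep (al : 'I_n -> Lam) : Chf kd ws true (@SB N) al -> indep al.
Proof.
move=> [e [s [he hal]]]; apply: (indep_frame he hal) => p hp.
exists (Lco kd ws e p); split; first exact: LcoD.
- move=> q hq qp; rewrite /SB; case: (ltnP q.+1 N) => hq1.
    rewrite LcoD LcoN !(Lco_e he) //; try lia.
    by case: (ltngtP q p) qp => // h _; dnat; rewrite ?subrr ?subr0.
  by rewrite (Lco_e he); try lia; dnat.
- rewrite /SB; case: (ltnP p.+1 N) => hp1.
    by rewrite LcoD LcoN !(Lco_e he); try lia; dnat; rewrite subr0.
  by rewrite (Lco_e he); try lia; dnat.
Qed.

Lemma SB_simple (al : 'I_n -> Lam) i : Chf kd ws true (@SB N) al -> al i \in PhiB.
Proof.
move=> [e [s [[h1 _ _] hal]]]; rewrite hal /SB mem_cat; have hi := ltn_ord (s i).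
case: ifP => h; apply/orP; [right|left]; last by apply/EseqP; apply: h1; lia.
apply/allpairsP; exists (e (s i), - e (s i).+1); split=> //; apply/EseqP; last apply: isE_opp;
  apply: h1; lia.
Qed.

Lemma SB_sign (al : 'I_n -> Lam) v : Chf kd ws true (@SB N) al -> v \in PhiB -> qpos al v \/ qpos al (- v).
Proof.
move=> [e [s [he hal]]].
have hd p : (p.+1 < N)%N -> qpos al (e p - e p.+1).
  by move=> hp; have := qpos_S hal (p := p); rewrite /SB hp; apply; lia.
have hp p : (p < N)%N -> qpos al (e p).
  move=> hp; have -> : e p = (e p - e N.-1) + e N.-1 by rewrite subrK.
  apply: qposD; first by apply: qpos_diff => //; lia.
  by have := qpos_S hal (p := N.-1); rewrite /SB; dnat; apply; lia.
rewrite mem_cat => /orP[/EseqP hv|/allpairsP[[u1 u2] /= [/EseqP hu1 /EseqP hu2 ->]]].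
  case: (he) => _ h2 _; have [p [hpN [->|[_ ->]]]] := h2 _ hv; [left; exact: hp|right].
  by rewrite opprK; exact: hp.
apply: (sign_coherent he (c := fun _ _ => true)) => // p q h1 h2 _.
by apply: qposD; exact: hp.
Qed.

Lemma SB_root (al : 'I_n -> Lam) i : Chf kd ws true (@SB N) al ->
  (B (al i) (al i) = 0 /\ P (al i)) \/ (2 <= `|B (al i) (al i)|)%N.
Proof.
move=> [e [s [he hal]]]; rewrite hal /SB; have := ltn_ord (s i) => hi.
case: ifP => h; bil he; rewrite /wsg ws2; repeat (match goal with |- context [P ?v] => case: (P v) end); first [by left | by right].
Qed.

Lemma SB_reflect (al : 'I_n -> Lam) i : Chf kd ws true (@SB N) al -> exists m : 'I_n -> nat,
  (forall j, j != i -> rcond B P (al i) (al j) (m j)) /\ Chf kd ws true (@SB N) (refl al i m).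
Proof.
apply: Chf_refl => e p he; have hp : (p < N)%N by rewrite -nN.
have [e' [m [h1 h2 h3]]] := SB_refl hws he hp.
exists e', 1%g, m; split=> //; first by rewrite perm1.
by move=> q qp; rewrite perm1; apply: h3 => //; rewrite -nN.
Qed.
End BType.

Section CType.
Hypotheses (nN : n = N) (N1 : (1 < N)%N).
(** Doubled delta vectors are roots, doubled epsilon vectors are excluded: at a fork, twice the last
    vector is a difference of two simple roots, hence neither positive nor negative. *)
Definition condC u v := (u != v) || P u.
Definition PhiC : seq Lam :=
  [seq x.1 + x.2 | x <- [seq (u, v) | u <- Eseq N true, v <- Eseq N true] & condC x.1 x.2].

Lemma SC_indep (al : 'I_n -> Lam) : Chf kd ws true (SC kd) al -> indep al.
Proof.
move=> [e [s [he hal]]]; apply: (indep_frame he hal) => p hp.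
have Ldiff k q : (k < N)%N -> (q.+1 < N)%N -> Lco kd ws e k (e q - e q.+1) = if q == k then ws else 0.
  move=> hk hq; rewrite LcoD LcoN !(Lco_e he); try lia.
  by case: (ltngtP q k) => h; dnat; rewrite ?subrr ?subr0.
have ws20 : ws + ws != 0 by case: hws => ->.
have [E|E] : p.+2 <> N \/ p.+2 = N by lia.
  exists (Lco kd ws e p); split; first exact: LcoD.
  - move=> q hq qp; rewrite /SC; case: (ltnP q.+1 N) => hq1.
      by rewrite Ldiff; [dnat|lia|lia].
    by case: ifP => _; rewrite LcoD !(Lco_e he); try lia; dnat.
  - rewrite /SC; case: (ltnP p.+1 N) => hp1; first by rewrite Ldiff; [dnat|lia|lia].
    by case: ifP => _; rewrite LcoD !(Lco_e he); try lia; dnat.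
(* A functional for the next to last node must also kill the end node. On a fork the partial sum up
   to [p] gives [ws] and the full sum gives twice that, whence the correction; twice a delta vector
   is already killed. *)
exists (fun v => Lco kd ws e p v + Lco kd ws e p v - (if P (e N.-1) then 0 else Lco kd ws e N.-1 v)); split.
- by move=> u v; rewrite !LcoD; case: ifP => _; ring.
- move=> q hq qp; rewrite /SC; case: (ltnP q.+1 N) => hq1.
    by rewrite !Ldiff; try lia; dnat; rewrite if_same.
  have -> : N.-1 = q by lia.
  by case: ifP => _; rewrite !LcoD !(Lco_e he); try lia; dnat; rewrite ?addr0 ?add0r ?subrr.
- rewrite /SC; case: (ltnP p.+1 N) => hp1; last lia.
  by rewrite !Ldiff; try lia; dnat; rewrite if_same subr0.
Qed.

Lemma SC_simple (al : 'I_n -> Lam) i : Chf kd ws true (SC kd) al -> al i \in PhiC.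
Proof.
move=> [e [s [he hal]]]; case: (he) => h1 _ _; rewrite hal /SC; have hi := ltn_ord (s i).
have M u v : isE true u -> isE true v -> condC u v -> u + v \in PhiC.
  move=> hu hv huv; apply/mapP; exists (u, v) => //; rewrite mem_filter huv /=.
  by apply/allpairsP; exists (u, v); split=> //; apply/EseqP.
case: ifP => h.
  apply: M; [apply: h1; lia|apply: isE_opp; apply: h1; lia|].
  by rewrite /condC (frame_neq ws0 he _ _ _).2 //; lia.
case: ifP => hP; apply: M; try (apply: h1; lia); first by rewrite /condC hP orbT.
by rewrite /condC (frame_neq ws0 he _ _ _).1 //; lia.
Qed.

Lemma SC_sign (al : 'I_n -> Lam) v : Chf kd ws true (SC kd) al -> v \in PhiC -> qpos al v \/ qpos al (- v).
Proof.
move=> [e [s [he hal]]].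
have hS p : (p < N)%N -> qpos al (SC kd e p).
  by move=> hp; apply: (qpos_S (S := SC kd) hal); rewrite nN.
have hd p : (p.+1 < N)%N -> qpos al (e p - e p.+1).
  by move=> hp; have := hS p (ltnW hp); rewrite /SC hp.
have hl : qpos al (if P (e N.-1) then e N.-1 + e N.-1 else e N.-2 + e N.-1).
  by have := hS N.-1; rewrite /SC; dnat; apply; lia.
have hlt p q : (p < q)%N -> (q < N)%N -> qpos al (e p + e q).
  move=> pq hq; case E : (P (e N.-1)); rewrite E in hl.
    have -> : e p + e q = (e p - e N.-1) + (e q - e N.-1) + (e N.-1 + e N.-1) by vec.
    by apply: qposD => //; apply: qposD; apply: qpos_diff => //; lia.
  have -> : e p + e q = (e p - e N.-2) + (e q - e N.-1) + (e N.-2 + e N.-1) by vec.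
  by apply: qposD => //; apply: qposD; apply: qpos_diff => //; lia.
case/mapP=> [[u1 u2]]; rewrite mem_filter => /andP[hc /allpairsP[[x y] /= [/EseqP hu1 /EseqP hu2 [e1 e2]]] ->].
rewrite /= in hc *; subst u1 u2.
apply: (sign_coherent he (c := condC)) => //.
  by move=> u' v'; rewrite /condC eqr_opp PambN.
move=> p q hp hq; case: (ltngtP p q) => pq; first by move=> _; exact: hlt.
  by move=> _; rewrite addrC; exact: hlt.
rewrite pq /condC eqxx /= => hP; case: (eqVneq q N.-1) => eq.
  by move: hl; rewrite -eq hP.
have -> : e q + e q = (e q - e N.-1) + (e q + e N.-1) by vec.
apply: qposD; first by apply: qpos_diff => //; lia.
by apply: hlt; lia.
Qed.

Lemma SC_root (al : 'I_n -> Lam) i : Chf kd ws true (SC kd) al ->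
  (B (al i) (al i) = 0 /\ P (al i)) \/ (2 <= `|B (al i) (al i)|)%N.
Proof.
move=> [e [s [he hal]]]; rewrite hal /SC; have := ltn_ord (s i) => hi.
case: ifP => h; last case: ifP => hP; bil he; rewrite /wsg; repeat (match goal with |- context [P ?v] => case: (P v) end); case: hws => ->;
  first [by left | by right].
Qed.

Lemma SC_reflect (al : 'I_n -> Lam) i : Chf kd ws true (SC kd) al -> exists m : 'I_n -> nat,
  (forall j, j != i -> rcond B P (al i) (al j) (m j)) /\ Chf kd ws true (SC kd) (refl al i m).
Proof.
apply: Chf_refl => e p he; have hp : (p < N)%N by rewrite -nN.
case: (ltnP p.+1 N) => hp1.
  have [m [h2 h3]] := SC_refl_swp hws he hp1.
  exists (swp p e), 1%g, m; split=> //; [exact: frame_swp|by rewrite perm1|].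
  by move=> q qp; rewrite perm1; apply: h3 => //; rewrite -nN.
have hpN : p.+1 = N by lia.
have [e' [t [m [h1 ht h2 h3]]]] := SC_refl_last hws he hpN N1.
have p1n : (p.-1 < n)%N by have := ltn_ord p; lia.
have [t' ht'] : exists t' : {perm 'I_n}, forall q : 'I_n, t' q = t q :> nat.
  case: ht => [->|->]; first by exists 1%g => q; rewrite perm1.
  exists (tperm p (Ordinal p1n)) => q; case: tpermP => [->|->|/eqP n1 /eqP n2].
  - by rewrite eqxx.
  - by rewrite /=; case: eqP => [E|_]; [rewrite E|rewrite eqxx].
  - by rewrite -val_eqE /= in n1; rewrite -val_eqE /= in n2; rewrite (negbTE n1) (negbTE n2).
exists e', t', m; split=> //; first by rewrite ht'.
by move=> q qp; rewrite ht'; apply: h3 => //; rewrite -nN.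
Qed.
End CType.

End Chambers.

Section FamilyFrame.
Variables (N : nat) (kd : 'I_N -> bool) (ord : seq 'I_N) (sg : 'I_N -> int) (a0 : 'I_N).
Hypothesis po : perm_eq ord (enum 'I_N).
Variables (sgn : bool) (ws : int).
Hypothesis hsg : forall a, sg a = 1 \/ (sgn /\ sg a = -1).
Local Notation Lam := {ffun 'I_N -> int}.

Definition fo p := nth a0 ord p.
Definition fe (p : nat) : Lam := [ffun b => sg (fo p) * evec (fo p) b].

Lemma size_ord_seq : size ord = N. Proof. by rewrite (perm_size po) size_enum_ord. Qed.

Lemma feE p : fe p = eps (fo p) \/ (sgn /\ fe p = - eps (fo p)).
Proof.
case: (hsg (fo p)) => [h|[hs h]]; [left|right; split=> //]; apply/ffunP => b; rewrite !ffunE h.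
  by rewrite mul1r.
by rewrite mulN1r.
Qed.

Lemma fe_frame : frame kd ws sgn fe.
Proof.
split.
- by move=> p _; exists (fo p); exact: feE.
- move=> v [a ha]; exists (index a ord).
  have aord : a \in ord by rewrite (perm_mem po) mem_enum.
  split; first by rewrite -{2}size_ord_seq index_mem.
  have fa : fo (index a ord) = a by exact: nth_index.
  have := feE (index a ord); rewrite fa; case: ha => [->|[hs ->]].
    by case=> [->|[hs ->]]; [left|right; rewrite opprK].
  by case=> [->|[_ ->]]; [right|left].
move=> p q hp hq pq; have ne : fo p != fo q.
  by rewrite /fo nth_uniq ?size_ord_seq // (perm_uniq po) enum_uniq.
by case: (feE p) => [->|[_ ->]]; case: (feE q) => [->|[_ ->]];
  rewrite ?BambN ?BambNr B_eps (negbTE ne) ?oppr0.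
Qed.

Lemma size_sdiffs : size (sdiffs ord sg) = N.-1.
Proof. by rewrite size_map size_zip size_behead size_ord_seq; lia. Qed.

Lemma nth_sdiffs p : (p.+1 < N)%N ->
  [ffun a => nth (fun _ => 0) (sdiffs ord sg) p a] = fe p - fe p.+1.
Proof.
move=> hp; apply/ffunP => b; rewrite !ffunE (nth_map (a0, a0)); last first.
  by rewrite size_zip size_behead size_ord_seq; lia.
rewrite nth_zip_cond size_zip size_behead size_ord_seq.
have -> : (p < minn N N.-1)%N by lia.
by rewrite /= nth_behead.
Qed.

Lemma rev_ord : (0 < N)%N -> exists r, rev ord = fo N.-1 :: r.
Proof.
move=> h; have := size_ord_seq; rewrite /fo; case/lastP: (ord) => [|r l]; first by move=> /=; lia.
rewrite rev_rcons size_rcons => e; have -> : N.-1 = size r by lia.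
by exists (rev r); rewrite nth_rcons ltnn eqxx.
Qed.

Lemma rev_ord2 : (1 < N)%N -> exists r, rev ord = fo N.-1 :: fo N.-2 :: r.
Proof.
move=> h; have := size_ord_seq; rewrite /fo; case/lastP: (ord) => [|r l]; first by move=> /=; lia.
case/lastP: r => [|r l']; first by move=> /=; lia.
rewrite !rev_rcons !size_rcons => e.
have -> : N.-1 = (size r).+1 by lia. rewrite /=.
exists (rev r); rewrite !nth_rcons !size_rcons. by rewrite !ltnn !eqxx ltnSn.
Qed.

End FamilyFrame.

Theorem family_max n (D : datum n) (w : word n) : family_datum D ->
  dominant D w -> ismax (rW D w) w /\ ismax (EW D w) w.
Proof.
case=> t [m [k [N [kd [ord [sg [s [po hsg hn ht [hg hp _ hb]]]]]]]]].
have [N0 N1] : (0 < N)%N /\ (t <> TB -> (1 < N)%N).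
  clear - ht; case: t ht => [[h1 h2 _ _]|[h1 _]|[[h1 [_ [h2 _]]]|[h1 [h2 _]]]]; split=> //; try (clear - h1 h2; lia).
  by clear - h1; lia.
pose a0 : 'I_N := Ordinal N0.
set ws : int := if t is TB then 2 else 1 in hg hp hb.
have hws : ws = 1 \/ ws = 2 by rewrite /ws; case: (t); [left|right|left].
set L := sroots kd t ord sg in hn hg hp.
pose al i : {ffun 'I_N -> int} := [ffun a => nth (fun _ => 0) L (s i) a].
have hgram i j : gram D i j = Bamb kd ws (al i) (al j).
  by rewrite hg; apply: eq_bigr => a _; rewrite !ffunE /wsg.
have hpar i : par D i = Pamb kd (al i).
  by rewrite hp; congr (odd (absz _)); apply: eq_bigr => a _; rewrite ffunE.
have szd := size_sdiffs sg po.
(* In type B the form is scaled by 2, which supplies the evenness demanded where the bar map carries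
   a sign. *)
have hev : barpi D -> forall i j, exists z, gram D i j = z * 2.
  rewrite hb => h i j; have e2 : ws = 2 by move: h; rewrite /ws; case: (t).
  exists (Bamb kd 1 (al i) (al j)); rewrite hgram e2 /Bamb mulr_suml; apply: eq_bigr => a _.
  by rewrite /wsg; case: (kd a); ring.
have BC := BambC kd ws; have BD := BambD kd ws; have PD := PambD kd.
clear hg hp hb BC BD.
case: t ht @ws hws @L hn @al hgram hpar hev N1 => ht ws hws L hn al hgram hpar hev N1;
  have BC := BambC kd ws; have BD := BambD kd ws.
- have [_ _ _ sg1] := ht.
  have hsg' a : sg a = 1 \/ (false /\ sg a = -1) by left.
  have he := fe_frame kd a0 po ws hsg'.
  have nN : n.+1 = N by rewrite -hn /L /sroots cats0 szd; clear - N0; lia.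
  apply: (@form_max _ (Bamb kd ws) (Pamb kd) BC BD PD n D (Chf kd ws false (@SA N)) (PhiA N) al) => //.
  + by move=> al' i; exact: SA_reflect.
  + by move=> al'; exact: SA_indep.
  + by move=> al' i; exact: SA_simple.
  + by move=> al' v; exact: SA_sign.
  + exists (fe ord sg a0), s; split=> // i.
    rewrite /SA -(nth_sdiffs _ a0 po); last by have := ltn_ord (s i); clear - nN; lia.
    by rewrite /al /L /sroots cats0.
  + by move=> al' i; exact: SA_root.
- have hsg' a : sg a = 1 \/ (true /\ sg a = -1) by case: (hsg a); [left|right].
  have he := fe_frame kd a0 po ws hsg'.
  have [r er] := rev_ord a0 po N0.
  have nN : n = N by rewrite -hn /L /sroots er size_cat szd /=; clear - N0; lia.
  apply: (@form_max _ (Bamb kd ws) (Pamb kd) BC BD PD n D (Chf kd ws true (@SB N)) (PhiB N) al) => //.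
  + by move=> al' i; exact: SB_reflect.
  + by move=> al'; exact: SB_indep.
  + by move=> al' i; exact: SB_simple.
  + by move=> al' v; exact: SB_sign.
  + exists (fe ord sg a0), s; split=> // i; rewrite /SB /al /L /sroots er.
    case: ltnP => hi.
      rewrite -(nth_sdiffs _ a0 po) //; apply/ffunP => a; rewrite !ffunE nth_cat szd.
      by have -> : (s i < N.-1)%N by clear - hi; lia.
    have ei : nat_of_ord (s i) = N.-1 by have := ltn_ord (s i); clear - hi nN; lia.
    by apply/ffunP => a; rewrite !ffunE nth_cat szd ei ltnn subnn.
  + by move=> al' i; exact: SB_root.
- have hsg' a : sg a = 1 \/ (true /\ sg a = -1) by case: (hsg a); [left|right].
  have he := fe_frame kd a0 po ws hsg'; have {}N1 : (1 < N)%N by exact: N1.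
  have [r er] := rev_ord2 a0 po N1.
  have nN : n = N by rewrite -hn /L /sroots er size_cat szd /=; clear - N0; lia.
  apply: (@form_max _ (Bamb kd ws) (Pamb kd) BC BD PD n D (Chf kd ws true (SC kd)) (PhiC kd) al) => //.
  + by move=> al' i; exact: SC_reflect.
  + by move=> al'; exact: SC_indep.
  + by move=> al' i; exact: SC_simple.
  + by move=> al' v; exact: SC_sign.
  + exists (fe ord sg a0), s; split=> // i; rewrite /SC /al /L /sroots er.
    case: ltnP => hi.
      rewrite -(nth_sdiffs _ a0 po) //; apply/ffunP => a; rewrite !ffunE nth_cat szd.
      by have -> : (s i < N.-1)%N by clear - hi; lia.
    have ei : nat_of_ord (s i) = N.-1 by have := ltn_ord (s i); clear - hi nN; lia.
    have eP p : Pamb kd (fe ord sg a0 p) = kd (fo ord a0 p).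
      by case: (feE ord a0 hsg' p) => [->|[_ ->]]; rewrite ?PambN P_eps.
    rewrite ei eP; case: ifP => hk; apply/ffunP => a; rewrite !ffunE nth_cat szd ltnn subnn /= ?ffunE; ring.
  + by move=> al' i; exact: SC_root.
Qed.

(** * Types F(3|1) and G(3) *)

Section States.
Variable n : nat.

(* Gram matrix, parities and positive roots of a labelled simple system *)
Definition state : Type := (seq (seq int) * seq bool * seq (seq int))%type.
Implicit Types (t : state) (c : seq int) (i j k : nat).

Definition gr t i j : int := nth 0 (nth [::] t.1.1 i) j.
Definition pr_ t i : bool := nth false t.1.2 i.
Definition rts t : seq (seq int) := t.2 ++ [seq [seq - x | x <- c] | c <- t.2].
(** Absolute values suffice for the computation; that the signs fit is part of the test [rcb] in
    [step]. *)
Definition mst t i j : nat :=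
  if gr t i i == 0 then (gr t i j != 0 : nat) else ((2 * `|gr t i j|) %/ `|gr t i i|)%N.
Definition isum (f : nat -> int) : int := foldr (fun k x => f k + x) 0 (iota 0 n).

(** Change of coordinates between a simple system and its reflection: substituting
    [al j = al' j - m j al i] and [al i = - al' i] alters only the coordinate at [i]. The formula is
    the same in both directions. *)
Definition rcoef t i c : seq int := mkseq (fun j =>
  if j == i then isum (fun k => if k == i then 0 else (mst t i k)%:Z * nth 0 c k) - nth 0 c i
  else nth 0 c j) n.

Definition rgr t i a b : int :=
  let s j : int := if j == i then 0 else 1 in
  let m j : int := if j == i then -1 else (mst t i j)%:Z in
  s a * s b * gr t a b + s a * m b * gr t a i + m a * s b * gr t i b + m a * m b * gr t i i.

Definition rpr t i a : bool :=
  if a == i then pr_ t i else pr_ t a (+) (pr_ t i && odd (mst t i a)).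

Definition rstate i t : state :=
  (mkseq (fun a => mkseq (rgr t i a) n) n, mkseq (rpr t i) n,
   [seq (let d := rcoef t i c in if all (fun x => 0 <= x) d then d else [seq - x | x <- d]) | c <- t.2]).

Definition ni := iota 0 n.

(** A computable certificate that [t'] describes the reflection of [t] at [i]. Roots are compared
    together with their opposites, since the reflection changes some signs. *)
Definition step t i t' : bool :=
  [&& all (fun j => (j == i) || rcb (gr t i i) (gr t i j) (pr_ t i) (mst t i j)) ni,
      all (fun a => all (fun b => gr t' a b == rgr t i a b) ni) ni,
      all (fun a => pr_ t' a == rpr t i a) ni,
      all (fun c => rcoef t i c \in rts t') (rts t) &
      all (fun c => rcoef t i c \in rts t) (rts t')].

Definition good t : bool :=
  [&& all (fun i => all (fun j => gr t i j == gr t j i) ni) ni,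
      all (fun i => ((gr t i i == 0) && pr_ t i) || (2 <= `|gr t i i|)%N) ni,
      all (fun i => mkseq (fun j => (j == i)%:Z) n \in t.2) ni &
      all (all (fun x => 0 <= x)) t.2].

Definition closed_states (ts : seq state) : bool :=
  all (fun t => good t && all (fun i => has (step t i) ts) ni) ts.

End States.

(** * From a closed list of states to the simple systems it describes *)

Section Explicit.
Variables (n : nat) (t0 : state) (ts : seq state).
Hypotheses (hts : closed_states n ts) (ht0 : t0 \in ts).
Variable s : {perm 'I_n}.
Local Notation Lam := {ffun 'I_n -> int}.
Implicit Types (al : 'I_n -> Lam) (i j k : 'I_n) (c : seq int) (u v : Lam).

Definition Bex u v : int := \sum_i \sum_j u i * v j * gr t0 i j.
Definition Pex u : bool := Pamb (fun i : 'I_n => pr_ t0 i) u.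
Local Notation B := Bex.
Local Notation P := Pex.

Lemma mem_ni i : (i : nat) \in ni n. Proof. by rewrite mem_iota ltn_ord. Qed.

Lemma ts_good t : t \in ts -> good n t.
Proof. by move=> h; have /andP[] := allP hts _ h. Qed.

Lemma gr_sym t i j : t \in ts -> gr t i j = gr t j i.
Proof. by move/ts_good/and4P => [h _ _ _]; apply/eqP; exact: (allP (allP h _ (mem_ni i)) _ (mem_ni j)). Qed.

Lemma BexC u v : B u v = B v u.
Proof.
rewrite /B exchange_big; apply: eq_bigr => i _; apply: eq_bigr => j _.
by rewrite (gr_sym _ _ ht0) [u j * _]mulrC.
Qed.
Lemma BexD u v w : B (u + v) w = B u w + B v w.
Proof.
rewrite /B -big_split /=; apply: eq_bigr => i _; rewrite -big_split /=; apply: eq_bigr => j _.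
by rewrite ffunE; ring.
Qed.
Lemma BexN u w : B (- u) w = - B u w.
Proof.
rewrite /B -sumrN /=; apply: eq_bigr => i _; rewrite -sumrN /=; apply: eq_bigr => j _.
by rewrite ffunE; ring.
Qed.
Lemma PexD u v : P (u + v) = P u (+) P v. Proof. exact: PambD. Qed.

Lemma BexMn u v m : B (u *+ m) v = m%:Z * B u v.
Proof.
elim: m => [|m IH]; last by rewrite mulrS BexD IH -add1n PoszD mulrDl mul1r.
rewrite mulr0n mul0r; have := BexD 0 0 v; rewrite addr0 => /eqP.
by rewrite -subr_eq0 opprD addNKr oppr_eq0 => /eqP.
Qed.
Lemma PexMn u m : P (u *+ m) = P u && odd m.
Proof.
elim: m => [|m IH]; last by rewrite mulrS PexD IH /=; case: (P u); case: (odd m).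
rewrite mulr0n andbF; have := PexD 0 0; rewrite addr0; by case: (P 0).
Qed.

Definition lc al c : Lam := \sum_i al i *~ nth 0 c (s i).
Definition al0 i : Lam := eps (s i).
Definition Phix : seq Lam := [seq lc al0 c | c <- rts t0].

(** The vectors [al] are tied to a state only through Gram matrix, parities and root coordinates,
    because distinct simple systems may share one state. *)
Definition Chx al := indep al /\ exists t, [/\ t \in ts,
  forall i j, B (al i) (al j) = gr t (s i) (s j), forall i, P (al i) = pr_ t (s i),
  forall v, v \in Phix -> exists2 c, c \in rts t & v = lc al c &
  forall c, c \in rts t -> lc al c \in Phix].

Lemma isumE (f : nat -> int) : isum n f = \sum_(k < n) f (s k).
Proof.
have -> : isum n f = \sum_(k < n) f k; last exact: (reindex_inj (@perm_inj _ s)).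
rewrite /isum -(big_mkord xpredT f) /index_iota subn0.
by elim: (iota 0 n) => [|k r IH]; rewrite ?big_nil // big_cons /= IH.
Qed.

Lemma lc_refl al t i c :
  lc (refl al i (fun j => mst t (s i) (s j))) c = lc al (rcoef n t (s i) c).
Proof.
rewrite /lc (bigD1 i) //= [in RHS](bigD1 i) //= /refl eqxx.
rewrite nth_mkseq ?ltn_ord // eqxx isumE /= mulrzBr.
rewrite mulrz_sumr mulNrz [in RHS]addrAC addrC; congr (_ - _).
rewrite [X in _ = X + _](bigD1 i) //= eqxx mulr0z add0r -big_split /=; apply: eq_bigr => j ji.
rewrite nth_mkseq ?ltn_ord // (negbTE ji).
have -> : (nat_of_ord (s j) == s i) = false by rewrite val_eqE (inj_eq perm_inj) (negbTE ji).
by rewrite mulrzDl pmulrn -mulrzA addrC.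
Qed.

Lemma Chx_refl al i : Chx al -> exists m : 'I_n -> nat,
  (forall j, j != i -> rcond B P (al i) (al j) (m j)) /\ Chx (refl al i m).
Proof.
case=> hI [t [tts hB hP h1 h2]]; exists (fun j => mst t (s i) (s j)).
have /andP[_ /allP/(_ _ (mem_ni (s i)))/hasP[t' t'ts]] := allP hts _ tts.
case/and5P => k1 k2 k3 k4 k5; split.
  move=> j ji; have := allP k1 _ (mem_ni (s j)).
  rewrite val_eqE (inj_eq perm_inj) (negbTE ji) /= -!hB -hP.
  case/orP => [/andP[/andP[/eqP q1 q2] /eqP q3]|/and3P[q1 /eqP q2 q3]]; first by left.
  by right.
split; first exact: indep_refl.
exists t'; split=> //.
- move=> a b; rewrite (eqP (allP (allP k2 _ (mem_ni (s a))) _ (mem_ni (s b)))) /rgr /refl.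
  rewrite !val_eqE !(inj_eq perm_inj).
  case: (eqVneq a i) => [->|ai]; case: (eqVneq b i) => [->|bi].
  + by rewrite BexN BexC BexN hB; ring.
  + by rewrite BexN BexC BexD BexMn BexC hB [B (al i) _]hB; ring.
  + by rewrite BexC BexN BexC BexD BexMn !hB; ring.
  + rewrite BexD BexMn BexC BexD BexMn [B (al i) (_ + _)]BexC BexD BexMn !hB.
    by rewrite (gr_sym (s b) (s a) tts) (gr_sym (s b) (s i) tts) (gr_sym (s i) (s a) tts); ring.
- move=> a; rewrite (eqP (allP k3 _ (mem_ni (s a)))) /rpr /refl val_eqE (inj_eq perm_inj).
  case: (eqVneq a i) => _; first by rewrite /P PambN -/(P _) hP.
  by rewrite PexD PexMn !hP.
- move=> v /h1[c ct ->]; exists (rcoef n t (s i) c); first exact: (allP k4).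
  have := lc_refl (refl al i (fun j => mst t (s i) (s j))) t i c; rewrite /lc => <-.
  apply: eq_bigr => j _; congr (_ *~ _); rewrite /refl eqxx.
  by case: eqP => [->|_]; rewrite ?opprK // mulNrn addrK.
- move=> c /(allP k5) hc; rewrite lc_refl; exact: h2.
Qed.

Lemma lc_unit al i : lc al (mkseq (fun x : nat => (x == s i)%:Z) n) = al i.
Proof.
rewrite /lc (bigD1 i) //= nth_mkseq ?ltn_ord // eqxx mulr1z big1 ?addr0 // => j ji.
by rewrite nth_mkseq ?ltn_ord // val_eqE (inj_eq perm_inj) (negbTE ji).
Qed.

Lemma lc_opp al c : lc al [seq - x | x <- c] = - lc al c.
Proof.
rewrite /lc -sumrN; apply: eq_bigr => i _; rewrite -mulrNz; congr (_ *~ _).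
by case: (ltnP (s i) (size c)) => h; [rewrite (nth_map 0)|rewrite !nth_default ?size_map ?oppr0].
Qed.

Lemma Chx_simple al i : Chx al -> al i \in Phix.
Proof.
case=> _ [t [tts _ _ _ h2]]; rewrite -(lc_unit al i); apply: h2.
rewrite mem_cat; apply/orP; left; have /and4P[_ _ h _] := ts_good tts.
exact: (allP h _ (mem_ni (s i))).
Qed.

Lemma qpos_lc al c : all (fun x => 0 <= x) c -> qpos al (lc al c).
Proof.
move=> h; rewrite /lc; elim/big_rec: _ => [|i v _ hv]; first by exists [::]; rewrite wta_nil.
apply: qposD => //; have : 0 <= nth 0 c (s i).
  by case: (ltnP (s i) (size c)) => hi; [apply: (allP h); exact: mem_nth|rewrite nth_default].
case: (nth 0 c (s i)) => // x _; rewrite -pmulrn; apply: qposM; exact: qpos_simple.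
Qed.

Lemma Chx_sign al v : Chx al -> v \in Phix -> qpos al v \/ qpos al (- v).
Proof.
case=> _ [t [tts _ _ h1 _]] /h1[c + ->]; have /and4P[_ _ _ /allP hp] := ts_good tts.
rewrite mem_cat => /orP[/hp h|/mapP[d /hp h ->]]; [left|right]; first exact: qpos_lc.
by rewrite lc_opp opprK; exact: qpos_lc.
Qed.

Lemma Chx_root al k : Chx al -> (B (al k) (al k) = 0 /\ P (al k)) \/ (2 <= `|B (al k) (al k)|)%N.
Proof.
case=> _ [t [tts hB hP _ _]]; rewrite hB hP; have /and4P[_ h _ _] := ts_good tts.
by case/orP: (allP h _ (mem_ni (s k))) => [/andP[/eqP ? ?]|?]; [left|right].
Qed.

Lemma B_al0 i j : B (al0 i) (al0 j) = gr t0 (s i) (s j).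
Proof.
have z k l : k != s l -> al0 l k = 0 by move=> h; rewrite ffunE /evec eq_sym (negbTE h).
have o l : al0 l (s l) = 1 by rewrite ffunE /evec eqxx.
rewrite /B (bigD1 (s i)) //= [X in _ + X]big1 ?addr0 => [|a ai].
  rewrite (bigD1 (s j)) //= [X in _ + X]big1 ?addr0 => [|b bj]; last by rewrite (z b j) // mulr0 mul0r.
  by rewrite !o !mul1r.
by apply: big1 => b _; rewrite (z a i) // !mul0r.
Qed.

Lemma Chx_al0 : Chx al0.
Proof.
split.
  apply: indep_dual => k; exists (fun v : Lam => v (s k)); split=> [u v|j jk|].
  - by rewrite ffunE.
  - by rewrite ffunE /evec (inj_eq perm_inj) (negbTE jk).
  - by rewrite ffunE /evec eqxx.
exists t0; split=> //.
- exact: B_al0.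
- by move=> i; exact: P_eps.
- by move=> v /mapP[c ct ->]; exists c.
- by move=> c ct; apply: map_f.
Qed.

Theorem states_max (D : datum n) (w : word n) :
  (forall i j, gram D i j = gr t0 (s i) (s j)) -> (forall i, par D i = pr_ t0 (s i)) ->
  barpi D = false -> dominant D w -> ismax (rW D w) w /\ ismax (EW D w) w.
Proof.
move=> hg hp hb; apply: (@form_max _ Bex Pex BexC BexD PexD n D Chx Phix al0).
- by move=> al i; exact: Chx_refl.
- by move=> al [].
- by move=> al i; exact: Chx_simple.
- by move=> al v; exact: Chx_sign.
- exact: Chx_al0.
- by move=> i j; rewrite hg B_al0.
- by move=> i; rewrite hp; apply/esym; exact: P_eps.
- by rewrite hb.
- by move=> al k; exact: Chx_root.
Qed.

End Explicit.

Fixpoint walk n (t : state) (r : seq nat) : seq state :=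
  if r is i :: r' then t :: walk n (rstate n i t) r' else [:: t].

(* the labelled simple systems reachable by odd reflections from the distinguished one *)
Definition G3_state : state := (G3_gram, G3_par, G3_pos).
Definition G3_states : seq state := walk 3 G3_state [:: 0; 1; 2]%N.
Definition F4_state : state := (F4_gram, F4_par, F4_pos).
(** Six states: five along one chain of reflections, and one branching off after the third step.
    That reflections in all nodes stay within the list is checked by computation in [F4_closed]. *)
Definition F4_states : seq state :=
  walk 4 F4_state [:: 3; 2; 1; 0]%N ++ [:: last F4_state (walk 4 F4_state [:: 3; 2; 1; 3]%N)].

Lemma G3_closed : closed_states 3 G3_states.
Proof. by vm_compute. Qed.

Lemma F4_closed : closed_states 4 F4_states.
Proof. by vm_compute. Qed.

Theorem explicit_max_G3 (D : datum 3) (w : word 3) : explicit_datum D G3_gram G3_par G3_pos ->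
  dominant D w -> ismax (rW D w) w /\ ismax (EW D w) w.
Proof.
case=> s [hg hp _ hb]; apply: (@states_max 3 G3_state G3_states G3_closed _ s) => //.
Qed.

Theorem explicit_max_F4 (D : datum 4) (w : word 4) : explicit_datum D F4_gram F4_par F4_pos ->
  dominant D w -> ismax (rW D w) w /\ ismax (EW D w) w.
Proof.
case=> s [hg hp _ hb]; apply: (@states_max 4 F4_state F4_states F4_closed _ s) => //.
Qed.

Theorem mainTheorem13 (n : nat) (D : datum n) (hD : admissible D) (w : word n) :
  dominant D w -> ismax (rW D w) w /\ ismax (EW D w) w.
Proof.
case: hD => [|[[e]|[e]]]; first exact: family_max.
  by subst n; exact: explicit_max_F4.
by subst n; exact: explicit_max_G3.
Qed.
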